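(* For any finitely connected domain $D\subset\mathbb{C}$ there exists a constant $c>0$ (depending on $D$) such that $$K_D(z)\le\frac{c}{\lambda(I^A_D(z))}\quad\text{for all } z\in D,$$ where $K_D$ is the Bergman kernel of $D$ on the diagonal, $I^A_D(z)$ is the indicatrix of the Azukawa metric of $D$ at $z$, and $\lambda$ is Lebesgue measure on $\mathbb{C}$; if $\lambda(I^A_D(z))=\infty$, the inequality is understood as $K_D(z)=0$.
   Context: A domain is a nonempty connected open set. A domain $D\subset\mathbb{C}$ is finitely connected if its complement in the Riemann sphere $\mathbb{C}\cup\{\infty\}$ has finitely many connected components (single-point components are allowed). For a domain $D\subset\mathbb{C}$: Bergman kernel on the diagonal: $K_D(z)=\sup\{|f(z)|^2 : f \text{ holomorphic on } D,\ \int_D|f|^2\,d\lambda\le 1\}$, where $\lambda$ denotes Lebesgue measure on $\mathbb{C}\cong\mathbb{R}^{2}$. Green function with pole $z\in D$: $g_D(z,w)=\sup u(w)$, the supremum being over all subharmonic functions $u:D\to[-\infty,0)$ (the function $u\equiv-\infty$ being allowed) for which there is a constant $C$ with $u(\zeta)\le \log|\zeta-z|+C$ for $\zeta$ near $z$. Azukawa metric: for $z\in D$, $X\in\mathbb{C}$, $$A_D(z;X)=\limsup_{t\to0,\ t\in\mathbb{C}\setminus\{0\}}\frac{\exp g_D(z,z+tX)}{|t|},$$ with the convention $\exp(-\infty)=0$. Indicatrix of the Azukawa metric at $z\in D$: $I^A_D(z)=\{X\in\mathbb{C}: A_D(z;X)<1\}$ (it may have infinite measure, namely when $A_D(z;\cdot)\equiv0$).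 *)

(* Defs.v *)
From HB Require Import structures.
From mathcomp Require Import all_boot all_order all_algebra complex.
From mathcomp Require Import all_classical all_reals all_analysis.

Set Implicit Arguments.
Unset Strict Implicit.
Unset Printing Implicit Defensive.

Import Order.TTheory GRing.Theory Num.Theory.
Import numFieldNormedType.Exports.

Local Open Scope classical_set_scope.
Local Open Scope ring_scope.

(* R[i] carries the topology and normed-module structure of a [numFieldType]
   over itself, so that [derivable] below is complex differentiability. *)
HB.instance Definition _ (R : realType) := NormedModule.copy R[i] R[i]^o.

(* The norm [`|z|] of [z : R[i]] is an element of [R[i]]; [Normc.normc z] is the
   same number as an element of [R]. *)

Definition domain (R : realType) (D : set R[i]) : Prop :=
  [/\ D !=set0, open D & connected D].

(* [one_point_compactification R[i]] is the Riemann sphere, [None] being the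
   point at infinity. *)
Definition sphere_compl (R : realType) (D : set R[i]) :
    set (one_point_compactification R[i]) :=
  ~` (Some @` D).

Definition finitely_connected (R : realType) (D : set R[i]) : Prop :=
  finite_set (connected_component (sphere_compl D) @` sphere_compl D).

Local Notation lebesgue2 R := (@lebesgue_measure R \x @lebesgue_measure R)%E.

Definition pair_complex (R : realType) (p : R * R) : R[i] := (p.1 +i* p.2)%C.

Definition lambdaC (R : realType) (A : set R[i]) : \bar R :=
  lebesgue2 R (@pair_complex R @^-1` A).

Definition integralC (R : realType) (D : set R[i]) (h : R[i] -> \bar R) : \bar R :=
  (\int[lebesgue2 R]_(p in @pair_complex R @^-1` D) h (pair_complex p))%E.

(* Functions on [D] are represented by total functions, whose values outside [D]
   play no role. *)
Definition holomorphic (R : realType) (D : set R[i]) (f : R[i] -> R[i]) : Prop :=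
  forall z, D z -> derivable f z 1.

Definition bergman_kernel (R : realType) (D : set R[i]) (z : R[i]) : \bar R :=
  ereal_sup [set ((Normc.normc (f z)) ^+ 2)%:E | f in
    [set f | holomorphic D f /\
             (integralC D (fun w => ((Normc.normc (f w)) ^+ 2)%:E) <= 1)%E]].

Definition upper_semicontinuous_on (R : realType) (D : set R[i])
    (u : R[i] -> \bar R) : Prop :=
  forall w (a : R), D w -> (u w < a%:E)%E -> \forall x \near w, D x -> (u x < a%:E)%E.

Definition circle_pt (R : realType) (w : R[i]) (r t : R) : R[i] :=
  w + ((r * cos t) +i* (r * sin t))%C.

(* For [u] upper semicontinuous with values [< +oo], the positive part of [u] is
   bounded on the circle, so the integral is well defined, possibly [-oo]. *)
Definition circle_mean (R : realType) (u : R[i] -> \bar R) (w : R[i]) (r : R) : \bar R :=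
  ((2 * pi)^-1%:E *
   \int[@lebesgue_measure R]_(t in `[0%R, (2 * pi)%R]) u (circle_pt w r t))%E.

(* [u] may be identically [-oo]. *)
Definition subharmonic (R : realType) (D : set R[i]) (u : R[i] -> \bar R) : Prop :=
  [/\ forall w, D w -> (u w < +oo)%E,
      upper_semicontinuous_on D u &
      forall w (r : R), 0 < r -> [set x | Normc.normc (x - w) <= r] `<=` D ->
        (u w <= circle_mean u w r)%E].

(* [lne 0 = -oo], so at the pole [x = z] the bound reads [u z = -oo]. *)
Definition green_competitor (R : realType) (D : set R[i]) (z : R[i])
    (u : R[i] -> \bar R) : Prop :=
  [/\ subharmonic D u,
      forall w, D w -> (u w < 0)%E &
      exists C : R, \forall x \near z, (u x <= lne (Normc.normc (x - z))%:E + C%:E)%E].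

Definition green (R : realType) (D : set R[i]) (z w : R[i]) : \bar R :=
  ereal_sup [set u w | u in green_competitor D z].

(* The values of [green D z] outside the open set [D] do not affect the upper
   limit at [t = 0]; [expeR -oo = 0]. *)
Definition azukawa (R : realType) (D : set R[i]) (z X : R[i]) : \bar R :=
  limf_esup (fun t : R[i] => (expeR (green D z (z + t * X)%R) / (Normc.normc t)%:E)%E)
            (0 : R[i])^'.

Definition azukawa_indicatrix (R : realType) (D : set R[i]) (z : R[i]) : set R[i] :=
  [set X | (azukawa D z X < 1)%E].

(* Main.v *)
Require Import Defs.
From mathcomp Require Import all_boot all_order all_algebra complex.
From mathcomp Require Import all_classical all_reals all_analysis.
From mathcomp Require Import measurable_realfun.
From mathcomp Require Import ring lra.
Set Implicit Arguments.
Unset Strict Implicit.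
Unset Printing Implicit Defensive.
Import Order.TTheory GRing.Theory Num.Theory.
Import numFieldNormedType.Exports.
Local Open Scope classical_set_scope.
Local Open Scope ring_scope.
Local Notation nc := Normc.normc.

(** Both sides are compared with the distance d from z to the fat part of the
    complement, i.e. to the components having more than one point.

    Upper bound for K_D.  For f in the unit ball of L^2, apply Cauchy's formula
    to a rectangle around z of size comparable to d: by Tonelli its sides can be chosen
    so that the integral of |f|^2 along each of them is at most C/d, which gives
    |f(z)| <= C/d.  The finitely many one-point components do not matter:
    f is square integrable there, so its integral around such a point can be made
    arbitrarily small, hence vanishes.  When the fat part is empty, d can be taken
    arbitrarily large, so K_D = 0.  When it is bounded, z is far away and infinity is
    isolated in the complement, the same argument for w f(w) outside a large square
    gives |f(z)| <= C/|z|^2.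

    Upper bound for the indicatrix.  Let p be a point of the complement nearest to z up
    to a factor, E its component, and tau <= d so small that E meets every circle
    |w - p| = r with r <= tau.  If e_j in E has |e_j - p| = j tau / N for j <= N, then
    log |w - z| - (1/N) sum_j log |w - e_j| is bounded above, apart from an error that
    tends to 0 with N at each w in D.  Its upper limit in N, lowered by
    log (3 d / tau) + O(1), is a competitor for the Green function, so the Azukawa metric is
    at least c (tau / d^2) |X|.  Near E one can take tau comparable to d, and far away
    tau is bounded below, which matches |f(z)| <= C/|z|^2. *)

(** * The complex plane in real coordinates *)

(** Near a one-point component neither side of the inequality degenerates, so the distance to the
    whole complement would be the wrong scale; d has to ignore such components. The competitor is
    built without capacities or equilibrium measures. The points e_j are arbitrary choices, one on
    each circle, with no measurability or convergence, so the discrete averages need not converge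
    and an upper limit is taken. It needs no regularisation: all poles lie outside D, hence the
    averages obey a Harnack-type inequality that is uniform in N, and this makes the upper limit
    upper semicontinuous. The sub-mean value inequality follows from Fatou's lemma for the
    negatives. Equal spacing of the radii keeps the average bounded near p: the sum of ln (N / k)
    over k <= N is at most N, a discrete form of the fact that - ln has integral 1 over (0, 1).
    Finiteness enters twice: the one-point components can be avoided by the sides of rectangles, and
    the bounded components with more than one point share one bound for their position and, from
    below, for their size. *)

Section basics.
Variable R : realType.
Implicit Types (z w h : R[i]) (x y : R).

Lemma normCE z : `|z| = (nc z)%:C%C. Proof. by []. Qed.
Lemma nc_ge0 z : 0 <= nc z. Proof. by case: z => x y; exact: sqrtr_ge0. Qed.
Lemma nc0P z : (nc z == 0) = (z == 0).
Proof. apply/eqP/eqP => [/Normc.eq0_normc //|->]; exact: Normc.normc0. Qed.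
Lemma nc_gt0 z : (0 < nc z) = (z != 0).
Proof. by rewrite lt_neqAle nc_ge0 andbT eq_sym nc0P. Qed.
Lemma ncD z w : nc (z + w) <= nc z + nc w. Proof. exact: le_normcD. Qed.
Lemma ncN z : nc (- z) = nc z. Proof. exact: normcN. Qed.
Lemma ncC z w : nc (z - w) = nc (w - z). Proof. by rewrite -ncN opprB. Qed.
Lemma ncB z w : nc (z - w) <= nc z + nc w.
Proof. by rewrite -(ncN w); exact: ncD. Qed.
Lemma nc_dist_triangle w z u : nc (z - u) <= nc (z - w) + nc (w - u).
Proof. by have := ncD (z - w) (w - u); rewrite addrA subrK. Qed.
Lemma ncM z w : nc (z * w) = nc z * nc w. Proof. exact: Normc.normcM. Qed.
Lemma ncV z : nc z^-1 = (nc z)^-1. Proof. exact: Normc.normcV. Qed.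
Lemma nc_real x : nc x%:C%C = `|x|.
Proof. by rewrite /nc /= expr0n addr0 sqrtr_sqr. Qed.
Lemma nc_sqr z : nc z ^+ 2 = complex.Re z ^+ 2 + complex.Im z ^+ 2.
Proof. by case: z => x y; rewrite /nc /= sqr_sqrtr // addr_ge0 ?sqr_ge0. Qed.
Lemma Re_le_nc z : `|complex.Re z| <= nc z.
Proof.
rewrite -(@ler_pXn2r _ 2) ?nnegrE ?nc_ge0 ?normr_ge0 // nc_sqr real_normK ?num_real //.
by rewrite lerDl sqr_ge0.
Qed.
Lemma Im_le_nc z : `|complex.Im z| <= nc z.
Proof.
rewrite -(@ler_pXn2r _ 2) ?nnegrE ?nc_ge0 ?normr_ge0 // nc_sqr real_normK ?num_real //.
by rewrite lerDr sqr_ge0.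
Qed.
Lemma nc_le_ReIm z : nc z <= `|complex.Re z| + `|complex.Im z|.
Proof.
rewrite -(@ler_pXn2r _ 2) ?nnegrE ?nc_ge0 ?addr_ge0 // nc_sqr sqrrD.
rewrite !real_normK ?num_real // lerD2r lerDl mulrn_wge0 ?mulr_ge0 //.
Qed.

Lemma nbhsC_P (w : R[i]) (P : set R[i]) :
  nbhs w P <-> exists2 e : R, 0 < e & forall z, nc (z - w) < e -> P z.
Proof.
split.
  move=> /nbhs_ballP[e /= e0 eP].
  move: e0 eP; case: e => a b; rewrite ltcE /= => /andP[/eqP -> a0] eP.
  exists a => // z zw; apply: eP; rewrite -ball_normE /= normCE ltcR ncC.
  exact: zw.
move=> [e e0 eP]; apply/nbhs_ballP; exists (e%:C%C); first by rewrite /= ltcR.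
move=> z; rewrite -ball_normE /= => wz; apply: eP; rewrite ncC.
by move: wz; rewrite normCE ltcR.
Qed.

(** Complex differentiability with bounds in [R] and without division, so that the estimates stay in
    the real field. *)
Definition cderiv (f : R[i] -> R[i]) (z l : R[i]) : Prop :=
  forall e : R, 0 < e -> exists2 d : R, 0 < d &
    forall w, nc (w - z) < d -> nc (f w - f z - l * (w - z)) <= e * nc (w - z).

Lemma derivable_cderiv (f : R[i] -> R[i]) z : derivable f z 1 -> exists l, cderiv f z l.
Proof.
rewrite /derivable => /cvg_ex[/= l /cvgrPdist_lt H]; exists l => e e0.
have /H : (0 : R[i]) < e%:C%C by rewrite ltcR.
rewrite near_withinE near_simpl => /nbhsC_P[d d0 Hd].
exists d => // w wz; have [->|wnz] := eqVneq w z.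
  by rewrite !subrr mulr0 subr0 Normc.normc0 mulr0.
have h0 : w - z != 0 by rewrite subr_eq0.
have := Hd (w - z); rewrite subr0 => /(_ wz h0).
rewrite /shift /= normCE ltcR [_ *: 1]mulr1 subrK => /ltW le1.
have -> : f w - f z - l * (w - z) = - ((l - (w - z)^-1 *: (f w - f z)) * (w - z)).
  by rewrite mulrBl /GRing.scale /= mulrAC mulVf // mul1r opprB.
by rewrite ncN ncM; apply: ler_wpM2r => //; exact: nc_ge0.
Qed.

Lemma cderiv_continuous (f : R[i] -> R[i]) z l (e : R) : cderiv f z l -> 0 < e ->
  exists2 d : R, 0 < d & forall w, nc (w - z) < d -> nc (f w - f z) < e.
Proof.
move=> fl e0; have [d d0 Hd] := fl 1 ltr01.
have k0 : 0 < 1 + nc l by rewrite ltr_wpDr ?nc_ge0.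
exists (Num.min d (e / (1 + nc l))); first by rewrite lt_min d0 divr_gt0.
move=> w; rewrite lt_min => /andP[w1 w2].
have -> : f w - f z = (f w - f z - l * (w - z)) + l * (w - z) by rewrite subrK.
apply: (le_lt_trans (ncD _ _)); rewrite ncM.
apply: (@le_lt_trans _ _ ((1 + nc l) * nc (w - z))).
  by rewrite mulrDl lerD2r; apply: Hd.
by rewrite mulrC -ltr_pdivlMr.
Qed.

Lemma itv_sub x u v (a b : R) : a <= u -> v <= b -> u <= x <= v -> a <= x <= b.
Proof. by move=> au vb /andP[ux xv]; rewrite (le_trans au ux) (le_trans xv vb). Qed.
Lemma dist_itv_le x y (u r : R) : u <= x <= u + r -> u <= y <= u + r -> `|x - y| <= r.
Proof. by move=> /andP[? ?] /andP[? ?]; rewrite ler_norml; apply/andP; split; lra. Qed.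
Lemma dist_itv_lt x y (u v r : R) : y - r < u -> v < y + r -> u <= x <= v -> `|x - y| < r.
Proof. by move=> ? ? /andP[? ?]; rewrite ltr_norml; apply/andP; split; lra. Qed.
Lemma lt_of_subr x (e a u : R) : x - e < u -> e <= x - a -> a < u.
Proof. lra. Qed.
Lemma lt_of_addr x (e b u : R) : u < x + e -> e <= b - x -> u < b.
Proof. lra. Qed.
Lemma four_lt (k n s t u v : R) : 4 * s < k -> 4 * t < k -> 4 * u < k -> 4 * v < k ->
  n <= s + t + (u + v) -> n < k.
Proof. lra. Qed.
Lemma lt_norm_neg (u r : R) x : x <= u -> u < - r -> r < `|x|.
Proof. by move=> xu ur; rewrite ltr_normr; apply/orP; right; lra. Qed.
Lemma lt_norm_pos (u r : R) x : u <= x -> r < u -> r < `|x|.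
Proof. by move=> xu ur; rewrite ltr_normr; apply/orP; left; lra. Qed.
End basics.

(** * Integrals of continuous real functions over segments *)

Section real_integral.
Variable R : realType.
Notation mu := (@lebesgue_measure R).
Implicit Types (g k : R -> R) (a b c : R).

Definition ri g a b : R := (\int[mu]_(x in `[a, b]) g x)%R.
(** Continuity is two-sided even at the endpoints; the integrands come from functions that are
    continuous in the plane around each point of the segment. *)
Definition ctn g a b := forall x, a <= x <= b -> {for x, continuous g}.

Lemma ctn_within g a b : ctn g a b -> {within `[a, b], continuous g}.
Proof.
by move=> gc; apply: continuous_in_subspaceT => x; rewrite inE /= in_itv /=; exact: gc.
Qed.
Lemma ctn_integrable g a b : ctn g a b -> mu.-integrable `[a, b] (EFin \o g).
Proof.
by move=> gc; apply: continuous_compact_integrable;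
  [exact: segment_compact | exact: ctn_within].
Qed.
Lemma riD g k a b : ctn g a b -> ctn k a b ->
  ri (fun x => g x + k x) a b = ri g a b + ri k a b.
Proof. by move=> /ctn_integrable gi /ctn_integrable ki; exact: RintegralD. Qed.
Lemma riB g k a b : ctn g a b -> ctn k a b ->
  ri (fun x => g x - k x) a b = ri g a b - ri k a b.
Proof. by move=> /ctn_integrable gi /ctn_integrable ki; exact: RintegralB. Qed.
Lemma riZ g (l : R) a b : ctn g a b -> ri (fun x => l * g x) a b = l * ri g a b.
Proof. by move=> /ctn_integrable gi; exact: RintegralZl. Qed.
Lemma eq_ri g k a b : (forall x, a <= x <= b -> g x = k x) -> ri g a b = ri k a b.
Proof. by move=> gk; apply: eq_Rintegral => x; rewrite inE /= in_itv /=; exact: gk. Qed.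
Lemma le_ri g k a b : ctn g a b -> ctn k a b ->
  (forall x, a <= x <= b -> g x <= k x) -> ri g a b <= ri k a b.
Proof.
move=> /ctn_integrable gi /ctn_integrable ki gk.
by apply: le_Rintegral => // x /=; rewrite in_itv /=; exact: gk.
Qed.
Lemma ri_cst (l a b : R) : a <= b -> ri (fun=> l) a b = l * (b - a).
Proof.
move=> ab; rewrite /ri Rintegral_cst //= lebesgue_measure_itv /= lte_fin.
by case: ltgtP ab => // -> _ /=; rewrite subrr.
Qed.
Lemma ctn_cst (l : R) a b : ctn (fun=> l) a b.
Proof. by move=> x _; exact: cvg_cst. Qed.
Lemma ctn_id a b : ctn id a b.
Proof. by move=> x _; exact: cvg_id. Qed.
Lemma ctnD g k a b : ctn g a b -> ctn k a b -> ctn (fun x => g x + k x) a b.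
Proof. by move=> gc kc x xab; apply: cvgD; [exact: gc | exact: kc]. Qed.
Lemma ctnB g k a b : ctn g a b -> ctn k a b -> ctn (fun x => g x - k x) a b.
Proof. by move=> gc kc x xab; apply: cvgB; [exact: gc | exact: kc]. Qed.
Lemma ctnM g k a b : ctn g a b -> ctn k a b -> ctn (fun x => g x * k x) a b.
Proof. by move=> gc kc x xab; apply: cvgM; [exact: gc | exact: kc]. Qed.
Lemma ctn_norm g a b : ctn g a b -> ctn (fun x => `|g x|) a b.
Proof. by move=> gc x xab; apply: cvg_norm; exact: gc. Qed.
Lemma ri_split g a b c : a <= c <= b -> ctn g a b -> ri g a b = ri g a c + ri g c b.
Proof.
move=> /andP[ac cb] gc; have gi := ctn_integrable gc.
have := @Rintegral_itvB R g (BLeft a) (BRight b) c gi.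
rewrite /= !bnd_simp => /(_ ac cb) /eqP.
rewrite subr_eq addrC => /eqP; rewrite /ri => ->; congr (_ + _).
rewrite Rintegral_itv_obnd_cbnd //; apply: integrableS gi => //.
by apply: subset_itvr; rewrite bnd_simp.
Qed.
Lemma ri_abs_le g a b : ctn g a b -> `|ri g a b| <= ri (fun x => `|g x|) a b.
Proof. by move=> /ctn_integrable gi; exact: le_normr_Rintegral. Qed.
Lemma ri_bound g a b (M : R) : a <= b -> ctn g a b ->
  (forall x, a <= x <= b -> `|g x| <= M) -> `|ri g a b| <= M * (b - a).
Proof.
move=> ab gc gM; rewrite (le_trans (ri_abs_le gc)) // -ri_cst //.
by apply: le_ri => //; [exact: ctn_norm | exact: ctn_cst].
Qed.
Lemma ri_FTC g k a b : a < b -> ctn g a b ->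
  (forall x : R, is_derive x 1 k (g x)) -> ri g a b = k b - k a.
Proof.
move=> ab gc dk; rewrite /ri /Rintegral.
have kc x : {for x, continuous k}.
  by apply: differentiable_continuous; apply/derivable1_diffP; case: (dk x).
rewrite (@continuous_FTC2 R g k a b ab (ctn_within gc)) //.
- split; first by move=> x _; case: (dk x).
  + apply: cvg_at_right_filter; exact: kc.
  + apply: cvg_at_left_filter; exact: kc.
- by move=> x _; rewrite derive1E; case: (dk x).
Qed.
Lemma ri_id a b : a < b -> ri id a b = (b ^+ 2 - a ^+ 2) / 2.
Proof.
move=> ab.
have dk (x : R) : is_derive x 1 (fun x : R => 2^-1 * x ^+ 2 : R) (id x).
  by apply: is_derive_eq => /=; rewrite /GRing.scale /=; field.
by rewrite (ri_FTC ab (@ctn_id a b) dk); field.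
Qed.
End real_integral.

(** * Complex line integrals along axis-parallel segments *)

Section complex_integral.
Variable R : realType.
Implicit Types (f : R[i] -> R[i]) (g k : R -> R[i]) (a b c d : R).

Definition cint g a b : R[i] :=
  (ri (fun x => complex.Re (g x)) a b +i* ri (fun x => complex.Im (g x)) a b)%C.
Definition ccont g a b := forall x, a <= x <= b -> forall e, 0 < e ->
  exists2 t : R, 0 < t & forall y, `|y - x| < t -> nc (g y - g x) < e.
Definition fcont f (z : R[i]) := forall e : R, 0 < e ->
  exists2 t : R, 0 < t & forall w, nc (w - z) < t -> nc (f w - f z) < e.

Lemma ReB (z w : R[i]) : complex.Re (z - w) = complex.Re z - complex.Re w.
Proof. by case: z w => ? ? [? ?]. Qed.
Lemma ImB (z w : R[i]) : complex.Im (z - w) = complex.Im z - complex.Im w.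
Proof. by case: z w => ? ? [? ?]. Qed.

Lemma continuousR_P (h : R -> R) x :
  (forall e, 0 < e -> exists2 t : R, 0 < t & forall y, `|y - x| < t -> `|h y - h x| < e) ->
  {for x, continuous h}.
Proof.
move=> H; apply/cvgrPdist_lt => e /H[t t0 Ht]; apply/nbhs_ballP; exists t => //= y.
by rewrite /ball /= distrC => /Ht; rewrite distrC.
Qed.

Lemma ccont_Re g a b : ccont g a b -> ctn (fun x => complex.Re (g x)) a b.
Proof.
move=> gc x xab; apply: continuousR_P => e e0.
have [t t0 H] := gc x xab e e0; exists t => // y /H.
by rewrite -ReB; apply: le_lt_trans; exact: Re_le_nc.
Qed.
Lemma ccont_Im g a b : ccont g a b -> ctn (fun x => complex.Im (g x)) a b.
Proof.
move=> gc x xab; apply: continuousR_P => e e0.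
have [t t0 H] := gc x xab e e0; exists t => // y /H.
by rewrite -ImB; apply: le_lt_trans; exact: Im_le_nc.
Qed.
Lemma nc_lip (z w : R[i]) : `|nc z - nc w| <= nc (z - w).
Proof.
have := nc_dist_triangle w z 0; have := nc_dist_triangle z w 0.
by rewrite !subr0 (ncC w) => h1 h2; rewrite ler_norml; lra.
Qed.
Lemma ccont_nc g a b : ccont g a b -> ctn (fun x => nc (g x)) a b.
Proof.
move=> gc x xab; apply: continuousR_P => e e0.
have [t t0 H] := gc x xab e e0; exists t => // y /H.
by apply: le_lt_trans; exact: nc_lip.
Qed.

Lemma cint_sub g k a b : ccont g a b -> ccont k a b ->
  cint (fun x => g x - k x) a b = cint g a b - cint k a b.
Proof.
move=> gc kc; rewrite /cint.
rewrite -[RHS]/(_ +i* _)%C -!riB; do ?[exact: ccont_Re | exact: ccont_Im].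
by congr (_ +i* _)%C; apply: eq_ri => x _; rewrite ?ReB ?ImB.
Qed.
Lemma cint_split g a m b : a <= m <= b -> ccont g a b ->
  cint g a b = cint g a m + cint g m b.
Proof.
move=> amb gc; rewrite /cint (ri_split amb (ccont_Re gc)).
by rewrite (ri_split amb (ccont_Im gc)).
Qed.
(** Real and imaginary parts are estimated separately. The resulting factor 2 is harmless, and the
    rotation argument for the sharp constant is avoided. *)
Lemma cint_nc g a b : ccont g a b -> nc (cint g a b) <= 2 * ri (fun x => nc (g x)) a b.
Proof.
move=> gc; rewrite (le_trans (nc_le_ReIm _)) //= mulr_natl mulr2n lerD //.
  rewrite (le_trans (ri_abs_le (ccont_Re gc))) //; apply: le_ri.
  - exact: ctn_norm (ccont_Re gc).
  - exact: ccont_nc.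
  - by move=> x _; exact: Re_le_nc.
rewrite (le_trans (ri_abs_le (ccont_Im gc))) //; apply: le_ri.
- exact: ctn_norm (ccont_Im gc).
- exact: ccont_nc.
- by move=> x _; exact: Im_le_nc.
Qed.
Lemma cint_bound g a b (M : R) : a <= b -> ccont g a b ->
  (forall x, a <= x <= b -> nc (g x) <= M) -> nc (cint g a b) <= 2 * M * (b - a).
Proof.
move=> ab gc gM; rewrite (le_trans (cint_nc gc)) // -mulrA ler_pM2l //.
rewrite -ri_cst //; apply: le_ri => //; [exact: ccont_nc | exact: ctn_cst].
Qed.
Lemma eq_cint g k a b : (forall x, a <= x <= b -> g x = k x) -> cint g a b = cint k a b.
Proof. by move=> gk; congr (_ +i* _)%C; apply: eq_ri => x xab; rewrite gk. Qed.

Definition hseg f c a b := cint (fun x => f (x +i* c)%C) a b.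
Definition vseg f a c d := cint (fun y => f (a +i* y)%C) c d.
(* The integral of f dw along the boundary of [a, b] x [c, d], counterclockwise. *)
Definition bd f a b c d : R[i] :=
  hseg f c a b - hseg f d a b + (0 +i* 1)%C * (vseg f b c d - vseg f a c d).
Definition hcont f c a b := forall x, a <= x <= b -> fcont f (x +i* c)%C.
Definition vcont f a c d := forall y, c <= y <= d -> fcont f (a +i* y)%C.
Definition bcont f a b c d :=
  [/\ hcont f c a b, hcont f d a b, vcont f b c d & vcont f a c d].

Lemma nc_h (x y c : R) : nc ((x +i* c)%C - (y +i* c)%C) = `|x - y|.
Proof.
by rewrite -nc_real; congr nc; rewrite -[LHS]/(_ +i* _)%C subrr.
Qed.
Lemma nc_v (x y c : R) : nc ((c +i* x)%C - (c +i* y)%C) = `|x - y|.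
Proof.
by rewrite -[X in nc X]/(_ +i* _)%C subrr /nc expr0n add0r sqrtr_sqr.
Qed.
Lemma hcont_ccont f c a b : hcont f c a b -> ccont (fun x => f (x +i* c)%C) a b.
Proof.
move=> fc x xab e e0; have [t t0 H] := fc x xab e e0.
by exists t => // y yx; apply: H; rewrite nc_h.
Qed.
Lemma vcont_ccont f a c d : vcont f a c d -> ccont (fun y => f (a +i* y)%C) c d.
Proof.
move=> fc x xab e e0; have [t t0 H] := fc x xab e e0.
by exists t => // y yx; apply: H; rewrite nc_v.
Qed.

Lemma bd_split_x f a m b c d : a <= m <= b -> hcont f c a b -> hcont f d a b ->
  bd f a b c d = bd f a m c d + bd f m b c d.
Proof.
move=> amb h1 h2; rewrite /bd /hseg.
rewrite (cint_split amb (hcont_ccont h1)) (cint_split amb (hcont_ccont h2)).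
ring.
Qed.
Lemma bd_split_y f a b c m d : c <= m <= d -> vcont f a c d -> vcont f b c d ->
  bd f a b c d = bd f a b c m + bd f a b m d.
Proof.
move=> amb h1 h2; rewrite /bd /vseg.
rewrite (cint_split amb (vcont_ccont h1)) (cint_split amb (vcont_ccont h2)).
ring.
Qed.
Lemma bd_sub f f' a b c d : bcont f a b c d -> bcont f' a b c d ->
  bd (fun w => f w - f' w) a b c d = bd f a b c d - bd f' a b c d.
Proof.
move=> [f1 f2 f3 f4] [g1 g2 g3 g4]; rewrite /bd /hseg /vseg.
rewrite !cint_sub; do ?[exact: hcont_ccont | exact: vcont_ccont].
ring.
Qed.
Lemma nc_i : nc (0 +i* 1 : R[i])%C = 1.
Proof. by rewrite /nc expr0n expr1n add0r sqrtr1. Qed.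
Lemma bd_nc f a b c d : nc (bd f a b c d) <=
  nc (hseg f c a b) + nc (hseg f d a b) + (nc (vseg f b c d) + nc (vseg f a c d)).
Proof.
rewrite (le_trans (ncD _ _)) // ncM nc_i mul1r lerD //; exact: ncB.
Qed.
Lemma bd_bound f a b c d (M : R) : a <= b -> c <= d -> bcont f a b c d ->
  (forall x y, a <= x <= b -> c <= y <= d -> nc (f (x +i* y)%C) <= M) ->
  nc (bd f a b c d) <= 4 * M * ((b - a) + (d - c)).
Proof.
move=> ab cd [f1 f2 f3 f4] fM; rewrite (le_trans (bd_nc _ _ _ _ _)) //.
have aa : a <= a <= b by rewrite lexx ab.
have bb : a <= b <= b by rewrite lexx ab.
have cc : c <= c <= d by rewrite lexx cd.
have dd : c <= d <= d by rewrite lexx cd.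
have := cint_bound ab (hcont_ccont f1) (fun x h => fM x c h cc).
have := cint_bound ab (hcont_ccont f2) (fun x h => fM x d h dd).
have := cint_bound cd (vcont_ccont f3) (fun y h => fM b y bb h).
have := cint_bound cd (vcont_ccont f4) (fun y h => fM a y aa h).
rewrite /hseg /vseg; lra.
Qed.
Lemma eq_bd f f' a b c d : a <= b -> c <= d ->
  (forall x y, a <= x <= b -> c <= y <= d -> (x == a) || (x == b) || (y == c) || (y == d) ->
     f (x +i* y)%C = f' (x +i* y)%C) ->
  bd f a b c d = bd f' a b c d.
Proof.
move=> ab cd H; rewrite /bd /hseg /vseg.
congr (_ - _ + _ * (_ - _)); apply: eq_cint => x xab; apply: H;
  by rewrite ?lexx ?ab ?cd ?eqxx ?orbT.
Qed.

Lemma fcont_cst (l : R[i]) z : fcont (fun=> l) z.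
Proof. by move=> e e0; exists 1 => // w _; rewrite subrr Normc.normc0. Qed.
Lemma fcontD f f' z : fcont f z -> fcont f' z -> fcont (fun w => f w + f' w) z.
Proof.
move=> fc gc e e0; have e2 : 0 < e / 2 by lra.
have [t t0 Ht] := fc _ e2; have [s s0 Hs] := gc _ e2.
exists (Num.min t s); first by rewrite lt_min t0 s0.
move=> w; rewrite lt_min => /andP[/Ht h1 /Hs h2].
rewrite opprD addrACA (le_lt_trans (ncD _ _)) //; lra.
Qed.
Lemma fcontN f z : fcont f z -> fcont (fun w => - f w) z.
Proof.
move=> fc e /fc [t t0 H]; exists t => // w /H; by rewrite -opprD ncN.
Qed.
Lemma cderiv_fcont f z l : cderiv f z l -> fcont f z.
Proof. by move=> fl e e0; exact: (cderiv_continuous fl e0). Qed.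
Lemma cderiv_affine (A B z : R[i]) : cderiv (fun w => A + B * w) z B.
Proof.
move=> e e0; exists 1 => // w _.
have -> : A + B * w - (A + B * z) - B * (w - z) = 0 by ring.
rewrite Normc.normc0; apply: mulr_ge0; [exact: ltW | exact: nc_ge0].
Qed.

Lemma bd_affine (A B : R[i]) a b c d : a < b -> c < d ->
  bd (fun w => A + B * w) a b c d = 0.
Proof.
case: A B => [A1 A2] [B1 B2] ab cd; rewrite /bd /hseg /vseg /cint /=.
have ab' := ltW ab; have cd' := ltW cd.
have lin (p q u v : R) : u < v ->
    ri (fun x => p + q * x) u v = p * (v - u) + q * ((v ^+ 2 - u ^+ 2) / 2).
  move=> uv; rewrite riD ?ri_cst ?riZ ?ri_id ?(ltW uv) //; do ?exact: ctn_cst.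
    exact: ctn_id.
  by apply: ctnM; [exact: ctn_cst | exact: ctn_id].
have lin' (h : R -> R) (p q u v : R) : u < v -> (forall x, h x = p + q * x) ->
    ri h u v = p * (v - u) + q * ((v ^+ 2 - u ^+ 2) / 2).
  by move=> uv hE; rewrite -lin //; apply: eq_ri.
have E1 y : ri (fun x => A1 + (B1 * x - B2 * y)) a b =
    (A1 - B2 * y) * (b - a) + B1 * ((b ^+ 2 - a ^+ 2) / 2).
  by apply: lin' => // x; ring.
have E2 y : ri (fun x => A2 + (B1 * y + B2 * x)) a b =
    (A2 + B1 * y) * (b - a) + B2 * ((b ^+ 2 - a ^+ 2) / 2).
  by apply: lin' => // x; ring.
have E3 x : ri (fun y => A1 + (B1 * x - B2 * y)) c d =
    (A1 + B1 * x) * (d - c) + (- B2) * ((d ^+ 2 - c ^+ 2) / 2).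
  by apply: lin' => // y; ring.
have E4 x : ri (fun y => A2 + (B1 * y + B2 * x)) c d =
    (A2 + B2 * x) * (d - c) + B1 * ((d ^+ 2 - c ^+ 2) / 2).
  by apply: lin' => // y; ring.
rewrite !E1 !E2 !E3 !E4; apply/eqP; rewrite eq_complex /=.
by apply/andP; split; apply/eqP; field.
Qed.
End complex_integral.

(** * Goursat's theorem *)

Section goursat.
Variable R : realType.
Implicit Types (f : R[i] -> R[i]) (a b c d : R).

(** Nested rectangles: [B n a c] speaks of the rectangle with lower left corner (a, c) and sides p /
    2^n and q / 2^n. The common point is the supremum of the corners, since every corner stays below
    every upper right corner ([cross]). *)
Lemma bisection_point (p q a0 c0 : R) (B : nat -> R -> R -> Prop) :
  0 <= p -> 0 <= q -> B 0%N a0 c0 ->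
  (forall n a c, B n a c -> exists i j : bool,
     B n.+1 (a + i%:R * (p / 2 ^+ n.+1)) (c + j%:R * (q / 2 ^+ n.+1))) ->
  exists x y, forall n, exists a c,
    [/\ B n a c, a <= x <= a + p / 2 ^+ n, c <= y <= c + q / 2 ^+ n,
        a0 <= a /\ a + p / 2 ^+ n <= a0 + p & c0 <= c /\ c + q / 2 ^+ n <= c0 + q].
Proof.
move=> p0 q0 B0 BS.
pose P n (s t : R * R) := B n.+1 t.1 t.2 /\
   exists i j : bool, t = (s.1 + i%:R * (p / 2 ^+ n.+1), s.2 + j%:R * (q / 2 ^+ n.+1)).
pose step n s := xget s (P n s).
pose S := fix S n := if n is m.+1 then step m (S m) else (a0, c0).
have SB n : B n (S n).1 (S n).2.
  elim: n => //= n IH; rewrite /step.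
  have [i [j Hij]] := BS _ _ _ IH.
  by case: xgetP => [t _ []//|/(_ ((S n).1 + i%:R * (p / 2 ^+ n.+1),
    (S n).2 + j%:R * (q / 2 ^+ n.+1)))[]]; split => //; exists i, j.
have Sstep n : exists i j : bool, S n.+1 =
    ((S n).1 + i%:R * (p / 2 ^+ n.+1), (S n).2 + j%:R * (q / 2 ^+ n.+1)).
  have [i [j Hij]] := BS _ _ _ (SB n).
  rewrite /= /step; case: xgetP => [t _ []//|/(_ ((S n).1 + i%:R * (p / 2 ^+ n.+1),
    (S n).2 + j%:R * (q / 2 ^+ n.+1)))[]]; split => //; exists i, j => //.
have half (r : R) n : r / 2 ^+ n = 2 * (r / 2 ^+ n.+1).
  by rewrite exprS; field; rewrite expf_neq0 // pnatr_eq0.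
have pos (r : R) n : 0 <= r -> 0 <= r / 2 ^+ n.
  by move=> r0; rewrite divr_ge0 // exprn_ge0.
have mono n : [/\ (S n).1 <= (S n.+1).1,
   (S n.+1).1 + p / 2 ^+ n.+1 <= (S n).1 + p / 2 ^+ n, (S n).2 <= (S n.+1).2 &
   (S n.+1).2 + q / 2 ^+ n.+1 <= (S n).2 + q / 2 ^+ n].
  have [i [j ->]] := Sstep n; rewrite (half p n) (half q n) /=.
  have := pos p n.+1 p0; have := pos q n.+1 q0.
  by case: i; case: j; rewrite /= => h1 h2; split; lra.
have mono2 m n : (m <= n)%N -> [/\ (S m).1 <= (S n).1,
   (S n).1 + p / 2 ^+ n <= (S m).1 + p / 2 ^+ m, (S m).2 <= (S n).2 &
   (S n).2 + q / 2 ^+ n <= (S m).2 + q / 2 ^+ m].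
  elim: n => [|n IH]; first by rewrite leqn0 => /eqP ->.
  rewrite leq_eqVlt ltnS => /predU1P[->//|/IH[h1 h2 h3 h4]].
  by have [k1 k2 k3 k4] := mono n; split; lra.
have cross m n : (S n).1 <= (S m).1 + p / 2 ^+ m /\ (S n).2 <= (S m).2 + q / 2 ^+ m.
  have [mn|/ltnW mn] := leqP m n; have [h1 h2 h3 h4] := mono2 _ _ mn.
    by have := pos p n p0; have := pos q n q0; split; lra.
  by have := pos p m p0; have := pos q m q0; split; lra.
pose A := range (fun n => (S n).1); pose C := range (fun n => (S n).2).
have Aub m : ubound A ((S m).1 + p / 2 ^+ m) by move=> _ [n _ <-]; case: (cross m n).
have Cub m : ubound C ((S m).2 + q / 2 ^+ m) by move=> _ [n _ <-]; case: (cross m n).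
exists (sup A), (sup C) => n; exists (S n).1, (S n).2; split => //.
- apply/andP; split; first by apply: ub_le_sup; [exists ((S 0%N).1 + p / 2 ^+ 0) | exists n].
  by apply: ge_sup => //; exists (S 0%N).1, 0%N.
- apply/andP; split; first by apply: ub_le_sup; [exists ((S 0%N).2 + q / 2 ^+ 0) | exists n].
  by apply: ge_sup => //; exists (S 0%N).2, 0%N.
- by have [] := mono2 0%N n (leq0n _); rewrite /= expr0 !divr1.
- by have [] := mono2 0%N n (leq0n _); rewrite /= expr0 !divr1.
Qed.

(** Repeated quartering keeps at least the fraction 4^-n of the boundary integral. Near the limit
    point f differs from its tangent affine map, whose boundary integral is zero, by o(2^-n), and
    the perimeter is O(2^-n); hence the original integral vanishes. *)
Lemma goursat f a b c d : a < b -> c < d ->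
  (forall x y, a <= x <= b -> c <= y <= d -> exists l, cderiv f (x +i* y)%C l) ->
  bd f a b c d = 0.
Proof.
move=> ab cd fd.
pose p := b - a; pose q := d - c.
have p0 : 0 < p by rewrite /p; lra.
have q0 : 0 < q by rewrite /q; lra.
have fc x y : a <= x <= b -> c <= y <= d -> fcont f (x +i* y)%C.
  by move=> xab ycd; have [l fl] := fd x y xab ycd; exact: cderiv_fcont fl.
pose K := nc (bd f a b c d).
have pw n : 0 < 2 ^+ n :> R by rewrite exprn_gt0.
pose B n u v := [/\ a <= u, u + p / 2 ^+ n <= b, c <= v, v + q / 2 ^+ n <= d &
  K <= 4 ^+ n * nc (bd f u (u + p / 2 ^+ n) v (v + q / 2 ^+ n))].
have [||||x [y xyP]] := @bisection_point p q a c B _ _ _ _; do ?exact: ltW.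
- rewrite /B !expr0 !divr1 mul1r /p /q; split => //; rewrite ?[a + _]addrC ?[c + _]addrC ?subrK //.
- move=> n u v [au ub cv vd KB].
  set h := p / 2 ^+ n.+1; set k := q / 2 ^+ n.+1.
  have hE : p / 2 ^+ n = 2 * h by rewrite /h exprS; field; rewrite expf_neq0 // pnatr_eq0.
  have kE : q / 2 ^+ n = 2 * k by rewrite /k exprS; field; rewrite expf_neq0 // pnatr_eq0.
  have h0 : 0 < h by rewrite divr_gt0.
  have k0 : 0 < k by rewrite divr_gt0.
  move: KB ub vd; rewrite hE kE => KB ub vd.
  have uin : u <= u + h <= u + 2 * h by apply/andP; split; lra.
  have vin : v <= v + k <= v + 2 * k by apply/andP; split; lra.
  have E : bd f u (u + 2 * h) v (v + 2 * k) =
     bd f u (u + h) v (v + k) + bd f u (u + h) (v + k) (v + 2 * k) +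
     (bd f (u + h) (u + 2 * h) v (v + k) + bd f (u + h) (u + 2 * h) (v + k) (v + 2 * k)).
    rewrite (@bd_split_x _ f u (u + h)); first last.
    - by move=> z zP; apply: fc; [exact: itv_sub zP|rewrite (le_trans cv) //; lra].
    - by move=> z zP; apply: fc; [exact: itv_sub zP|rewrite cv; lra].
    - exact: uin.
    have vc t : u <= t <= u + 2 * h -> vcont f t v (v + 2 * k).
      by move=> tP z zP; apply: fc; [exact: itv_sub tP|exact: itv_sub zP].
    have uu : u <= u <= u + 2 * h by rewrite lexx; lra.
    have uw : u <= u + 2 * h <= u + 2 * h by rewrite lexx; lra.
    by congr (_ + _); rewrite (@bd_split_y _ f _ _ v (v + k)) //; exact: vc.
  have : exists i j : bool, K <= 4 ^+ n.+1 * nc (bd f (u + i%:R * h) (u + i%:R * h + h)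
      (v + j%:R * k) (v + j%:R * k + k)).
    apply: contrapT => /forallNP H.
    have H' (i j : bool) : 4 ^+ n.+1 * nc (bd f (u + i%:R * h) (u + i%:R * h + h)
      (v + j%:R * k) (v + j%:R * k + k)) < K.
      by rewrite ltNge; apply/negP => HK; apply: (H i); exists j.
    have := H' false false; have := H' false true.
    have := H' true false; have := H' true true.
    have uE : u + h + h = u + 2 * h by rewrite mulr_natl mulr2n addrA.
    have vE : v + k + k = v + 2 * k by rewrite mulr_natl mulr2n addrA.
    rewrite mul0r mul1r mul0r mul1r !addr0 uE vE => H1 H2 H3 H4.
    have : nc (bd f u (u + 2 * h) v (v + 2 * k)) <=
     nc (bd f u (u + h) v (v + k)) + nc (bd f u (u + h) (v + k) (v + 2 * k)) +
     (nc (bd f (u + h) (u + 2 * h) v (v + k)) + nc (bd f (u + h) (u + 2 * h) (v + k) (v + 2 * k))).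
      by rewrite E (le_trans (ncD _ _)) // lerD // ncD.
    have pos4 : 0 < 4 ^+ n :> R by rewrite exprn_gt0.
    move: H1 H2 H3 H4; rewrite exprS -!mulrA => H1 H2 H3 H4.
    rewrite -(ler_pM2l pos4) !mulrDr => H5.
    by have := four_lt H4 H3 H2 H1 H5; rewrite ltNge KB.
  move=> [i [j Hij]]; exists i, j; split => //.
  + by case: i {Hij} => /=; lra.
  + by rewrite -/h; case: i {Hij} => /=; lra.
  + by case: j {Hij} => /=; lra.
  + by rewrite -/k; case: j {Hij} => /=; lra.
apply/eqP; rewrite -nc0P; apply/eqP/le_anti; rewrite nc_ge0 andbT -/K.
apply/ler_addgt0Pr => e e0; rewrite add0r.
have [u [v [[_ _ _ _ _] xu yv [uP1 uP2] [vP1 vP2]]]] := xyP 0%N.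
have [l fl] : exists l, cderiv f (x +i* y)%C l.
  apply: fd; [move: xu uP1 uP2|move: yv vP1 vP2]; rewrite expr0 divr1 /p /q => /andP[? ?] ? ?;
  by apply/andP; split; lra.
(* At level n the bound is 4 e' (p + q)^2 / 4^n, which becomes e after multiplication by 4^n. *)
pose e' := e / (4 * (p + q) ^+ 2).
have pq0 : 0 < (p + q) ^+ 2 by rewrite exprn_gt0 // addr_gt0.
have e'0 : 0 < e' by rewrite divr_gt0 // mulr_gt0.
have [t t0 Ht] := fl e' e'0.
have [n nt] : exists n, (p + q) / 2 ^+ n < t.
  have [n] : exists n : nat, (p + q) / t < n%:R.
    by exists (Num.truncn ((p + q) / t)).+1; exact: truncnS_gt.
  move=> hn; exists n; rewrite ltr_pdivrMr // mulrC -ltr_pdivrMr //.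
  by rewrite (lt_trans hn) // -natrX ltr_nat ltn_expl.
have {uP1 uP2 vP1 vP2 xu yv u v}[u [v [[_ _ _ _ KB] /andP[xu1 xu2] /andP[yv1 yv2] [uP1 uP2] [vP1 vP2]]]] := xyP n.
set h := p / 2 ^+ n in KB xu1 xu2 uP2; set k := q / 2 ^+ n in KB yv1 yv2 vP2.
have h0 : 0 < h by rewrite divr_gt0.
have k0 : 0 < k by rewrite divr_gt0.
have hkE : h + k = (p + q) / 2 ^+ n by rewrite mulrDl.
move: uP2 vP2; rewrite {1}/p {1}/q => uP2 vP2.
pose L w := f (x +i* y)%C - l * (x +i* y)%C + l * w.
have fcB : bcont f u (u + h) v (v + k).
  have au := uP1; have cv := vP1.
  have hb : u + h <= b by lra.
  have kd : v + k <= d by lra.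
  have [uu uh] : u <= u <= b /\ a <= u + h <= b by rewrite lexx hb; lra.
  have [vv vk] : v <= v <= d /\ c <= v + k <= d by rewrite lexx kd; lra.
  by split => z zP; apply: fc => //; try exact: itv_sub zP; rewrite ?au ?cv //; lra.
have LcB : bcont L u (u + h) v (v + k).
  by split => z _; apply: cderiv_fcont; exact: cderiv_affine.
have fL : bd f u (u + h) v (v + k) = bd (fun w => f w - L w) u (u + h) v (v + k).
  by rewrite bd_sub // bd_affine ?subr0 //; lra.
rewrite fL in KB.
have dc : bcont (fun w => f w - L w) u (u + h) v (v + k).
  case: fcB LcB => [f1 f2 f3 f4] [g1 g2 g3 g4].
  by split => z zP; apply: fcontD;
    [exact: f1|exact/fcontN/g1|exact: f2|exact/fcontN/g2|exact: f3|exact/fcontN/g3|exact: f4|exact/fcontN/g4].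
apply: (le_trans KB).
have := @bd_bound _ _ u (u + h) v (v + k) (e' * (h + k)) _ _ dc _.
have -> : u + h - u + (v + k - v) = h + k by ring.
move=> bdb.
have {bdb} : nc (bd (fun w : R[i] => f w - L w) u (u + h) v (v + k)) <=
    4 * (e' * (h + k)) * (h + k).
  apply: bdb; [lra|lra|].
  move=> x' y' x'P y'P.
  have D : nc ((x' +i* y')%C - (x +i* y)%C) <= h + k.
    rewrite (le_trans (nc_le_ReIm _)) // ReB ImB lerD //.
      by apply: dist_itv_le x'P _; apply/andP.
    by apply: dist_itv_le y'P _; apply/andP.
  have -> : f (x' +i* y')%C - L (x' +i* y')%C =
     f (x' +i* y')%C - f (x +i* y)%C - l * ((x' +i* y')%C - (x +i* y)%C) by rewrite /L; ring.
  rewrite (le_trans (Ht _ _)) //; first by rewrite (le_lt_trans D) // hkE.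
  by rewrite ler_pM2l.
have pos4 : 0 < 4 ^+ n :> R by rewrite exprn_gt0.
rewrite -(ler_pM2l pos4) => /le_trans; apply.
rewrite hkE /e' le_eqVlt; apply/orP; left; apply/eqP.
have -> : 4 ^+ n = 2 ^+ n * 2 ^+ n :> R by rewrite -exprMn; congr (_ ^+ _); ring.
field; rewrite expf_neq0 ?pnatr_eq0 //= ; apply/lt0r_neq0; lra.
Qed.
End goursat.

(** * Cauchy's theorem with finitely many exceptional points *)

Section exceptional.
Variable R : realType.
Implicit Types (f : R[i] -> R[i]) (a b c d : R).

Definition box (p : R[i]) (e a b c d : R) : Prop :=
  [/\ complex.Re p - e < a < complex.Re p, complex.Re p < b < complex.Re p + e,
      complex.Im p - e < c < complex.Im p & complex.Im p < d < complex.Im p + e].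

(* The coordinates in S are excluded so that the sides can be kept away from other
   exceptional points. *)
Definition removable f (p : R[i]) := forall (e : R) (S : seq R), 0 < e ->
  exists a b c d, [/\ box p e a b c d, a \notin S /\ b \notin S, c \notin S /\ d \notin S &
    nc (bd f a b c d) < e].

Definition offlines (P : seq R[i]) a b c d := forall p, p \in P ->
  [/\ complex.Re p != a, complex.Re p != b, complex.Im p != c & complex.Im p != d].

(** The frame between the two rectangles is cut into a left and a right strip of full height and the
    two pieces below and above the inner rectangle. The cuts run along x = a' and x = b' over the
    full height, hence the two [vcont] hypotheses. *)
Lemma bd_split5 f a a' b' b c c' d' d : a <= a' -> a' <= b' -> b' <= b ->
  c <= c' -> c' <= d' -> d' <= d ->
  hcont f c a b -> hcont f d a b -> vcont f a' c d -> vcont f b' c d ->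
  bd f a b c d = bd f a a' c d + bd f b' b c d + bd f a' b' c c' + bd f a' b' d' d
    + bd f a' b' c' d'.
Proof.
move=> aa ab bb cc cd dd h1 h2 v1 v2.
rewrite (@bd_split_x _ f a a' b) //; last by rewrite aa (le_trans ab bb).
rewrite (@bd_split_x _ f a' b' b); last first.
- by move=> x /andP[? ?]; apply: h2; apply/andP; split; lra.
- by move=> x /andP[? ?]; apply: h1; apply/andP; split; lra.
- by rewrite ab bb.
rewrite (@bd_split_y _ f a' b' c c' d) //; last by rewrite cc (le_trans cd dd).
rewrite (@bd_split_y _ f a' b' c' d' d); last first.
- by move=> x /andP[? ?]; apply: v2; apply/andP; split; lra.
- by move=> x /andP[? ?]; apply: v1; apply/andP; split; lra.
- by rewrite cd dd.
ring.
Qed.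

(** Induction on the exceptional points: a small rectangle around the first one has a small boundary
    integral by [removable], and the four rectangles around it involve only the remaining points. *)
Lemma goursat_except (P : seq R[i]) f a b c d : a < b -> c < d -> offlines P a b c d ->
  (forall x y, a <= x <= b -> c <= y <= d -> (x +i* y)%C \notin P ->
     exists l, cderiv f (x +i* y)%C l) ->
  (forall p, p \in P -> a < complex.Re p < b -> c < complex.Im p < d -> removable f p) ->
  bd f a b c d = 0.
Proof.
elim: P a b c d => [|p P IH] a b c d ab cd off fd rem.
  by apply: goursat => // x y xab ycd; exact: fd.
have offP : offlines P a b c d by move=> q qP; apply: off; rewrite inE qP orbT.
have remP q : q \in P -> a < complex.Re q < b -> c < complex.Im q < d -> removable f q.
  by move=> qP; apply: rem; rewrite inE qP orbT.
(* If p is repeated in P or lies outside the open rectangle, the shorter list already covers the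
   exceptional points; by [offlines] p cannot lie on a side. *)
have [pin|pout] := boolP [&& p \notin P, a < complex.Re p < b & c < complex.Im p < d];
  last first.
  apply: IH => // x y xab ycd xyP; apply: fd => //; rewrite inE negb_or xyP andbT.
  apply: contra pout => /eqP pE; rewrite -pE xyP /=.
  have [] := off p (mem_head _ _); rewrite -pE /= => xa xb yc yd.
  move: xab ycd => /andP[? ?] /andP[? ?].
  rewrite !lt_neqAle eq_sym xa xb (eq_sym c) yc yd /=; apply/and3P; split => //.
  by apply/andP.
case/and3P: pin => pP /andP[pa pb] /andP[pc pd].
apply/eqP; rewrite -nc0P; apply/eqP/le_anti; rewrite nc_ge0 andbT.
apply/ler_addgt0Pr => e e0; rewrite add0r.
pose e' := Num.min (Num.min e (Num.min (complex.Re p - a) (b - complex.Re p)))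
  (Num.min (complex.Im p - c) (d - complex.Im p)).
have e'0 : 0 < e' by rewrite !lt_min e0 !subr_gt0 pa pb pc pd.
have : e' <= e' by [].
rewrite {2}/e' !le_min => /andP[/andP[e'e /andP[e1 e2]] /andP[e3 e4]].
(* Sides chosen off S preserve [offlines] for the new rectangles. *)
pose S := [seq complex.Re q | q <- P] ++ [seq complex.Im q | q <- P].
have pmem : p \in p :: P by exact: mem_head.
have pa' : a < complex.Re p < b by apply/andP.
have pc' : c < complex.Im p < d by apply/andP.
have [a' [b' [c' [d' [[/andP[a1 a2] /andP[b1 b2] /andP[c1 c2] /andP[d1 d2]] [aS bS] [cS dS] small]]]]]
  := rem p pmem pa' pc' _ S e'0.
have ReS x q : x \notin S -> q \in P -> complex.Re q != x.
  move=> xS qP; apply: contra xS => /eqP <-; rewrite mem_cat; apply/orP; left.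
  by apply/mapP; exists q.
have ImS x q : x \notin S -> q \in P -> complex.Im q != x.
  move=> xS qP; apply: contra xS => /eqP <-; rewrite mem_cat; apply/orP; right.
  by apply/mapP; exists q.
have fcv x y : a <= x <= b -> c <= y <= d -> (x +i* y)%C \notin p :: P -> fcont f (x +i* y)%C.
  by move=> xab ycd xyP; have [l fl] := fd x y xab ycd xyP; exact: cderiv_fcont fl.
have hc y : y = c \/ y = d -> hcont f y a b.
  move=> ycd x xab; apply: fcv => //; first by case: ycd => ->; rewrite lexx ltW.
  apply/negP => /off[_ _ /=]; case: ycd => ->; by rewrite eqxx.
have vc x : a <= x <= b -> complex.Re p != x -> x \notin S -> vcont f x c d.
  move=> xab px xS y ycd; apply: fcv => //; rewrite inE negb_or; apply/andP; split.
    by apply: contra px => /eqP <-.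
  by apply/negP => /(ReS _ _ xS); rewrite eqxx.
have sub u v r s : a <= u -> u < v -> v <= b -> c <= r -> r < s -> s <= d ->
   offlines P u v r s -> ~~ [&& u <= complex.Re p <= v & r <= complex.Im p <= s] ->
   bd f u v r s = 0.
  move=> au uv vb cr rs sd offuv pnot; apply: IH => //.
  - move=> x y xuv yrs xyP; apply: fd; [exact: itv_sub xuv|exact: itv_sub yrs|].
    rewrite inE negb_or xyP andbT; apply: contra pnot => /eqP <- /=.
    by rewrite xuv yrs.
  - move=> q qP /andP[q1 q2] /andP[q3 q4]; apply: remP => //.
      by rewrite (le_lt_trans au q1) (lt_le_trans q2 vb).
    by rewrite (le_lt_trans cr q3) (lt_le_trans q4 sd).
have la := lt_of_subr a1 e1; have lb := lt_of_addr b2 e2.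
have lc := lt_of_subr c1 e3; have ld := lt_of_addr d2 e4.
have ab' := lt_trans a2 b1; have cd' := lt_trans c2 d1.
have L1 : bd f a a' c d = 0.
  apply: (sub _ _ _ _ (lexx a) la (ltW (lt_trans ab' lb)) (lexx c) cd (lexx d)).
    by move=> q qP; have [h1 h2 h3 h4] := offP q qP; split => //; exact: ReS.
  by rewrite [complex.Re p <= a']leNgt a2 !andbF.
have L2 : bd f b' b c d = 0.
  apply: (sub _ _ _ _ (ltW (lt_trans la ab')) lb (lexx b) (lexx c) cd (lexx d)).
    by move=> q qP; have [h1 h2 h3 h4] := offP q qP; split => //; exact: ReS.
  by rewrite [b' <= complex.Re p]leNgt b1.
have L3 : bd f a' b' c c' = 0.
  apply: (sub _ _ _ _ (ltW la) ab' (ltW lb) (lexx c) lc (ltW (lt_trans cd' ld))).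
    by move=> q qP; have [h1 h2 h3 h4] := offP q qP; split => //; [exact: ReS|exact: ReS|exact: ImS].
  by rewrite [complex.Im p <= c']leNgt c2 !andbF.
have L4 : bd f a' b' d' d = 0.
  apply: (sub _ _ _ _ (ltW la) ab' (ltW lb) (ltW (lt_trans lc cd')) ld (lexx d)).
    by move=> q qP; have [h1 h2 h3 h4] := offP q qP; split => //; [exact: ReS|exact: ReS|exact: ImS].
  by rewrite [d' <= complex.Im p]leNgt d1 !andbF.
rewrite (bd_split5 (ltW la) (ltW ab') (ltW lb) (ltW lc) (ltW cd') (ltW ld)
  (hc _ (or_introl erefl)) (hc _ (or_intror erefl))).
- by rewrite L1 L2 L3 L4 !add0r (le_trans (ltW small)).
- by apply: vc => //; [rewrite (ltW la) (ltW (lt_trans ab' lb))|rewrite gt_eqF].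
- by apply: vc => //; [rewrite (ltW lb) (ltW (lt_trans la ab'))|rewrite lt_eqF].
Qed.
End exceptional.

(** * Square integrals over the plane *)

Section plane_measure.
Variable R : realType.
Notation mu := (@lebesgue_measure R).
Notation RR := (measurableTypeR R * measurableTypeR R)%type.
Notation mu2 := (@lebesgue_measure R \x @lebesgue_measure R)%E.

Lemma between_dist (e k q x y : R) : k < e / 2 ->
  x - k < q < x + k -> q - k < y < q + k -> `|y - x| < e.
Proof. by move=> ke /andP[? ?] /andP[? ?]; rewrite ltr_norml; lra. Qed.

Lemma half_sum (s t r : R) : s < r / 2 -> t < r / 2 -> s + t < r.
Proof. lra. Qed.

Lemma near_sym (k q x : R) : x - k < q < x + k -> q - k < x < q + k.
Proof. by move=> /andP[? ?]; apply/andP; split; lra. Qed.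

Lemma rat_near (x k : R) : 0 < k -> exists q : rat, x - k < ratr q < x + k.
Proof.
move=> k0; have /rat_in_itvoo[q] : x - k < x + k by lra.
by rewrite inE /= => qP; exists q; apply/andP; split; rewrite (itvP qP).
Qed.

(** Openness in the maximum norm makes A the union of the countably many squares with rational
    centre and radius 1 / (n + 1) that it contains, and these are measurable in the product. *)
Lemma measurable_box_open (A : set RR) :
  (forall p, A p -> exists2 e : R, 0 < e &
     forall q : RR, `|q.1 - p.1| < e -> `|q.2 - p.2| < e -> A q) -> measurable A.
Proof.
move=> Aop.
pose bx (q1 q2 : rat) (n : nat) : set RR :=
  [set x : R | ratr q1 - n.+1%:R^-1 < x < ratr q1 + n.+1%:R^-1] `*`
  [set y : R | ratr q2 - n.+1%:R^-1 < y < ratr q2 + n.+1%:R^-1].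
have -> : A = \bigcup_(q1 : rat) \bigcup_(q2 : rat) \bigcup_(n : nat)
    (if pselect (bx q1 q2 n `<=` A) then bx q1 q2 n else set0).
  apply/seteqP; split => [p Ap|p [q1 _ [q2 _ [n _]]]]; last first.
    by case: pselect => // /[apply].
  have [e e0 He] := Aop p Ap.
  have e2 : 0 < e / 2 by lra.
  pose n := Num.truncn (2 / e).
  have n0 : 0 < n.+1%:R :> R by rewrite ltr0n.
  have hn : n.+1%:R^-1 < e / 2.
    by rewrite -[e / 2]invrK ltf_pV2 ?posrE ?invr_gt0 // invf_div truncnS_gt.
  have in0 : 0 < n.+1%:R^-1 :> R by rewrite invr_gt0.
  have [q1 q1P] := rat_near p.1 in0.
  have [q2 q2P] := rat_near p.2 in0.
  exists q1 => //; exists q2 => //; exists n => //.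
  case: pselect => [bA|nb]; first by split => /=; apply: near_sym.
  exfalso; apply: nb => q [/= uq vq]; apply: He.
    by apply: (between_dist hn (q := ratr q1)) uq => //.
  by apply: (between_dist hn (q := ratr q2)) vq => //.
apply: bigcupT_measurable_rat => q1; apply: bigcupT_measurable_rat => q2.
apply: bigcupT_measurable => n; case: pselect => [bA|nb]; last exact: measurable0.
have mi q : measurable [set x : measurableTypeR R | ratr q - n.+1%:R^-1 < x < ratr q + n.+1%:R^-1].
  have := @measurable_itv R `]ratr q - n.+1%:R^-1, ratr q + n.+1%:R^-1[.
  by congr measurable; apply/seteqP; split => x /=; rewrite in_itv.
by apply: measurableX; exact: mi.
Qed.

Lemma measurable_pair_open (D : set R[i]) : open D -> measurable (@pair_complex R @^-1` D : set RR).
Proof.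
move=> Dop; apply: measurable_box_open => -[x y] /= /[dup] Dp.
rewrite openE in Dop; move=> /Dop /nbhsC_P [e e0 He].
exists (e / 2) => [|[u v] /= h1 h2]; first by lra.
apply: He; rewrite (le_lt_trans (nc_le_ReIm _)) //=; exact: half_sum h1 h2.
Qed.

(** Extension by zero, so that Tonelli's theorem applies on the whole product, whatever the sections
    of D are. *)
Definition sqnorm_on (D : set R[i]) (f : R[i] -> R[i]) (p : RR) : R :=
  if pair_complex p \in D then nc (f (pair_complex p)) ^+ 2 else 0.

Lemma sqnorm_on_ge0 D f p : 0 <= sqnorm_on D f p.
Proof. by rewrite /sqnorm_on; case: ifP => // _; rewrite sqr_ge0. Qed.

(** The extension is lower semicontinuous, as it only drops to 0 outside the open set: its strict
    superlevel sets are open, and the whole plane for a negative level. *)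
Lemma measurable_sqnorm_on (D : set R[i]) f : open D -> (forall z, D z -> fcont f z) ->
  measurable_fun setT (sqnorm_on D f).
Proof.
move=> Dop fc _; apply: (measurability _ (measurable_realfun.RGenOInfty.measurableE R)) => //.
move=> /= _ [_ [a ->] <-]; rewrite setTI; apply: measurable_box_open => -[x y] /=.
rewrite in_itv /= andbT /sqnorm_on; have [a0|a0] := ltP a 0.
  move=> _; exists 1 => // q _ _; rewrite in_itv /= andbT; case: ifP => // _.
  exact: lt_le_trans (sqr_ge0 _).
case: ifPn => [/set_mem Dxy|_]; last by rewrite ltNge a0.
rewrite -[X in X < _](sqr_sqrtr a0) ltr_pXn2r ?nnegrE ?sqrtr_ge0 ?nc_ge0 // => h.
have h' : 0 < nc (f (x +i* y)%C) - Num.sqrt a by rewrite subr_gt0.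
have [t t0 Ht] := fc _ Dxy _ h'.
rewrite openE in Dop; have /nbhsC_P [e e0 He] := Dop _ Dxy.
exists (Num.min (t / 2) (e / 2)); first by rewrite lt_min; apply/andP; split; lra.
move=> [u v] /=; rewrite !lt_min => /andP[u1 u2] /andP[v1 v2].
have D1 (r : R) : `|u - x| < r / 2 -> `|v - y| < r / 2 ->
   nc ((u +i* v)%C - (x +i* y)%C) < r.
  by move=> k1 k2; rewrite (le_lt_trans (nc_le_ReIm _)) //=; exact: half_sum k1 k2.
rewrite in_itv /= andbT; rewrite mem_set; last exact/He/D1.
rewrite -[X in X < _](sqr_sqrtr a0) ltr_pXn2r ?nnegrE ?sqrtr_ge0 ?nc_ge0 // /pair_complex /=.
have := Ht _ (D1 _ u1 v1); have := nc_lip (f (x +i* y)%C) (f (u +i* v)%C).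
by rewrite (ncC (f (x +i* y)%C)) ler_norml => /andP[? ?] ?; lra.
Qed.

Lemma integralC_sqnorm_on (D : set R[i]) f :
  integralC D (fun w => ((nc (f w)) ^+ 2)%:E) = (\int[mu2]_p (sqnorm_on D f p)%:E)%E.
Proof.
rewrite /integralC integral_mkcond; apply: eq_integral => p _.
by rewrite /patch /sqnorm_on -[p \in _]/(pair_complex p \in D); case: ifP.
Qed.

Local Open Scope ereal_scope.

(** Markov's inequality on the interval with the null set S removed: if h exceeded 2 M / (be - al)
    everywhere there, its integral would be at least 2 M > M. *)
Lemma exists_small_section (h : measurableTypeR R -> \bar R) (M al be : R) (S : seq R) :
  measurable_fun setT h -> (forall x, 0 <= h x) ->
  \int[mu]_x h x <= M%:E -> (0 < M)%R -> (al < be)%R ->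
  exists x, [/\ (al < x < be)%R, x \notin S & h x <= (2 * M / (be - al))%:E].
Proof.
move=> mh h0 hM M0 ab; apply: contrapT => /forallNP H.
pose A : set R := `]al, be[%classic `\` [set` S].
have mS : measurable ([set` S] : set R).
  exact: countable_measurable (finite_set_countable (finite_seq S)).
have mA : measurable A by apply: measurableD => //; exact: measurable_itv.
have muS : mu [set` S] = 0 by apply: countable_lebesgue_measure0; exact: finite_set_countable.
have muA : mu A = (be - al)%:E.
  have : mu `]al, be[%classic <= mu A + mu [set` S].
    apply: (@le_trans _ _ (mu (A `|` [set` S]))); last exact: measureU2.
    apply: le_measure; rewrite ?inE; [exact: measurable_itv|exact: measurableU|].
    by move=> x xab; case: (pselect (x \in S)) => [xS|xS]; [right|left; split].
  rewrite muS adde0 lebesgue_measure_itv /= lte_fin ab -EFinB => h1.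
  apply/le_anti; rewrite h1 andbT.
  have : mu A <= mu `]al, be[%classic.
    by apply: le_measure; rewrite ?inE // => x [].
  by rewrite lebesgue_measure_itv /= lte_fin ab -EFinB.
have k0 : (0 < 2 * M / (be - al))%R by rewrite divr_gt0 ?mulr_gt0 // subr_gt0.
have hA x : A x -> (2 * M / (be - al))%:E <= h x.
  move=> [/= xab xS]; rewrite leNgt; apply/negP => hx; apply: (H x); split.
  - by move: xab; rewrite in_itv.
  - exact/negP.
  - exact: ltW.
have : \int[mu]_(x in A) (2 * M / (be - al))%:E <= M%:E.
  apply: le_trans hM; apply: (@le_trans _ _ (\int[mu]_(x in A) h x)).
    apply: ge0_le_integral => //; first by move=> x _; rewrite lee_fin ltW.
    exact: measurable_funTS.
  by apply: ge0_subset_integral.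
have -> : \int[mu]_(x in A) (2 * M / (be - al))%:E = (2 * M / (be - al))%:E * mu A by exact: integral_cst.
rewrite muA -EFinM lee_fin divfK; last by rewrite subr_eq0 gt_eqF.
by apply/negP; rewrite -ltNge; lra.
Qed.

Lemma exists_small_vline (G : RR -> R) (M al be : R) (S : seq R) :
  measurable_fun setT G -> (forall p, (0 <= G p)%R) ->
  \int[mu2]_p (G p)%:E <= M%:E -> (0 < M)%R -> (al < be)%R ->
  exists x, [/\ (al < x < be)%R, x \notin S &
    \int[mu]_y (G (x, y))%:E <= (2 * M / (be - al))%:E].
Proof.
move=> mG G0 GM M0 ab.
have mE : measurable_fun setT (EFin \o G) by exact/measurable_EFinP.
have E0 p : 0 <= (EFin \o G) p by rewrite lee_fin.
apply: (@exists_small_section (fubini_F mu (EFin \o G))) => //.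
- exact: (measurable_fun_fubini_tonelli_F _ mE E0).
- by move=> x; apply: integral_ge0 => y _; exact: E0.
- by rewrite (fubini_tonelli1 _ mE E0) in GM.
Qed.

Lemma exists_small_hline (G : RR -> R) (M al be : R) (S : seq R) :
  measurable_fun setT G -> (forall p, (0 <= G p)%R) ->
  \int[mu2]_p (G p)%:E <= M%:E -> (0 < M)%R -> (al < be)%R ->
  exists y, [/\ (al < y < be)%R, y \notin S &
    \int[mu]_x (G (x, y))%:E <= (2 * M / (be - al))%:E].
Proof.
move=> mG G0 GM M0 ab.
have mE : measurable_fun setT (EFin \o G) by exact/measurable_EFinP.
have E0 p : 0 <= (EFin \o G) p by rewrite lee_fin.
apply: (@exists_small_section (fubini_G mu (EFin \o G))) => //.
- exact: (measurable_fun_fubini_tonelli_G _ mE E0).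
- by move=> x; apply: integral_ge0 => y _; exact: E0.
- by rewrite (fubini_tonelli1 _ mE E0) (fubini_tonelli _ mE E0) in GM.
Qed.

(** Dominated convergence with G itself as the dominating function; the sets only have to leave
    every point eventually, so the lemma serves both for shrinking punctured discs and for
    neighbourhoods of infinity. *)
Lemma integral_tail_small (G : RR -> R) (M : R) (A : nat -> set RR) :
  measurable_fun setT G -> (forall p, (0 <= G p)%R) -> \int[mu2]_p (G p)%:E <= M%:E ->
  (forall n, measurable (A n)) ->
  (forall p, \forall n \near \oo, ~ A n p) ->
  forall e : R, (0 < e)%R -> \forall n \near \oo, \int[mu2]_(p in A n) (G p)%:E <= e%:E.
Proof.
move=> mG G0 GM mA AE e e0.
have iG : (mu2 : measure _ _).-integrable setT (EFin \o G).
  apply/integrableP; split; first exact/measurable_EFinP.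
  under eq_integral do rewrite gee0_abs ?lee_fin //.
  by rewrite (le_lt_trans GM) // ltry.
have [] := @dominated_convergence _ _ R mu2 setT measurableT
   (fun n => (EFin \o G) \_ (A n)) (cst 0) (EFin \o G).
- move=> n; apply/(measurable_restrict _ _ _) => //.
  by rewrite setTI; apply: measurable_funTS; exact/measurable_EFinP.
- exact: measurable_cst.
- apply/aeW => p _; apply: cvg_near_cst.
  by have := AE p; apply: filterS => n nA; rewrite /patch memNset.
- exact: iG.
- apply/aeW => p n _; rewrite /patch; case: ifPn => _ /=.
    by rewrite ger0_norm.
  by rewrite normr0 lee_fin.
move=> _ _; rewrite integral0 => /fine_cvgP [Hfin /cvgrPdist_lt /(_ e e0)] H.
near=> n.
rewrite integral_mkcond.
have h1 : (\int[mu2]_p ((EFin \o G) \_ (A n)) p)%E \is a fin_num by near: n.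
have h2 : (`|0 - fine (\int[mu2]_p ((EFin \o G) \_ (A n)) p)| < e)%R by near: n.
rewrite -(fineK h1) lee_fin; move: h2; rewrite sub0r normrN => /ltW; exact: le_trans (ler_norm _).
Unshelve. all: by end_near. Qed.
End plane_measure.

(** * Rules for continuity and complex derivatives *)

Section complex_derivative_rules.
Variable R : realType.
Implicit Types (f g : R[i] -> R[i]) (z w l : R[i]).

Lemma fcontM f g z : fcont f z -> fcont g z -> fcont (fun w => f w * g w) z.
Proof.
move=> fc gc e e0.
pose M := nc (f z) + nc (g z) + 1.
have M1 : 1 <= M by rewrite lerDr addr_ge0 ?nc_ge0.
have M0 : 0 < M by lra.
have e1 : 0 < Num.min 1 (e / (2 * M)) by rewrite lt_min ltr01 divr_gt0 // mulr_gt0.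
have [t t0 Ht] := fc _ e1; have [s s0 Hs] := gc _ e1.
exists (Num.min t s); first by rewrite lt_min t0 s0.
move=> w; rewrite lt_min => /andP[/Ht h1 /Hs h2].
move: h1 h2; rewrite !lt_min => /andP[h1 h1'] /andP[h2 h2'].
have -> : f w * g w - f z * g z = (f w - f z) * g w + f z * (g w - g z) by ring.
apply: (le_lt_trans (ncD _ _)); rewrite !ncM.
have gw : nc (g w) <= M.
  have := ncD (g w - g z) (g z); rewrite subrK /M => h.
  have := nc_ge0 (f z); lra.
have fz : nc (f z) <= M by rewrite /M; have := nc_ge0 (g z); lra.
have E1 : nc (f w - f z) * nc (g w) <= nc (f w - f z) * M.
  by apply: ler_wpM2l => //; exact: nc_ge0.
have E2 : nc (f z) * nc (g w - g z) <= M * nc (g w - g z).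
  by apply: ler_wpM2r => //; exact: nc_ge0.
have E3 : nc (f w - f z) * M < e / 2.
  by rewrite -ltr_pdivlMr // (lt_le_trans h1') // invfM mulrA.
have E4 : M * nc (g w - g z) < e / 2.
  by rewrite mulrC -ltr_pdivlMr // (lt_le_trans h2') // invfM mulrA.
lra.
Qed.

Lemma fcontV f z : fcont f z -> f z != 0 -> fcont (fun w => (f w)^-1) z.
Proof.
move=> fc fz e e0; have m0 : 0 < nc (f z) by rewrite nc_gt0.
set m := nc (f z) in m0 *.
have e1 : 0 < Num.min (m / 2) (e * m ^+ 2 / 2).
  by rewrite lt_min !divr_gt0 // mulr_gt0 // exprn_gt0.
have [t t0 Ht] := fc _ e1; exists t => // w /Ht; rewrite lt_min => /andP[h1 h2].
have fw : m / 2 < nc (f w).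
  have := nc_lip (f z) (f w); rewrite -/m ncC ler_norml => /andP[_ h]; lra.
have fw0 : f w != 0 by rewrite -nc_gt0; lra.
have -> : (f w)^-1 - (f z)^-1 = - (f w - f z) / (f w * f z) by field; rewrite fz fw0.
rewrite ncM ncN ncV ncM -/m ltr_pdivrMr; last by rewrite mulr_gt0 //; lra.
apply: (lt_le_trans h2).
have -> : e * m ^+ 2 / 2 = e * (m / 2 * m) by field.
by rewrite ler_pM2l // ler_pM2r // ltW.
Qed.

(** Differentiability becomes continuity of the completed difference quotient, so the rules for
    sums, products and inverses reduce to those for [fcont]. *)
Lemma caratheodory f z l :
  cderiv f z l <-> fcont (fun w => if w == z then l else (f w - f z) / (w - z)) z.
Proof.
split => [fl e e0|fc e e0].
  have e2 : 0 < e / 2 by lra.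
  have [t t0 Ht] := fl _ e2; exists t => // w wz; rewrite eqxx.
  case: eqVneq => [_|wnz]; first by rewrite subrr Normc.normc0.
  have wz0 : w - z != 0 by rewrite subr_eq0.
  have n0 : 0 < nc (w - z) by rewrite nc_gt0.
  have -> : (f w - f z) / (w - z) - l = (f w - f z - l * (w - z)) / (w - z).
    by rewrite [RHS]mulrBl mulfK.
  rewrite ncM ncV ltr_pdivrMr // (le_lt_trans (Ht _ wz)) // ltr_pM2r //; lra.
have [t t0 Ht] := fc _ e0; exists t => // w /Ht; rewrite eqxx.
case: eqVneq => [->|wnz] h; first by rewrite !subrr mulr0 subr0 Normc.normc0 mulr0.
have wz0 : w - z != 0 by rewrite subr_eq0.
have -> : f w - f z - l * (w - z) = ((f w - f z) / (w - z) - l) * (w - z).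
  by rewrite mulrBl divfK.
by rewrite ncM ler_wpM2r ?nc_ge0 // ltW.
Qed.

Lemma fcont_eq f g z : f =1 g -> fcont f z -> fcont g z.
Proof. by move=> /funext ->. Qed.

Lemma cderivM f g z l m : cderiv f z l -> cderiv g z m ->
  cderiv (fun w => f w * g w) z (l * g z + f z * m).
Proof.
move=> fl gm; have gc := cderiv_fcont gm.
move/caratheodory in fl; move/caratheodory in gm; apply/caratheodory.
apply: fcont_eq (fcontD (fcontM fl gc) (fcontM (@fcont_cst _ (f z) z) gm)) => w /=.
case: eqVneq => [->//|wz]; field; by rewrite subr_eq0.
Qed.

Lemma cderiv_shiftV z w : w != z -> cderiv (fun w => (w - z)^-1) w (- (w - z)^-2).
Proof.
move=> wz; have wz0 : w - z != 0 by rewrite subr_eq0.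
have sc : fcont (fun u : R[i] => u - z) w.
  have := cderiv_fcont (@cderiv_affine _ (- z) 1 w).
  by apply: fcont_eq => u; rewrite mul1r addrC.
have ic := fcontV sc wz0.
have wn0 : 0 < nc (w - z) by rewrite nc_gt0.
have [t t0 Ht] := sc _ wn0.
have pc := fcontN (fcontM ic (@fcont_cst _ (w - z)^-1 w)).
apply/caratheodory => e e0; have [s s0 Hs] := pc e e0.
exists (Num.min t s); first by rewrite lt_min t0 s0.
move=> u; rewrite lt_min => /andP[/Ht h1 /Hs].
rewrite eqxx; case: eqVneq => [->|uw]; first by rewrite !subrr.
have uz0 : u - z != 0.
  apply: contraTneq h1 => ->; by rewrite sub0r ncN ltxx.
suff -> : ((u - z)^-1 - (w - z)^-1) / (u - w) = - ((u - z)^-1 * (w - z)^-1).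
  by rewrite expr2 invfM.
by field; rewrite uz0 wz0 subr_eq0 uw.
Qed.

Lemma cderivD f g z l m : cderiv f z l -> cderiv g z m ->
  cderiv (fun w => f w + g w) z (l + m).
Proof.
move=> /caratheodory fl /caratheodory gm; apply/caratheodory.
apply: fcont_eq (fcontD fl gm) => w /=.
by case: eqVneq => // _; rewrite -mulrDl; congr (_ / _); ring.
Qed.

Lemma cderiv_cst A z : cderiv (fun=> A) z 0.
Proof.
move=> e e0; exists 1 => // w _; rewrite subrr mul0r subr0 Normc.normc0.
by apply: mulr_ge0; [exact: ltW | exact: nc_ge0].
Qed.

Lemma cderiv_id z : cderiv id z 1.
Proof.
move=> e e0; exists 1 => // w _; rewrite mul1r subrr Normc.normc0.
by apply: mulr_ge0; [exact: ltW | exact: nc_ge0].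
Qed.

Lemma cderiv_quot f A z w : (exists l, cderiv f w l) -> w != z ->
  exists l, cderiv (fun w => (f w - A) / (w - z)) w l.
Proof.
move=> [l fl] wz; eexists; apply: cderivM (cderiv_shiftV wz).
exact: cderivD fl (@cderiv_cst (- A) w).
Qed.

Lemma cderiv_mulid f w : (exists l, cderiv f w l) ->
  exists l, cderiv (fun w => f w * w) w l.
Proof. by move=> [l fl]; eexists; exact: cderivM fl (@cderiv_id w). Qed.
End complex_derivative_rules.

(** * Rectangles with controlled integrals along their sides *)

Section frames.
Variable R : realType.
Notation mu := (@lebesgue_measure R).
Notation RR := (measurableTypeR R * measurableTypeR R)%type.
Notation mu2 := (@lebesgue_measure R \x @lebesgue_measure R)%E.
Implicit Types (f g : R[i] -> R[i]) (z w l : R[i]) (D : set R[i]).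

Lemma cint_scale l (g : R -> R[i]) a b : ccont g a b ->
  cint (fun x => l * g x) a b = l * cint g a b.
Proof.
case: l => l1 l2 gc; rewrite /cint.
have r1 := ccont_Re gc; have i1 := ccont_Im gc.
have cM (k : R) h : ctn h a b -> ctn (fun x => k * h x) a b.
  by move=> hc; apply: ctnM => //; exact: ctn_cst.
rewrite -[RHS]/(_ +i* _)%C -!riZ // -riB; do ?exact: cM.
rewrite -riD; do ?exact: cM.
by congr (_ +i* _)%C; apply: eq_ri => x _; case: (g x) => u v //=; rewrite addrC.
Qed.

Lemma bd_scale l f a b c d : bcont f a b c d ->
  bd (fun w => l * f w) a b c d = l * bd f a b c d.
Proof.
move=> [f1 f2 f3 f4]; rewrite /bd /hseg /vseg !cint_scale;
  do ?[exact: hcont_ccont | exact: vcont_ccont].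
ring.
Qed.

Definition hlen f y a b := ri (fun x => nc (f (x +i* y)%C)) a b.
Definition vlen f x c d := ri (fun y => nc (f (x +i* y)%C)) c d.
Definition on_frame a b c d (x y : R) :=
  a <= x <= b /\ c <= y <= d /\ [\/ x = a, x = b, y = c | y = d].

Lemma ri_le_affine (g h : R -> R) a b (K L : R) : a <= b -> ctn g a b -> ctn h a b ->
  (forall x, a <= x <= b -> g x <= K * h x + L) -> ri g a b <= K * ri h a b + L * (b - a).
Proof.
move=> ab gc hc gh.
have Kh : ctn (fun x => K * h x) a b by apply: ctnM => //; exact: ctn_cst.
rewrite -riZ // -ri_cst // -riD //; last exact: ctn_cst.
by apply: le_ri => //; apply: ctnD => //; exact: ctn_cst.
Qed.

(** The affine bound is the one met by difference quotients (f - A) / (w - z) away from z: K comes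
    from the kernel and L from the constant A. *)
Lemma bd_frame_le f g a b c d (K L : R) : a <= b -> c <= d ->
  bcont f a b c d -> bcont g a b c d ->
  (forall x y, on_frame a b c d x y -> nc (g (x +i* y)%C) <= K * nc (f (x +i* y)%C) + L) ->
  nc (bd g a b c d) <= 2 * (K * (hlen f c a b + hlen f d a b + vlen f a c d + vlen f b c d)
     + 2 * L * ((b - a) + (d - c))).
Proof.
move=> ab cd [f1 f2 f3 f4] [g1 g2 g3 g4] gf.
rewrite (le_trans (bd_nc _ _ _ _ _)) //.
have aa : a <= a <= b by rewrite lexx ab.
have bb : a <= b <= b by rewrite lexx ab.
have cc : c <= c <= d by rewrite lexx cd.
have dd : c <= d <= d by rewrite lexx cd.
have H1 : nc (hseg g c a b) <= 2 * (K * hlen f c a b + L * (b - a)).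
  rewrite (le_trans (cint_nc (hcont_ccont g1))) // ler_pM2l //.
  apply: ri_le_affine => //; do ?exact/ccont_nc/hcont_ccont.
  by move=> x xab; apply: gf; do 2?split => //; constructor 3.
have H2 : nc (hseg g d a b) <= 2 * (K * hlen f d a b + L * (b - a)).
  rewrite (le_trans (cint_nc (hcont_ccont g2))) // ler_pM2l //.
  apply: ri_le_affine => //; do ?exact/ccont_nc/hcont_ccont.
  by move=> x xab; apply: gf; do 2?split => //; constructor 4.
have H3 : nc (vseg g b c d) <= 2 * (K * vlen f b c d + L * (d - c)).
  rewrite (le_trans (cint_nc (vcont_ccont g3))) // ler_pM2l //.
  apply: ri_le_affine => //; do ?exact/ccont_nc/vcont_ccont.
  by move=> y ycd; apply: gf; do 2?split => //; constructor 2.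
have H4 : nc (vseg g a c d) <= 2 * (K * vlen f a c d + L * (d - c)).
  rewrite (le_trans (cint_nc (vcont_ccont g4))) // ler_pM2l //.
  apply: ri_le_affine => //; do ?exact/ccont_nc/vcont_ccont.
  by move=> y ycd; apply: gf; do 2?split => //; constructor 1.
lra.
Qed.

(* AM-GM : 2 |h| <= t |h|^2 + 1 / t *)
Lemma ri_le_sq (h : R -> R) a b (t k : R) : 0 < t -> a <= b -> ctn h a b ->
  (\int[mu]_(x in `[a, b]) (h x ^+ 2)%:E <= k%:E)%E ->
  ri h a b <= (t * k + (b - a) / t) / 2.
Proof.
move=> t0 ab hc hk.
have h2c : ctn (fun x => h x ^+ 2) a b by apply: ctnM.
have k1 : ri (fun x => h x ^+ 2) a b <= k.
  rewrite -lee_fin fineK //.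
  by apply: integrable_fin_num => //; exact: ctn_integrable.
have : ri h a b <= t / 2 * ri (fun x => h x ^+ 2) a b + (2 * t)^-1 * (b - a).
  apply: ri_le_affine => // x _.
  have -> : t / 2 * h x ^+ 2 + (2 * t)^-1 = h x + (t * h x - 1) ^+ 2 / (2 * t).
    by field; rewrite gt_eqF.
  by rewrite lerDl divr_ge0 ?sqr_ge0 // mulr_ge0 // ltW.
move=> /le_trans; apply.
have : t / 2 * ri (fun x => h x ^+ 2) a b <= t / 2 * k by rewrite ler_pM2l // divr_gt0.
have -> : (2 * t)^-1 * (b - a) = (b - a) / t / 2 by field; rewrite gt_eqF.
lra.
Qed.

Lemma vlen_le D f x c d (t k : R) : 0 < t -> c <= d -> open D ->
  (forall z, D z -> fcont f z) -> (forall y, c <= y <= d -> D (x +i* y)%C) ->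
  (\int[mu]_y (sqnorm_on D f (x, y))%:E <= k%:E)%E ->
  vlen f x c d <= (t * k + (d - c) / t) / 2.
Proof.
move=> t0 cd Dop fc Dx Hk; apply: ri_le_sq => //.
  by apply: ccont_nc; apply: vcont_ccont => y ycd; apply: fc; exact: Dx.
apply: le_trans Hk.
have -> : (\int[mu]_(y in `[c, d]) (nc (f (x +i* y)%C) ^+ 2)%:E =
   \int[mu]_(y in `[c, d]) (sqnorm_on D f (x, y))%:E)%E.
  apply: eq_integral => y; rewrite inE /= in_itv /= => ycd.
  by rewrite /sqnorm_on mem_set //; exact: Dx.
apply: ge0_subset_integral => //.
- apply/measurable_EFinP.
  exact: (measurableT_comp (measurable_sqnorm_on Dop fc) (measurable_pair1 x)).
- by move=> y _; rewrite lee_fin sqnorm_on_ge0.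
Qed.

Lemma hlen_le D f y a b (t k : R) : 0 < t -> a <= b -> open D ->
  (forall z, D z -> fcont f z) -> (forall x, a <= x <= b -> D (x +i* y)%C) ->
  (\int[mu]_x (sqnorm_on D f (x, y))%:E <= k%:E)%E ->
  hlen f y a b <= (t * k + (b - a) / t) / 2.
Proof.
move=> t0 cd Dop fc Dx Hk; apply: ri_le_sq => //.
  by apply: ccont_nc; apply: hcont_ccont => x xab; apply: fc; exact: Dx.
apply: le_trans Hk.
have -> : (\int[mu]_(x in `[a, b]) (nc (f (x +i* y)%C) ^+ 2)%:E =
   \int[mu]_(x in `[a, b]) (sqnorm_on D f (x, y))%:E)%E.
  apply: eq_integral => x; rewrite inE /= in_itv /= => ycd.
  by rewrite /sqnorm_on mem_set //; exact: Dx.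
apply: ge0_subset_integral => //.
- apply/measurable_EFinP.
  exact: (measurableT_comp (measurable_sqnorm_on Dop fc) (measurable_pair2 y)).
- by move=> x _; rewrite lee_fin sqnorm_on_ge0.
Qed.

(** Each side may move in an interval of length r, which is the freedom used to select lines with
    small integral. *)
Definition framed (z : R[i]) (r a b c d : R) :=
  [/\ complex.Re z - 2 * r < a < complex.Re z - r,
      complex.Re z + r < b < complex.Re z + 2 * r,
      complex.Im z - 2 * r < c < complex.Im z - r &
      complex.Im z + r < d < complex.Im z + 2 * r].

(** Each side lies on a line where |f|^2 has integral at most 2 M / r and has length at most 4 r, so
    AM-GM with parameter t bounds its share by t M / r + 2 r / t. With M = 1 and t = r the total is
    12; with M = k^2 and t = r / k it is 12 k, for every r. *)
Lemma exists_good_frame D f z (M r t : R) (S : seq R) : open D ->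
  (forall w, D w -> fcont f w) -> 0 < M -> 0 < r -> 0 < t ->
  (\int[mu2]_p (sqnorm_on D f p)%:E <= M%:E)%E ->
  (forall x y, `|x - complex.Re z| < 2 * r -> `|y - complex.Im z| < 2 * r ->
     r < `|x - complex.Re z| /\ x \notin S \/ r < `|y - complex.Im z| /\ y \notin S ->
     D (x +i* y)%C) ->
  exists a b c d, [/\ framed z r a b c d,
    [/\ a \notin S, b \notin S, c \notin S & d \notin S],
    forall x y, on_frame a b c d x y -> D (x +i* y)%C &
    hlen f c a b + hlen f d a b + vlen f a c d + vlen f b c d <= 4 * (t * M / r + 2 * r / t)].
Proof.
move=> Dop fc M0 r0 t0 GM HD.
have mG := measurable_sqnorm_on Dop fc.
have G0 := sqnorm_on_ge0 D f.
have [|a [/andP[a1 a2] aS Ha]] := @exists_small_vline _ _ M (complex.Re z - 2 * r) (complex.Re z - r) S mG G0 GM M0; first lra.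
have [|b [/andP[b1 b2] bS Hb]] := @exists_small_vline _ _ M (complex.Re z + r) (complex.Re z + 2 * r) S mG G0 GM M0; first lra.
have [|c [/andP[c1 c2] cS Hc]] := @exists_small_hline _ _ M (complex.Im z - 2 * r) (complex.Im z - r) S mG G0 GM M0; first lra.
have [|d [/andP[d1 d2] dS Hd]] := @exists_small_hline _ _ M (complex.Im z + r) (complex.Im z + 2 * r) S mG G0 GM M0; first lra.
have E1 : complex.Re z - r - (complex.Re z - 2 * r) = r by ring.
have E2 : complex.Re z + 2 * r - (complex.Re z + r) = r by ring.
have E3 : complex.Im z - r - (complex.Im z - 2 * r) = r by ring.
have E4 : complex.Im z + 2 * r - (complex.Im z + r) = r by ring.
rewrite E1 in Ha; rewrite E2 in Hb; rewrite E3 in Hc; rewrite E4 in Hd.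
have Dv x y : x = a \/ x = b -> c <= y <= d -> D (x +i* y)%C.
  move=> xab yP; apply: HD.
  - by case: xab => ->; rewrite ltr_norml; apply/andP; split; lra.
  - exact: dist_itv_lt c1 d2 yP.
  - by left; split; case: xab => -> //; [apply: lt_norm_neg (lexx _) _|apply: lt_norm_pos (lexx _) _]; lra.
have Dh x y : y = c \/ y = d -> a <= x <= b -> D (x +i* y)%C.
  move=> ycd xP; apply: HD.
  - exact: dist_itv_lt a1 b2 xP.
  - by case: ycd => ->; rewrite ltr_norml; apply/andP; split; lra.
  - by right; split; case: ycd => -> //; [apply: lt_norm_neg (lexx _) _|apply: lt_norm_pos (lexx _) _]; lra.
exists a, b, c, d; split.
- by split; apply/andP.
- by [].
- move=> x y [xab [ycd]]; case=> e; [apply: Dv|apply: Dv|apply: Dh|apply: Dh] => //; by [left|right].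
have ab : a <= b by lra.
have cd : c <= d by lra.
have La : vlen f a c d <= (t * (2 * M / r) + (d - c) / t) / 2.
  by apply: (@vlen_le D) => // y; apply: Dv; left.
have Lb : vlen f b c d <= (t * (2 * M / r) + (d - c) / t) / 2.
  by apply: (@vlen_le D) => // y; apply: Dv; right.
have Lc : hlen f c a b <= (t * (2 * M / r) + (b - a) / t) / 2.
  by apply: (@hlen_le D) => // x; apply: Dh; left.
have Ld : hlen f d a b <= (t * (2 * M / r) + (b - a) / t) / 2.
  by apply: (@hlen_le D) => // x; apply: Dh; right.
have it : 0 < t^-1 by rewrite invr_gt0.
have W1 : (d - c) / t <= 4 * r / t by rewrite ler_pM2r //; lra.
have W2 : (b - a) / t <= 4 * r / t by rewrite ler_pM2r //; lra.
have Q1 : t * (2 * M / r) = 2 * (t * M / r) by field; rewrite gt_eqF.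
have Q2 : 4 * r / t = 2 * (2 * r / t) by field; rewrite gt_eqF.
rewrite Q1 in La Lb Lc Ld; rewrite Q2 in W1 W2.
lra.
Qed.
End frames.

(** * Pointwise bounds for square-integrable holomorphic functions *)

Section mean_bounds.
Variable R : realType.
Notation mu := (@lebesgue_measure R).
Notation RR := (measurableTypeR R * measurableTypeR R)%type.
Notation mu2 := (@lebesgue_measure R \x @lebesgue_measure R)%E.
Implicit Types (f g : R[i] -> R[i]) (z w l p : R[i]) (D : set R[i]).

Lemma ReV w : complex.Re w^-1 = complex.Re w / nc w ^+ 2.
Proof. by rewrite nc_sqr; case: w => x y. Qed.
Lemma ImV w : complex.Im w^-1 = - complex.Im w / nc w ^+ 2.
Proof. by rewrite nc_sqr; case: w => x y /=; rewrite mulNr. Qed.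
Lemma ImD w z : complex.Im (w + z) = complex.Im w + complex.Im z.
Proof. by case: w z => ? ? []. Qed.
Lemma Im_muli w : complex.Im ((0 +i* 1)%C * w) = complex.Re w.
Proof. by case: w => x y /=; rewrite mul0r mul1r add0r. Qed.

Lemma bcont_frame f a b c d : a <= b -> c <= d ->
  (forall x y, on_frame a b c d x y -> fcont f (x +i* y)%C) -> bcont f a b c d.
Proof.
move=> ab cd H; split => x xP; apply: H; split => //; rewrite ?lexx ?ab ?cd //; split => //;
  rewrite ?lexx ?ab ?cd //; by [constructor 1|constructor 2|constructor 3|constructor 4].
Qed.

Lemma framed_lt z r a b c d : 0 < r -> framed z r a b c d -> a < b /\ c < d.
Proof. by move=> r0 [/andP[? ?] /andP[? ?] /andP[? ?] /andP[? ?]]; split; lra. Qed.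

Lemma on_frame_bound z r a b c d x y : 0 < r -> framed z r a b c d -> on_frame a b c d x y ->
  [/\ `|x - complex.Re z| < 2 * r, `|y - complex.Im z| < 2 * r &
      r < `|x - complex.Re z| \/ r < `|y - complex.Im z| ].
Proof.
move=> r0 [/andP[? ?] /andP[? ?] /andP[? ?] /andP[? ?]] [/andP[? ?] [/andP[? ?] H]].
split; first by rewrite ltr_norml; apply/andP; split; lra.
  by rewrite ltr_norml; apply/andP; split; lra.
case: H => ->; [left|left|right|right]; rewrite ltr_normr; apply/orP;
  by [right; lra|left; lra].
Qed.

Lemma on_frame_nc z r a b c d x y : 0 < r -> framed z r a b c d -> on_frame a b c d x y ->
  r < nc ((x +i* y)%C - z) < 4 * r.
Proof.
move=> r0 H1 H2; have [h1 h2 h3] := on_frame_bound r0 H1 H2.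
have eR : complex.Re ((x +i* y)%C - z) = x - complex.Re z by rewrite ReB.
have eI : complex.Im ((x +i* y)%C - z) = y - complex.Im z by rewrite ImB.
apply/andP; split.
  case: h3 => h3; apply: (lt_le_trans h3); first by rewrite -eR; exact: Re_le_nc.
  by rewrite -eI; exact: Im_le_nc.
by rewrite (le_lt_trans (nc_le_ReIm _)) // eR eI; lra.
Qed.

Lemma frame_neq z r a b c d x y : 0 < r -> framed z r a b c d -> on_frame a b c d x y ->
  (x +i* y)%C != z.
Proof.
move=> r0 H1 H2; have /andP[h _] := on_frame_nc r0 H1 H2.
by rewrite -subr_eq0 -nc_gt0; lra.
Qed.

(** The true value is 2 pi i, but a lower bound suffices for Cauchy estimates. Each side adds at
    least 1/4 to the imaginary part: the relevant coordinate of w - z is at least r in absolute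
    value, |w - z|^2 <= 8 r^2, and the side is at least 2 r long. *)
Lemma winding_ge1 z r a b c d : 0 < r -> framed z r a b c d ->
  1 <= nc (bd (fun w => (w - z)^-1) a b c d).
Proof.
move=> r0 fr; have [ab cd] := framed_lt r0 fr.
have cont x y : on_frame a b c d x y -> fcont (fun w => (w - z)^-1) (x +i* y)%C.
  by move=> H; apply: cderiv_fcont; apply: cderiv_shiftV; exact: frame_neq r0 fr H.
have [c1 c2 c3 c4] := bcont_frame (ltW ab) (ltW cd) cont.
have sq x y : on_frame a b c d x y -> 0 < nc ((x +i* y)%C - z) ^+ 2 <= 8 * r ^+ 2.
  move=> H; have /andP[h1 h2] := on_frame_nc r0 fr H.
  have [h3 h4 _] := on_frame_bound r0 fr H.
  rewrite exprn_gt0 /=; last by lra.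
  rewrite nc_sqr ReB ImB /= -(real_normK (num_real (x - _))) -(real_normK (num_real (y - _))).
  have := normr_ge0 (x - complex.Re z); have := normr_ge0 (y - complex.Im z).
  move: h3 h4; set u := `|_|; set v := `|_| => h3 h4 v0 u0.
  have : u ^+ 2 <= (2 * r) ^+ 2 by rewrite ler_pXn2r ?nnegrE //; lra.
  have : v ^+ 2 <= (2 * r) ^+ 2 by rewrite ler_pXn2r ?nnegrE //; lra.
  by rewrite exprMn => *; lra.
have low q (n : R) : r <= q -> 0 < n <= 8 * r ^+ 2 -> (8 * r)^-1 <= q / n.
  move=> rq /andP[n0 n8]; rewrite ler_pdivlMr // ler_pdivrMl ?mulr_gt0 //.
  apply: (le_trans n8); rewrite expr2 mulrA ler_pM2l ?mulr_gt0 //.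
case: (fr) => [/andP[a1 a2] /andP[b1 b2] /andP[d1 d2] /andP[e1 e2]].
have i8 : 0 < (8 * r)^-1 by rewrite invr_gt0 mulr_gt0.
have quarter L : 2 * r <= L -> 4^-1 <= (8 * r)^-1 * L.
  move=> h; have -> : 4^-1 = (8 * r)^-1 * (2 * r) by field; rewrite gt_eqF.
  by rewrite ler_pM2l.
have aa : a <= a <= b by rewrite lexx ltW.
have bb : a <= b <= b by rewrite lexx ltW.
have cc : c <= c <= d by rewrite lexx ltW.
have dd : c <= d <= d by rewrite lexx ltW.
have I1 : 4^-1 <= complex.Im (hseg (fun w => (w - z)^-1) c a b).
  apply: (@le_trans _ _ ((8 * r)^-1 * (b - a))); first by apply: quarter; lra.
  rewrite -[X in _ <= X]/(ri (fun x => complex.Im ((x +i* c)%C - z)^-1) a b) -ri_cst; last exact: ltW.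
  apply: le_ri; [exact: ctn_cst|exact: (ccont_Im (hcont_ccont c1))|].
  move=> x xab; rewrite ImV; apply: low; first by rewrite ImB /=; lra.
  by apply: sq; split => //; split => //; constructor 3.
have I2 : 4^-1 <= - complex.Im (hseg (fun w => (w - z)^-1) d a b).
  rewrite -[- _]mulN1r; rewrite -[X in _ * X]/(ri (fun x => complex.Im ((x +i* d)%C - z)^-1) a b) -riZ; last exact: (ccont_Im (hcont_ccont c2)).
  apply: (@le_trans _ _ ((8 * r)^-1 * (b - a))); first by apply: quarter; lra.
  rewrite -ri_cst; last exact: ltW.
  apply: le_ri; [exact: ctn_cst| |].
    by apply: ctnM; [exact: ctn_cst|exact: (ccont_Im (hcont_ccont c2))].
  move=> x xab; rewrite ImV mulN1r mulNr opprK; apply: low; first by rewrite ImB /=; lra.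
  by apply: sq; split => //; split => //; constructor 4.
have I3 : 4^-1 <= complex.Re (vseg (fun w => (w - z)^-1) b c d).
  apply: (@le_trans _ _ ((8 * r)^-1 * (d - c))); first by apply: quarter; lra.
  rewrite -[X in _ <= X]/(ri (fun y => complex.Re ((b +i* y)%C - z)^-1) c d) -ri_cst; last exact: ltW.
  apply: le_ri; [exact: ctn_cst|exact: (ccont_Re (vcont_ccont c3))|].
  move=> y ycd; rewrite ReV; apply: low; first by rewrite ReB /=; lra.
  by apply: sq; split => //; split => //; constructor 2.
have I4 : 4^-1 <= - complex.Re (vseg (fun w => (w - z)^-1) a c d).
  rewrite -[- _]mulN1r; rewrite -[X in _ * X]/(ri (fun y => complex.Re ((a +i* y)%C - z)^-1) c d) -riZ; last exact: (ccont_Re (vcont_ccont c4)).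
  apply: (@le_trans _ _ ((8 * r)^-1 * (d - c))); first by apply: quarter; lra.
  rewrite -ri_cst; last exact: ltW.
  apply: le_ri; [exact: ctn_cst| |].
    by apply: ctnM; [exact: ctn_cst|exact: (ccont_Re (vcont_ccont c4))].
  move=> y ycd; rewrite ReV mulN1r -mulNr; apply: low; first by rewrite ReB /=; lra.
  by apply: sq; split => //; split => //; constructor 1.
apply: (le_trans _ (Im_le_nc _)); apply: (le_trans _ (ler_norm _)).
rewrite /bd ImD Im_muli ImB ReB; lra.
Qed.

(** The section lemma applied to the zero function. *)
Lemma notin_between (al be : R) (S : seq R) : al < be -> exists x, al < x < be /\ x \notin S.
Proof.
move=> ab; have mc : measurable_fun setT (cst 0%E : measurableTypeR R -> \bar R).
  exact: measurable_cst.
have i0 : (\int[mu]_x (cst 0%E : measurableTypeR R -> \bar R) x <= 1%:E)%E.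
  by rewrite /= integral0 lee_fin.
have [x [x1 x2 _]] := exists_small_section S mc (fun _ => lexx _) i0 ltr01 ab.
by exists x.
Qed.

Lemma exists_frame z r (S : seq R) : 0 < r -> exists a b c d, framed z r a b c d /\
  [/\ a \notin S, b \notin S, c \notin S & d \notin S].
Proof.
move=> r0.
have [|a [a1 aS]] := @notin_between (complex.Re z - 2 * r) (complex.Re z - r) S; first lra.
have [|b [b1 bS]] := @notin_between (complex.Re z + r) (complex.Re z + 2 * r) S; first lra.
have [|c [c1 cS]] := @notin_between (complex.Im z - 2 * r) (complex.Im z - r) S; first lra.
have [|d [d1 dS]] := @notin_between (complex.Im z + r) (complex.Im z + 2 * r) S; first lra.
by exists a, b, c, d.
Qed.

Lemma framed_box z r e a b c d : 0 < r -> 2 * r <= e -> framed z r a b c d -> box z e a b c d.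
Proof.
by move=> r0 re [/andP[? ?] /andP[? ?] /andP[? ?] /andP[? ?]]; split; apply/andP; split; lra.
Qed.

(** Near z the quotient is bounded by 1 + |l|, so its integral along a frame is proportional to the
    size of the frame. *)
Lemma removable_quot f z l (e0 : R) : 0 < e0 -> cderiv f z l ->
  (forall w, nc (w - z) < e0 -> exists m, cderiv f w m) ->
  removable (fun w => (f w - f z) / (w - z)) z.
Proof.
move=> e00 fl fd e S e1.
have [t t0 Ht] := fl 1 ltr01.
pose K := 1 + nc l.
have K0 : 0 < K by rewrite ltr_wpDr ?nc_ge0.
(* The points of the frame are within 4 r of z, and the boundary integral is at most 4 K times the
   sum of two adjacent sides, hence below 32 K r <= e / 2. *)
pose r := Num.min (Num.min (e / 2) (e / (64 * K))) (Num.min (t / 4) (e0 / 4)).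
have r0 : 0 < r by rewrite !lt_min !divr_gt0 ?mulr_gt0.
have : r <= r by []. rewrite {2}/r !le_min => /andP[/andP[r1 r2] /andP[r3 r4]].
have [a [b [c [d [fr [aS bS cS dS]]]]]] := exists_frame z S r0.
have [ab cd] := framed_lt r0 fr.
exists a, b, c, d; split => //; first by apply: framed_box fr => //; lra.
have bc : bcont (fun w => (f w - f z) / (w - z)) a b c d.
  apply: bcont_frame; try exact: ltW.
  move=> x y xy; have /andP[_ h] := on_frame_nc r0 fr xy.
  have [|m Hm] := @cderiv_quot _ f (f z) z (x +i* y)%C _ (frame_neq r0 fr xy).
    by apply: fd; lra.
  exact: cderiv_fcont Hm.
have bf0 : bcont (fun=> 0 : R[i]) a b c d.
  by apply: bcont_frame; try exact: ltW; move=> *; exact: fcont_cst.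
have bnd x y : on_frame a b c d x y ->
    nc ((f (x +i* y)%C - f z) / ((x +i* y)%C - z)) <= 0 * nc (0 : R[i]) + K.
  move=> xy; rewrite mul0r add0r.
  have /andP[h1 h2] := on_frame_nc r0 fr xy.
  have n0 : 0 < nc ((x +i* y)%C - z) by lra.
  rewrite ncM ncV ler_pdivrMr //.
  have -> : f (x +i* y)%C - f z =
     (f (x +i* y)%C - f z - l * ((x +i* y)%C - z)) + l * ((x +i* y)%C - z) by rewrite subrK.
  rewrite (le_trans (ncD _ _)) // ncM /K mulrDl lerD2r; apply: Ht; lra.
have H := bd_frame_le (ltW ab) (ltW cd) bf0 bc bnd; rewrite mul0r add0r in H.
apply: (le_lt_trans H).
case: fr => [/andP[? ?] /andP[? ?] /andP[? ?] /andP[? ?]].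
have : K * (b - a + (d - c)) < K * (8 * r) by rewrite ltr_pM2l //; lra.
have : K * r <= e / 64.
  have -> : e / 64 = K * (e / (64 * K)) by field; rewrite gt_eqF.
  by rewrite ler_pM2l.
lra.
Qed.

(** The maximum-norm distance, whose balls are squares with sides parallel to the axes. *)
Definition cheb (w p : R[i]) : R :=
  Num.max `|complex.Re w - complex.Re p| `|complex.Im w - complex.Im p|.
Lemma cheb_nc w p : cheb w p <= nc (w - p).
Proof. by rewrite ge_max -ReB -ImB Re_le_nc Im_le_nc. Qed.
Lemma nc_cheb w p : nc (w - p) <= 2 * cheb w p.
Proof.
rewrite (le_trans (nc_le_ReIm _)) // ReB ImB mulr_natl mulr2n lerD // le_max lexx ?orbT //.
Qed.

Lemma openC_P D : open D <-> forall z, D z -> exists2 e : R, 0 < e & forall w, nc (w - z) < e -> D w.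
Proof.
rewrite openE; split => [Dop z /Dop /nbhsC_P //|H z /H h]; exact/nbhsC_P.
Qed.

Lemma sqnorm_on_setI D A f (q : RR) :
  sqnorm_on (D `&` A) f q = if pair_complex q \in A then sqnorm_on D f q else 0.
Proof. by rewrite /sqnorm_on in_setI; case: (_ \in A); rewrite ?andbT ?andbF. Qed.

Lemma integral_sqnorm_setI D A f : (\int[mu2]_q (sqnorm_on (D `&` A) f q)%:E =
  \int[mu2]_(q in (@pair_complex R @^-1` A : set RR)) (sqnorm_on D f q)%:E)%E.
Proof.
rewrite [RHS]integral_mkcond; apply: eq_integral => q _.
by rewrite sqnorm_on_setI /patch -[q \in _]/(pair_complex q \in A); case: ifP.
Qed.

Lemma shrink_integral_small D f (M : R) (A : nat -> set R[i]) : open D ->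
  (forall w, D w -> fcont f w) -> (\int[mu2]_p (sqnorm_on D f p)%:E <= M%:E)%E ->
  (forall n, open (A n)) -> (forall w, \forall n \near \oo, ~ A n w) ->
  forall e : R, 0 < e ->
  \forall n \near \oo, (\int[mu2]_p (sqnorm_on (D `&` A n) f p)%:E <= e%:E)%E.
Proof.
move=> Dop fc GM Aop AE e e0.
have := @integral_tail_small R _ M (fun n => (fun q : RR => A n (pair_complex q)))
  (measurable_sqnorm_on Dop fc) (sqnorm_on_ge0 D f) GM.
move=> /(_ (fun n => measurable_pair_open (Aop n))) H.
have AE' (q : RR) : \forall n \near \oo, ~ A n (pair_complex q) by exact: AE.
have := H AE' e e0.
by apply: filterS => n; rewrite integral_sqnorm_setI.
Qed.

(** The L^2 mass of f on a punctured disc tends to 0 with the radius, and by Cauchy-Schwarz the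
    integral of |f| along a good frame is controlled by the square root of that mass, independently
    of the size of the frame. *)
Lemma removable_L2 D f g p (M C e0 : R) : open D -> (forall w, D w -> fcont f w) ->
  (\int[mu2]_q (sqnorm_on D f q)%:E <= M%:E)%E -> 0 < e0 -> 0 < C ->
  (forall w, w != p -> nc (w - p) < e0 ->
    [/\ D w, fcont g w & nc (g w) <= C * nc (f w) + C]) -> removable g p.
Proof.
move=> Dop fc GM e00 C0 Hg e S e1.
pose A n : set R[i] := [set w | w != p /\ nc (w - p) < n.+1%:R^-1].
have Aop n : open (A n).
  apply/openC_P => w [wp wn]; have w0 : 0 < nc (w - p) by rewrite nc_gt0 subr_eq0.
  exists (Num.min (nc (w - p)) (n.+1%:R^-1 - nc (w - p))).
    by rewrite lt_min w0 subr_gt0.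
  move=> u; rewrite lt_min => /andP[u1 u2]; split.
    by apply: contraTneq u1 => ->; rewrite ncC ltxx.
  by apply: (le_lt_trans (nc_dist_triangle w u p)); rewrite -ltrBrDr.
have AE w : \forall n \near \oo, ~ A n w.
  have [->|wp] := eqVneq w p; first by apply: nearW => n [/eqP].
  have w0 : 0 < nc (w - p) by rewrite nc_gt0 subr_eq0.
  exists (Num.truncn (nc (w - p))^-1) => // n /= hn [_]; apply/negP; rewrite -leNgt.
  rewrite invf_ple ?posrE //; apply: ltW; apply: (lt_le_trans (truncnS_gt _)).
  by rewrite ler_nat.
(* The final bound is 2 (12 C k + 4 C k) = 32 C k, which is less than e. *)
have [k [k0 kC]] : exists k : R, 0 < k /\ k <= e / (200 * C).
  by exists (e / (200 * C)); rewrite divr_gt0 ?mulr_gt0.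
have k20 : 0 < k ^+ 2 by rewrite exprn_gt0.
pose e2 := Num.min e (Num.min e0 (k : R)).
have e20 : 0 < e2 by rewrite /e2 lt_min e1 lt_min e00 k0.
have : \forall n \near \oo, n.+1%:R^-1 < e2.
  exists (Num.truncn e2^-1) => // n /= hn.
  rewrite invf_plt ?posrE //; apply: (lt_le_trans (truncnS_gt _)).
  by rewrite ler_nat.
move=> /(filterI (shrink_integral_small Dop fc GM Aop AE k20)) [N _ /(_ N (leqnn N))] [HN Ne].
pose r : R := N.+1%:R^-1 / 4.
have i0 : 0 < N.+1%:R^-1 :> R by rewrite invr_gt0 ltr0n.
have r0 : 0 < r by rewrite divr_gt0.
have rE : N.+1%:R^-1 = 4 * r by rewrite /r; field; rewrite gt_eqF.
rewrite rE in Ne.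
have : e2 <= e2 by [].
rewrite {2}/e2 !le_min => /and3P[e2e e2e0 e2k].
(* Mass k^2 and t = r / k balance the two AM-GM terms. The frame lies within 4 r = 1 / (N + 1) of p,
   hence inside A N. *)
have [||||a [b [c [d [fr [aS bS cS dS] frD len]]]]] :=
  @exists_good_frame R (D `&` A N) f p (k ^+ 2) r (r / k) S _ _ k20 r0 _ HN _.
- by apply: openI.
- by move=> w [Dw _]; exact: fc.
- by rewrite divr_gt0.
- move=> x y xr yr H.
  have n4 : nc ((x +i* y)%C - p) < 4 * r.
    by rewrite (le_lt_trans (nc_le_ReIm _)) // ReB ImB /=; lra.
  have np : (x +i* y)%C != p.
    apply/negP => /eqP xyp; move: H; rewrite -xyp /= !subrr normr0 => -[[h _]|[h _]];
      by have := lt_trans r0 h; rewrite ltxx.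
  split; last by split => //; rewrite rE.
  have nn : nc ((x +i* y)%C - p) < e0 by apply: (lt_trans n4); apply: (lt_le_trans Ne).
  by have [] := Hg _ np nn.
have [ab cd] := framed_lt r0 fr.
exists a, b, c, d; split => //.
  by apply: framed_box fr => //; lra.
have near w x y : w = (x +i* y)%C -> on_frame a b c d x y -> w != p /\ nc (w - p) < e0.
  move=> -> xy; split; first exact: frame_neq r0 fr xy.
  by have /andP[_ h] := on_frame_nc r0 fr xy; lra.
have bf : bcont f a b c d.
  apply: bcont_frame; try exact: ltW.
  by move=> x y /frD[Dxy _]; exact: fc.
have bg : bcont g a b c d.
  apply: bcont_frame; try exact: ltW.
  by move=> x y xy; have [h1 h2] := near _ _ _ erefl xy; have [] := Hg _ h1 h2.
have := bd_frame_le (ltW ab) (ltW cd) bf bg (K := C) (L := C).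
move=> H; apply: (le_lt_trans (H _)) => {H}.
  by move=> x y xy; have [h1 h2] := near _ _ _ erefl xy; have [] := Hg _ h1 h2.
have EL : r / k * k ^+ 2 / r + 2 * r / (r / k) = 3 * k by field; rewrite !gt_eqF.
rewrite EL in len.
have len' : C * (hlen f c a b + hlen f d a b + vlen f a c d + vlen f b c d) <= C * (4 * (3 * k)).
  by rewrite ler_pM2l.
have kC' : C * k <= e / 200.
  have -> : e / 200 = C * (e / (200 * C)) by field; rewrite gt_eqF.
  by rewrite ler_pM2l.
have per : C * (b - a + (d - c)) <= C * (2 * k).
  rewrite ler_pM2l //.
  case: fr => [/andP[? ?] /andP[? ?] /andP[? ?] /andP[? ?]]; lra.
lra.
Qed.
End mean_bounds.

Section pointwise_bounds.
Variable R : realType.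
Notation mu2 := (@lebesgue_measure R \x @lebesgue_measure R)%E.
Implicit Types (f g : R[i] -> R[i]) (z w l p : R[i]) (D : set R[i]).

Lemma seq_isolated (P : seq R[i]) p :
  exists2 e : R, 0 < e & forall q, q \in P -> q != p -> e <= nc (q - p).
Proof.
elim: P => [|q P [e e0 IH]]; first by exists 1.
have [->|qp] := eqVneq q p.
  exists e => // q'; rewrite inE => /predU1P[->|]; last exact: IH.
  by rewrite eqxx.
exists (Num.min e (nc (q - p))).
  by rewrite lt_min e0 nc_gt0 subr_eq0.
move=> q'; rewrite inE => /predU1P[-> _|qP qq]; first by rewrite ge_min lexx orbT.
by rewrite ge_min IH.
Qed.

(** Cauchy's formula in the form of an inequality, with A in the place of f(z): the bound
    [winding_ge1] replaces the exact winding integral. *)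
Lemma frame_kernel_bd f z r a b c d A : 0 < r -> framed z r a b c d ->
  (forall x y, on_frame a b c d x y -> fcont f (x +i* y)%C) ->
  bd (fun w => (f w - A) / (w - z)) a b c d = 0 ->
  nc A <= nc (bd (fun w => f w / (w - z)) a b c d).
Proof.
move=> r0 fr fc bd0; have [ab cd] := framed_lt r0 fr.
have kc x y : on_frame a b c d x y -> fcont (fun w => (w - z)^-1) (x +i* y)%C.
  by move=> xy; apply: cderiv_fcont; apply: cderiv_shiftV; exact: frame_neq r0 fr xy.
have bk := bcont_frame (ltW ab) (ltW cd) kc.
have E : bd (fun w => (f w - A) / (w - z)) a b c d =
   bd (fun w => f w / (w - z)) a b c d - A * bd (fun w => (w - z)^-1) a b c d.
  rewrite -bd_scale // -bd_sub.
  - by apply: eq_bd; [exact: ltW|exact: ltW|move=> x y _ _ _; rewrite mulrBl].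
  - apply: bcont_frame; try exact: ltW.
    by move=> x y xy; apply: fcontM; [exact: fc|exact: kc].
  - apply: bcont_frame; try exact: ltW.
    by move=> x y xy; apply: fcontM; [exact: fcont_cst|exact: kc].
have -> : bd (fun w => f w / (w - z)) a b c d = A * bd (fun w => (w - z)^-1) a b c d.
  by apply/eqP; rewrite -subr_eq0 -E bd0.
by rewrite ncM ler_peMr ?nc_ge0 // (winding_ge1 r0 fr).
Qed.

Lemma between_of_dist (x q a b : R) : `|x - q| < q - a -> `|x - q| < b - q -> a <= x <= b.
Proof. by rewrite !ltr_norml => /andP[? ?] /andP[? ?]; apply/andP; split; lra. Qed.

Lemma nc_lt_cheb (x y r : R) z : nc ((x +i* y)%C - z) < r ->
  `|x - complex.Re z| < r /\ `|y - complex.Im z| < r.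
Proof.
move=> h; have := le_lt_trans (cheb_nc (x +i* y)%C z) h.
by rewrite gt_max /= => /andP[].
Qed.

(** A good frame with t = r has total integral of |f| at most 12, the kernel is at most 1 / r on it,
    and [cint_nc] adds a factor 2. The difference quotient is exceptional at z, where f is
    differentiable, and at the points of P, where it is square integrable up to a constant. *)
Lemma L2_mean_bound D f z r (P : seq R[i]) : open D ->
  (forall w, D w -> exists l, cderiv f w l) ->
  (\int[mu2]_q (sqnorm_on D f q)%:E <= 1%:E)%E -> D z -> 0 < r ->
  (forall w, `|complex.Re w - complex.Re z| < 2 * r ->
     `|complex.Im w - complex.Im z| < 2 * r -> w \notin P -> D w) ->
  nc (f z) <= 24 / r.
Proof.
move=> Dop fd G1 Dz r0 HD.
have fc w : D w -> fcont f w by move=> /fd[l]; exact: cderiv_fcont.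
pose S := [seq complex.Re q | q <- z :: P] ++ [seq complex.Im q | q <- z :: P].
have ReS x q : x \notin S -> q \in z :: P -> complex.Re q != x.
  move=> xS qP; apply: contra xS => /eqP <-; rewrite mem_cat; apply/orP; left.
  by apply/mapP; exists q.
have ImS x q : x \notin S -> q \in z :: P -> complex.Im q != x.
  move=> xS qP; apply: contra xS => /eqP <-; rewrite mem_cat; apply/orP; right.
  by apply/mapP; exists q.
have [a [b [c [d [fr [aS bS cS dS] frD len]]]]] : exists a b c d, [/\ framed z r a b c d,
    [/\ a \notin S, b \notin S, c \notin S & d \notin S],
    forall x y, on_frame a b c d x y -> D (x +i* y)%C &
    hlen f c a b + hlen f d a b + vlen f a c d + vlen f b c d <= 4 * (r * 1 / r + 2 * r / r)].
  apply: exists_good_frame => // x y xr yr H; apply: HD => //.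
  apply/negP => xyP; case: H => -[_ /negP]; apply; rewrite mem_cat; apply/orP; [left|right].
    by apply/mapP; exists (x +i* y)%C => //; rewrite inE xyP orbT.
  by apply/mapP; exists (x +i* y)%C => //; rewrite inE xyP orbT.
have [ab cd] := framed_lt r0 fr.
case: (fr) => [/andP[a1 a2] /andP[b1 b2] /andP[c1 c2] /andP[d1 d2]].
have HD' x y : a <= x <= b -> c <= y <= d -> (x +i* y)%C \notin P -> D (x +i* y)%C.
  by move=> xP yP xyP; apply: HD => //; [exact: dist_itv_lt a1 b2 xP|exact: dist_itv_lt c1 d2 yP].
have bd0 : bd (fun w => (f w - f z) / (w - z)) a b c d = 0.
  apply: (@goursat_except _ (z :: P)) => //.
  - by move=> p pP; split; [exact: ReS|exact: ReS|exact: ImS|exact: ImS].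
  - move=> x y xab ycd; rewrite inE negb_or => /andP[xz xP].
    by apply: cderiv_quot => //; apply: fd; exact: HD'.
  move=> p pP /andP[pa pb] /andP[pc pd].
  have [->|pz] := eqVneq p z.
    have [l fl] := fd z Dz; have [e e0 De] := (openC_P D).1 Dop z Dz.
    by apply: removable_quot e0 fl _ => w /De /fd.
  have [e e0 He] := seq_isolated P p.
  have pz0 : 0 < nc (p - z) by rewrite nc_gt0 subr_eq0.
  (* In the disc of radius e1 around p there is no other point of P, the kernel is at most 2 / |p -
     z|, and the rectangle is not left. *)
  pose e1 := Num.min (Num.min e (nc (p - z) / 2))
    (Num.min (Num.min (complex.Re p - a) (b - complex.Re p))
             (Num.min (complex.Im p - c) (d - complex.Im p))).
  have e10 : 0 < e1 by rewrite !lt_min e0 divr_gt0 // !subr_gt0 pa pb pc pd.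
  pose K := 2 / nc (p - z) * (1 + nc (f z)).
  have K1 : 2 / nc (p - z) <= K.
    by rewrite /K ler_peMr ?lerDl ?nc_ge0 // divr_ge0 // ltW.
  have K2 : 2 / nc (p - z) * nc (f z) <= K.
    by rewrite /K ler_pM2l ?divr_gt0 // lerDr.
  have K0 : 0 < K by rewrite (lt_le_trans _ K1) // divr_gt0.
  apply: (removable_L2 Dop fc G1 e10 K0) => -[u v] wp.
  rewrite !lt_min => /andP[/andP[w1 w2] /andP[/andP[w3 w4] /andP[w5 w6]]].
  have [u3 _] := nc_lt_cheb w3; have [u4 _] := nc_lt_cheb w4.
  have [_ u5] := nc_lt_cheb w5; have [_ u6] := nc_lt_cheb w6.
  have Dw : D (u +i* v)%C.
    apply: HD'.
    - exact: between_of_dist u3 u4.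
    - exact: between_of_dist u5 u6.
    - by apply/negP => /He /(_ wp); rewrite leNgt w1.
  have far : nc (p - z) / 2 < nc ((u +i* v)%C - z).
    have := nc_dist_triangle (u +i* v)%C p z; rewrite (ncC p (u +i* v)%C); lra.
  have wz : (u +i* v)%C != z.
    by rewrite -subr_eq0 -nc_gt0 (lt_trans _ far) // divr_gt0.
  split => //.
    have [l Hl] := cderiv_quot (f z) (fd _ Dw) wz; exact: cderiv_fcont Hl.
  rewrite ncM ncV.
  have iv : (nc ((u +i* v)%C - z))^-1 <= 2 / nc (p - z).
    rewrite -[2 / _]invrK invf_div lef_pV2 ?posrE ?divr_gt0 //; first exact: ltW.
    by rewrite (lt_trans _ far) // divr_gt0.
  apply: (@le_trans _ _ ((nc (f (u +i* v)%C) + nc (f z)) * (2 / nc (p - z)))).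
    by apply: ler_pM; rewrite ?nc_ge0 ?invr_ge0 ?nc_ge0 // ncB.
  rewrite mulrDl lerD //; last by rewrite mulrC.
  by rewrite mulrC ler_wpM2r ?nc_ge0.
apply: (le_trans (frame_kernel_bd r0 fr (fun x y xy => fc _ (frD x y xy)) bd0)).
have bf : bcont f a b c d.
  by apply: bcont_frame; try exact: ltW; move=> x y /frD; exact: fc.
have kc x y : on_frame a b c d x y -> fcont (fun w => f w / (w - z)) (x +i* y)%C.
  move=> xy; apply: fcontM; first by apply: fc; exact: frD.
  by apply: cderiv_fcont; apply: cderiv_shiftV; exact: frame_neq r0 fr xy.
have bk := bcont_frame (ltW ab) (ltW cd) kc.
have bnd x y : on_frame a b c d x y ->
    nc (f (x +i* y)%C / ((x +i* y)%C - z)) <= r^-1 * nc (f (x +i* y)%C) + 0.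
  move=> xy; rewrite addr0 ncM ncV mulrC ler_wpM2r ?nc_ge0 //.
  have /andP[h _] := on_frame_nc r0 fr xy.
  by rewrite lef_pV2 ?posrE ?(ltW h) // (lt_trans r0).
apply: (le_trans (bd_frame_le (ltW ab) (ltW cd) bf bk bnd)).
have E : 4 * (r * 1 / r + 2 * r / r) = 12 by field; rewrite gt_eqF.
rewrite E in len; rewrite mulr0 mul0r addr0.
have -> : 24 / r = 2 * (r^-1 * 12) by ring.
by rewrite ler_pM2l // ler_pM2l // invr_gt0.
Qed.
End pointwise_bounds.

(** * Decay of square-integrable holomorphic functions at infinity *)

Section exterior.
Variable R : realType.
Notation mu2 := (@lebesgue_measure R \x @lebesgue_measure R)%E.
Implicit Types (f g : R[i] -> R[i]) (z w l p : R[i]) (D : set R[i]).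

Lemma cheb_real w : cheb w 0 = Num.max `|complex.Re w| `|complex.Im w|.
Proof. by rewrite /cheb /= !subr0. Qed.

Lemma framed_neq z r a b c d : 0 < r -> framed z r a b c d ->
  [/\ complex.Re z != a, complex.Re z != b, complex.Im z != c & complex.Im z != d].
Proof.
move=> r0 [/andP[_ a2] /andP[b1 _] /andP[_ c2] /andP[d1 _]].
by split; apply/eqP => e; move: a2 b1 c2 d1; rewrite ?e; lra.
Qed.

Lemma framed_nested z r t a b c d a' b' c' d' (m : R) :
  `|complex.Re z| <= m -> `|complex.Im z| <= m -> m + 2 * r <= t ->
  framed z t a b c d -> framed 0 r a' b' c' d' -> [/\ a < a', b' < b, c < c' & d' < d].
Proof.
rewrite !ler_norml => /andP[R1 R2] /andP[I1 I2] mt.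
move=> [/andP[A1 A2] /andP[B1 B2] /andP[C1 C2] /andP[D1 D2]].
move=> [/andP[/= a1 a2] /andP[/= b1 b2] /andP[/= c1 c2] /andP[/= d1 d2]].
by split; lra.
Qed.

Lemma norm_between (a b x r : R) : - r < a -> b < r -> a <= x -> x <= b -> ~ r < `|x|.
Proof. by move=> *; apply/negP; rewrite -leNgt ler_norml; apply/andP; split; lra. Qed.

Lemma le_double (s t u m T : R) : s <= t + u -> u <= 2 * m -> 2 * m <= T -> T < t -> s <= 2 * t.
Proof. lra. Qed.

Lemma le_quadruple (L k : R) : L <= 12 * k -> 2 * (2 * L) <= 48 * k.
Proof. lra. Qed.

Lemma lt_norm_far (u v m T N r : R) : `|v| <= m -> 2 * m <= T -> N + m <= T -> 4 * r < m -> 0 < m ->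
  T < `|u - v| -> N < `|u| /\ r < `|u|.
Proof. by move=> *; have := ler_normB u v; split; lra. Qed.

(** Cauchy's formula for h = w f(w) between a small frame around 0 and a huge frame around z. The
    difference quotient of h has the same integral along both; the inner frame does not enclose z,
    so h(z) times the outer winding integral is the difference of the two integrals of h / (w - z).
    The outer one tends to 0 and the inner one gives 192 r / m. *)
Lemma L2_exterior_bound D f z r : open D ->
  (forall w, D w -> exists l, cderiv f w l) ->
  (\int[mu2]_q (sqnorm_on D f q)%:E <= 1%:E)%E -> 0 < r ->
  (forall w, r < `|complex.Re w| \/ r < `|complex.Im w| -> D w) ->
  4 * r < cheb z 0 -> nc (f z) <= 192 * r / cheb z 0 ^+ 2.
Proof.
move=> Dop fd G1 r0 HD; set m := cheb z 0 => m4.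
have fc w : D w -> fcont f w by move=> /fd[l]; exact: cderiv_fcont.
have m0 : 0 < m by lra.
have zm : nc z <= 2 * m by have := nc_cheb z 0; rewrite subr0.
have mz : m <= nc z by have := cheb_nc z 0; rewrite subr0.
have Rem : `|complex.Re z| <= m by rewrite /m cheb_real le_max lexx.
have Imm : `|complex.Im z| <= m by rewrite /m cheb_real le_max lexx orbT.
have mE : m = `|complex.Re z| \/ m = `|complex.Im z|.
  by rewrite /m cheb_real /Num.max; case: ifP => _; [right|left].
have Dz : D z by apply: HD; case: mE => mE; [left|right]; lra.
pose S := [:: complex.Re z; complex.Im z].
have [a' [b' [c' [d' [fr' [aS bS cS dS] frD' len']]]]] : exists a b c d, [/\ framed 0 r a b c d,
    [/\ a \notin S, b \notin S, c \notin S & d \notin S],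
    forall x y, on_frame a b c d x y -> D (x +i* y)%C &
    hlen f c a b + hlen f d a b + vlen f a c d + vlen f b c d <= 4 * (r * 1 / r + 2 * r / r)].
  apply: exists_good_frame => // x y _ _; rewrite !subr0 => -[[h _]|[h _]]; apply: HD; by [left|right].
have [ab' cd'] := framed_lt r0 fr'.
case: (fr'); rewrite /= !sub0r !add0r => /andP[a1 a2] /andP[b1 b2] /andP[c1 c2] /andP[d1 d2].
(* Square integrability at infinity pays for one factor w: on a frame of radius T around z the
   quotient |w| / |w - z| is bounded and the integral of |f| tends to 0. That factor improves the
   decay from 1 / |z| to 1 / |z|^2. *)
pose h w := f w * w.
pose q w := (h w - h z) / (w - z).
have hd w : D w -> exists l, cderiv h w l by move=> /fd /cderiv_mulid.
have qd w : D w -> w != z -> exists l, cderiv q w l.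
  by move=> /hd ? ?; exact: cderiv_quot.
have hc w : D w -> fcont h w by move=> /hd[l]; exact: cderiv_fcont.
have remq : removable q z.
  have [l fl] := hd z Dz; have [e e0 De] := (openC_P D).1 Dop z Dz.
  by apply: removable_quot e0 fl _ => w /De /hd.
have znin : 2 * r < `|complex.Re z| \/ 2 * r < `|complex.Im z|.
  by case: mE => mE; [left|right]; lra.
have inner_far x y : on_frame a' b' c' d' x y -> m / 2 < nc ((x +i* y)%C - z).
  move=> xy; have [] := on_frame_bound r0 fr' xy; rewrite /= !subr0 => x2 y2 _.
  have := cheb_nc (x +i* y)%C z; rewrite /cheb /= ge_max => /andP[k1 k2].
  have t1 := lerB_dist (complex.Re z) x; have t2 := lerB_dist (complex.Im z) y.
  rewrite (distrC _ x) in t1; rewrite (distrC _ y) in t2.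
  case: mE => mE; lra.
have bdin0 : bd (fun w => (w - z)^-1) a' b' c' d' = 0.
  apply: goursat => // x y /andP[x1 x2] /andP[y1 y2].
  exists (- ((x +i* y)%C - z) ^- 2); apply: cderiv_shiftV.
  apply/negP => /eqP xyz; case: znin; rewrite -xyz /=;
    [exact: (norm_between a1 b2 x1 x2)|exact: (norm_between c1 d2 y1 y2)].
pose K w := h w / (w - z).
have bdK a b c d : a <= b -> c <= d ->
   (forall x y, on_frame a b c d x y -> D (x +i* y)%C /\ (x +i* y)%C != z) ->
   [/\ bcont K a b c d, bcont f a b c d &
   bd q a b c d = bd K a b c d - h z * bd (fun w => (w - z)^-1) a b c d].
  move=> ab cd H.
  have kc x y : on_frame a b c d x y -> fcont (fun w => (w - z)^-1) (x +i* y)%C.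
    by move=> /H[_ xz]; apply: cderiv_fcont; exact: cderiv_shiftV.
  have bk := bcont_frame ab cd kc.
  have bK : bcont K a b c d.
    by apply: bcont_frame => // x y xy; apply: fcontM; [apply: hc; case: (H _ _ xy)|exact: kc].
  split => //; first by apply: bcont_frame => // x y /H[/fc].
  rewrite -bd_scale // -bd_sub //.
    by apply: eq_bd => // x y _ _ _; rewrite /q mulrBl.
  by apply: bcont_frame => // x y xy; apply: fcontM; [exact: fcont_cst|exact: kc].
have inH x y : on_frame a' b' c' d' x y -> D (x +i* y)%C /\ (x +i* y)%C != z.
  move=> xy; split; first exact: frD'.
  by rewrite -subr_eq0 -nc_gt0 (lt_trans _ (inner_far _ _ xy)) // divr_gt0.
have [bK' bf' bdq'] := bdK _ _ _ _ (ltW ab') (ltW cd') inH.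
(* On the inner frame |w| <= 4 r and |w - z| >= m / 2; the kernel bound 8 r / m is multiplied by 12
   and by the factor 2 of [bd_frame_le]. *)
have innerK : nc (bd K a' b' c' d') <= 192 * r / m.
  have bnd x y : on_frame a' b' c' d' x y ->
      nc (K (x +i* y)%C) <= 8 * r / m * nc (f (x +i* y)%C) + 0.
    move=> xy; rewrite addr0 /K /h !ncM ncV -mulrA mulrC.
    apply: ler_wpM2r; first exact: nc_ge0.
    have /andP[_] := on_frame_nc r0 fr' xy; rewrite subr0 => n4.
    have far := inner_far _ _ xy.
    have m20 : 0 < m / 2 by rewrite divr_gt0.
    have -> : 8 * r / m = (4 * r) * (m / 2)^-1 by field; rewrite gt_eqF.
    apply: ler_pM; rewrite ?nc_ge0 ?invr_ge0 ?nc_ge0 //; first exact: ltW.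
    by rewrite lef_pV2 ?posrE // ?(ltW far) // (lt_trans m20).
  apply: (le_trans (bd_frame_le (ltW ab') (ltW cd') bf' bK' bnd)).
  have E : 4 * (r * 1 / r + 2 * r / r) = 12 by field; rewrite gt_eqF.
  rewrite E in len'; rewrite mulr0 mul0r addr0.
  have -> : 192 * r / m = 2 * (8 * r / m * 12) by ring.
  by rewrite ler_pM2l // ler_pM2l // divr_gt0 // mulr_gt0.
have outer (k : R) : 0 < k -> nc (f z) * nc z <= 48 * k + 192 * r / m.
  move=> k0.
  pose A (n : nat) : set R[i] := [set w | n%:R < cheb w 0].
  have Aop n : open (A n).
    apply/openC_P => w wn; exists (cheb w 0 - n%:R); first by rewrite subr_gt0.
    move=> u uw; rewrite /A /=; have := cheb_nc u w; rewrite !cheb_real /cheb ge_max => /andP[k1 k2].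
    have {uw} : nc (u - w) < cheb w 0 - n%:R by [].
    rewrite cheb_real ltrBrDl lt_max => /orP h1; rewrite lt_max; apply/orP.
    case: h1 => h1; [left|right].
      have := lerB_dist (complex.Re w) (complex.Re u); rewrite (distrC _ (complex.Re u)); lra.
    have := lerB_dist (complex.Im w) (complex.Im u); rewrite (distrC _ (complex.Im u)); lra.
  have AE w : \forall n \near \oo, ~ A n w.
    exists (Num.truncn (cheb w 0)).+1 => // n /= hn; apply/negP; rewrite -leNgt.
    by apply: ltW; apply: (lt_le_trans (truncnS_gt _)); rewrite ler_nat.
  have k20 : 0 < k ^+ 2 by rewrite exprn_gt0.
  have [N _ /(_ N (leqnn N)) HN] := shrink_integral_small Dop fc G1 Aop AE k20.
  (* Large enough for the frame around z to lie in A N, to enclose the inner frame, and to give |z|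
     <= 2 m <= T, whence |w| <= 2 |w - z| on it. *)
  pose T := N%:R + 2 * m.
  have N0 : 0 <= N%:R :> R by [].
  have T0 : 0 < T by rewrite ltr_wpDl // mulr_gt0.
  have tT : 0 < T / k by rewrite divr_gt0.
  have Tm : 2 * m <= T by rewrite /T; lra.
  have TR : m + 2 * r <= T by rewrite /T; lra.
  have TN : N%:R + m <= T by rewrite /T; lra.
  have farx (u v : R) : `|v| <= m -> T < `|u - v| -> N%:R < `|u| /\ r < `|u|.
    by move=> vm; exact: lt_norm_far vm Tm TN m4 m0.
  have DAop : open (D `&` A N) by exact: openI.
  have fc' w : (D `&` A N) w -> fcont f w by case=> + _; exact: fc.
  have HDA (x y : R) : `|x - complex.Re z| < 2 * T -> `|y - complex.Im z| < 2 * T ->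
     T < `|x - complex.Re z| /\ x \notin S \/ T < `|y - complex.Im z| /\ y \notin S ->
     (D `&` A N) (x +i* y)%C.
    move=> _ _ [[H _]|[H _]]; [have [h1 h2] := farx _ _ Rem H|have [h1 h2] := farx _ _ Imm H].
      by split; [apply: HD; left|rewrite /A /= cheb_real lt_max /= h1].
    by split; [apply: HD; right|rewrite /A /= cheb_real lt_max /= h1 orbT].
  have [a [b [c [d [fr [aS' bS' cS' dS'] frD len]]]]] :=
    exists_good_frame DAop fc' k20 T0 tT HN HDA.
  have [ab cd] := framed_lt T0 fr.
  have outH x y : on_frame a b c d x y -> D (x +i* y)%C /\ (x +i* y)%C != z.
    by move=> xy; split; [case: (frD _ _ xy)|exact: frame_neq T0 fr xy].
  have [bK bf bdq] := bdK _ _ _ _ (ltW ab) (ltW cd) outH.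
  have [q1 q2 q3 q4] : bcont q a b c d.
    apply: bcont_frame; try exact: ltW.
    by move=> x y /outH[Dxy xz]; have [l Hl] := qd _ Dxy xz; exact: cderiv_fcont Hl.
  have offz u v s t : [/\ complex.Re z != u, complex.Re z != v, complex.Im z != s & complex.Im z != t] ->
      offlines [:: z] u v s t.
    by move=> H p; rewrite inE => /eqP ->.
  have neS x : x \notin S -> complex.Re z != x /\ complex.Im z != x.
    by rewrite !inE negb_or eq_sym (eq_sym x) => /andP[].
  have [ra ia] := neS _ aS; have [rb ib] := neS _ bS.
  have [rc ic] := neS _ cS; have [rd id] := neS _ dS.
  have [za zb zc zd] := framed_neq T0 fr.
  have zero u v s t : u < v -> s < t -> offlines [:: z] u v s t ->
     (forall x y, u <= x <= v -> s <= y <= t -> r < `|x| \/ r < `|y|) -> bd q u v s t = 0.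
    move=> uv st off H; apply: (@goursat_except _ [:: z]) => //.
      by move=> x y xuv yst; rewrite inE => xz; apply: qd => //; apply: HD; exact: H.
    by move=> p; rewrite inE => /eqP ->.
  have vq x : complex.Re z != x -> r < `|x| -> vcont q x c d.
    move=> zx rx y _; have [||l Hl] := @qd (x +i* y)%C; last exact: cderiv_fcont Hl.
      by apply: HD; left.
    by apply: contra zx => /eqP <-.
  have ra' : r < `|a'| := lt_norm_neg (lexx _) a2.
  have rb' : r < `|b'| := lt_norm_pos (lexx _) b1.
  have [ord1 ord2 ord3 ord4] := framed_nested Rem Imm TR fr fr'.
  have Z1 : bd q a a' c d = 0.
    apply: zero => //; first exact: offz.
    by move=> x y /andP[X1 X2] _; left; exact: lt_norm_neg X2 a2.
  have Z2 : bd q b' b c d = 0.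
    apply: zero => //; first exact: offz.
    by move=> x y /andP[X1 X2] _; left; exact: lt_norm_pos X1 b1.
  have Z3 : bd q a' b' c c' = 0.
    apply: zero => //; first exact: offz.
    by move=> x y _ /andP[X1 X2]; right; exact: lt_norm_neg X2 c2.
  have Z4 : bd q a' b' d' d = 0.
    apply: zero => //; first exact: offz.
    by move=> x y _ /andP[X1 X2]; right; exact: lt_norm_pos X1 d1.
  have E5 : bd q a b c d = bd q a' b' c' d'.
    rewrite (bd_split5 (ltW ord1) (ltW ab') (ltW ord2) (ltW ord3) (ltW cd') (ltW ord4) q1 q2
      (vq _ ra ra') (vq _ rb rb')).
    by rewrite Z1 Z2 Z3 Z4 !add0r.
  have bnd x y : on_frame a b c d x y ->
      nc (K (x +i* y)%C) <= 2 * nc (f (x +i* y)%C) + 0.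
    move=> xy; rewrite addr0 /K /h !ncM ncV -mulrA mulrC.
    apply: ler_wpM2r; first exact: nc_ge0.
    have /andP[h1 _] := on_frame_nc T0 fr xy.
    rewrite ler_pdivrMr ?(lt_trans T0) //.
    have := ncD ((x +i* y)%C - z) z; rewrite subrK => tri.
    exact: le_double tri zm Tm h1.
  have outK := bd_frame_le (ltW ab) (ltW cd) bf bK bnd.
  have E : 4 * (T / k * k ^+ 2 / T + 2 * T / (T / k)) = 12 * k.
    by field; rewrite !gt_eqF.
  rewrite E in len; rewrite mulr0 mul0r addr0 in outK.
  have key : h z * bd (fun w => (w - z)^-1) a b c d = bd K a b c d - bd K a' b' c' d'.
    have : bd K a b c d - h z * bd (fun w => (w - z)^-1) a b c d = bd K a' b' c' d'.
      by rewrite -bdq E5 bdq' bdin0 mulr0 subr0.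
    by move=> <-; ring.
  rewrite -ncM -/(h z).
  apply: (@le_trans _ _ (nc (h z * bd (fun w => (w - z)^-1) a b c d))).
    by rewrite ncM ler_peMr ?nc_ge0 // (winding_ge1 T0 fr).
  rewrite key (le_trans (ncB _ _)) // lerD //.
  exact: le_trans outK (le_quadruple len).
have fzz : nc (f z) * nc z <= 192 * r / m.
  apply/ler_addgt0Pr => e e0; have e48 : 0 < e / 48 by rewrite divr_gt0.
  have := outer _ e48; lra.
have -> : 192 * r / m ^+ 2 = 192 * r / m / m by field; rewrite gt_eqF.
rewrite ler_pdivlMr //; apply: le_trans fzz.
by rewrite ler_wpM2l ?nc_ge0.
Qed.
End exterior.

(** * Circle means of logarithms *)

Section log_means.
Variable R : realType.
Notation mu := (@lebesgue_measure R).
Implicit Types (w z : R[i]) (t r : R).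

Lemma ri_affine (g : R -> R) (a b k c : R) : 0 < k -> a < b -> ctn g (k * a + c) (k * b + c) ->
  ri (fun t => g (k * t + c)) a b = k^-1 * ri g (k * a + c) (k * b + c).
Proof.
move=> k0 ab gc; pose F t : R := k * t + c.
have dF (t : R) : is_derive t 1 F k.
  have -> : F = (fun t => k *: t + c) by [].
  by apply: is_derive_eq; rewrite /GRing.scale /= mulr1 addr0.
have F' : derive1 F = cst k by apply/funext => t; rewrite derive1E; apply: derive_val.
have Fc (t : R) : {for t, continuous F}.
  by apply: differentiable_continuous; apply/derivable1_diffP; case: (dF t).
have := @integration_by_substitution_increasing R F g a b (ltW ab) _ _ _ _ _ _.
rewrite F' => H.
have E : (\int[mu]_(x in `[F a, F b]) (g x)%:E = \int[mu]_(x in `[a, b]) (g (F x) * k)%:E)%E.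
  rewrite H //.
  - by move=> x y _ _ xy; rewrite /F ltrD2r ltr_pM2l.
  - by move=> x _; exact: cvg_cst.
  - exact: is_cvg_cst.
  - exact: is_cvg_cst.
  - split; first by move=> x _; case: (dF x).
    + by apply: cvg_at_right_filter; exact: Fc.
    + by apply: cvg_at_left_filter; exact: Fc.
  - exact: ctn_within.
rewrite /ri /Rintegral -/(F a) -/(F b) E -[X in X * _]/(k^-1).
have gFc : ctn (fun t => g (F t)) a b.
  move=> t /andP[ta tb]; apply: continuous_comp; first exact: Fc.
  by apply: gc; rewrite /F !lerD2r !ler_pM2l // ta tb.
rewrite -[RHS]/(k^-1 * ri (fun t => g (F t) * k) a b).
have -> : ri (fun t => g (F t) * k) a b = k * ri (fun t => g (F t)) a b.
  by rewrite -riZ //; apply: eq_ri => t _; rewrite mulrC.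
by rewrite mulKf // gt_eqF.
Qed.

Definition cis t : R[i] := (cos t +i* sin t)%C.

Lemma nc_cis t : nc (cis t) = 1.
Proof. by rewrite /nc /= cos2Dsin2 sqrtr1. Qed.

Lemma cisDpi t : cis (t + pi) = - cis t.
Proof. by rewrite /cis cosDpi sinDpi. Qed.

Lemma cis2 t : cis (2 * t) = cis t ^+ 2.
Proof.
rewrite /cis expr2 mulr_natl mulr2n cosD sinD; apply/eqP.
by rewrite eq_complex /= eqxx /= addrC mulrC.
Qed.

Lemma cis_lip t s : nc (cis t - cis s) <= `|cos t - cos s| + `|sin t - sin s|.
Proof. by rewrite (le_trans (nc_le_ReIm _)) // ReB ImB. Qed.

Lemma cis_cont t : forall e : R, 0 < e ->
  exists2 d : R, 0 < d & forall s, `|s - t| < d -> nc (cis s - cis t) < e.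
Proof.
move=> e e0; have e2 : 0 < e / 2 by lra.
have /cvgrPdist_lt /(_ (e / 2) e2) /nbhs_ballP[d1 /= d10 H1] := @continuous_cos R t.
have /cvgrPdist_lt /(_ (e / 2) e2) /nbhs_ballP[d2 /= d20 H2] := @continuous_sin R t.
exists (Num.min d1 d2); first by rewrite lt_min d10 d20.
move=> s; rewrite lt_min => /andP[s1 s2]; rewrite (le_lt_trans (cis_lip _ _)) //.
have := H1 s; have := H2 s; rewrite /ball /= !(distrC _ s) => /(_ s2) h2 /(_ s1) h1.
rewrite distrC in h1; rewrite distrC in h2; lra.
Qed.

Lemma cont_ln_nc (g : R -> R[i]) t :
  (forall e : R, 0 < e -> exists2 d : R, 0 < d & forall s, `|s - t| < d -> nc (g s - g t) < e) ->
  g t != 0 -> {for t, continuous (fun s => ln (nc (g s)))}.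
Proof.
move=> gc gt; have c1 : {for t, continuous (fun s => nc (g s))}.
  apply: continuousR_P => e /gc[d d0 H]; exists d => // s /H.
  by apply: le_lt_trans; exact: nc_lip.
apply: (continuous_comp c1); apply: continuous_ln; by rewrite nc_gt0.
Qed.

Definition lnm w t := ln (nc (1 - w * cis t)).

Lemma cis_den_neq0 w t : nc w < 1 -> 1 - w * cis t != 0.
Proof.
move=> w1; apply/negP => /eqP e; have := ltr01 (R := R).
have : nc (w * cis t) = 1 by rewrite (_ : w * cis t = 1) ?Normc.normc1 //; apply/esym/eqP; rewrite -subr_eq0 e.
by rewrite ncM nc_cis mulr1 => e1; rewrite e1 ltxx in w1.
Qed.

Lemma ctn_lnm w a b : nc w < 1 -> ctn (lnm w) a b.
Proof.
move=> w1 t _; apply: cont_ln_nc; last exact: cis_den_neq0.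
move=> e e0; have [d d0 H] := cis_cont t e0; exists d => // s /H h.
have -> : 1 - w * cis s - (1 - w * cis t) = - (w * (cis s - cis t)) by ring.
by rewrite ncN ncM (le_lt_trans _ h) // ler_piMl ?nc_ge0 // ltW.
Qed.

Definition J w := ri (lnm w) 0 (2 * pi).

(** The half circles combine through (1 - v)(1 + v) = 1 - v^2 with v = w e^(it), and doubling the
    angle turns the half circle into the full one. *)
Lemma J_square w : nc w < 1 -> J (w ^+ 2) = 2 * J w.
Proof.
move=> w1; have pi0 := pi_gt0 R.
have w21 : nc (w ^+ 2) < 1.
  by rewrite expr2 ncM (le_lt_trans _ w1) // ler_piMl ?nc_ge0 // ltW.
have piin : 0 <= (pi : R) <= 2 * pi by apply/andP; split; lra.
have E1 : J w = ri (fun t => lnm w t + lnm (- w) t) 0 pi.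
  rewrite /J (ri_split piin); last exact: ctn_lnm.
  rewrite riD; try by apply: ctn_lnm; rewrite ?ncN.
  congr (_ + _); have := @ri_affine (lnm w) 0 pi 1 pi ltr01 pi0.
  rewrite mulr0 add0r mul1r invr1 mul1r (_ : pi + pi = 2 * pi); last by ring.
  move=> <-; last exact: ctn_lnm.
  apply: eq_ri => t _; rewrite mul1r /lnm cisDpi; congr (ln (nc _)); ring.
have -> : J w = ri (fun t => lnm (w ^+ 2) (2 * t + 0)) 0 pi.
  rewrite E1; apply: eq_ri => t _; rewrite addr0 /lnm cis2 -lnM ?posrE ?nc_gt0 ?cis_den_neq0 ?ncN //.
  rewrite -ncM; congr (ln (nc _)); ring.
rewrite (@ri_affine (lnm (w ^+ 2)) 0 pi 2 0) //; last exact: ctn_lnm.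
by rewrite mulr0 !addr0 mulrA mulfV ?mul1r // pnatr_eq0.
Qed.

Lemma J_bound w (r : R) : nc w <= r -> r < 1 -> `|J w| <= - ln (1 - r) * (2 * pi).
Proof.
move=> wr r1; have pi0 := pi_gt0 R; have w0 := nc_ge0 w.
have := @ri_bound _ (lnm w) 0 (2 * pi) (- ln (1 - r)); rewrite subr0; apply.
- lra.
- by apply: ctn_lnm; lra.
move=> t _; rewrite /lnm.
have n1 : 1 - r <= nc (1 - w * cis t).
  have := nc_lip 1 (w * cis t); rewrite Normc.normc1 ncM nc_cis mulr1 ler_norml; lra.
have n2 : nc (1 - w * cis t) <= 1 + r.
  have := ncB 1 (w * cis t); rewrite Normc.normc1 ncM nc_cis mulr1; lra.
rewrite ler_norml opprK; apply/andP; split.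
  by rewrite ler_ln ?posrE //; lra.
rewrite -lnV ?posrE; last lra.
rewrite ler_ln ?posrE ?invr_gt0; [|lra|lra].
apply: (le_trans n2).
rewrite -[_^-1]div1r ler_pdivlMr; last lra.
have : 0 <= r ^+ 2 by rewrite sqr_ge0.
rewrite expr2; lra.
Qed.

(** The mean value property without harmonic functions: 2^n J(w) = J(w^(2^n)) stays bounded in n. *)
Lemma J_eq0 w : nc w < 1 -> J w = 0.
Proof.
move=> w1; have pi0 := pi_gt0 R.
have H n : exists2 v, nc v <= nc w & J v = 2 ^+ n * J w.
  elim: n => [|n [v vw IH]]; first by exists w; rewrite ?mul1r.
  have v1 := le_lt_trans vw w1.
  exists (v ^+ 2); last by rewrite J_square // IH exprS mulrA.
  by rewrite expr2 ncM (le_trans _ vw) // ler_piMl ?nc_ge0 // ltW.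
apply/eqP; rewrite -normr_le0; apply/ler_addgt0Pr => e e0; rewrite add0r.
set C := - ln (1 - nc w) * (2 * pi).
have [n hn] : exists n : nat, C / e < n%:R.
  by exists (Num.truncn (C / e)).+1; exact: truncnS_gt.
have [v vw Jv] := H n; have := J_bound vw w1; rewrite -/C Jv normrM ger0_norm ?exprn_ge0 // => h.
have n2 : n%:R < 2 ^+ n :> R by rewrite -natrX ltr_nat ltn_expl.
have p2 : 0 < 2 ^+ n :> R by rewrite exprn_gt0.
rewrite -(ler_pM2l p2); apply: (le_trans h).
by rewrite -ler_pdivrMr // ltW // (lt_trans hn).
Qed.
End log_means.

(** * Jensen's inequality for the logarithm of the distance to a point *)

Section log_circle_mean.
Variable R : realType.
Notation mu := (@lebesgue_measure R).
Implicit Types (w z : R[i]) (t r : R).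

Lemma lne_nc_neq0 z : z != 0 -> lne (nc z)%:E = (ln (nc z))%:E.
Proof. by move=> z0; rewrite lne_EFin // nc_gt0. Qed.

Let I2 := `[0%R, (2 * pi)%R]%classic : set R.

Let mI2 : measurable (I2 : set (measurableTypeR R)).
Proof. exact: measurable_itv. Qed.

Lemma mu_I2 : mu I2 = (2 * pi)%:E.
Proof.
have pi0 := pi_gt0 R.
by rewrite /I2 lebesgue_measure_itv /= lte_fin mulr_gt0 // -EFinB subr0.
Qed.

Lemma integral_ctn (g : R -> R) : ctn g 0 (2 * pi) ->
  mu.-integrable I2 (EFin \o g) /\
  (\int[mu]_(t in I2) (g t)%:E = (ri g 0 (2 * pi))%:E)%E.
Proof.
move=> gc; have gi := ctn_integrable gc; split => //.
by rewrite /ri /Rintegral fineK //; apply: integrable_fin_num.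
Qed.

Lemma integrable_lnm w : nc w < 1 ->
  mu.-integrable I2 (fun t => (lnm w t)%:E) /\ (\int[mu]_(t in I2) (lnm w t)%:E = 0)%E.
Proof.
move=> w1; have [h1 h2] := integral_ctn (@ctn_lnm _ w 0 (2 * pi) w1); split => //.
by rewrite h2 -/(J w) J_eq0.
Qed.

(* On the unit circle: Fatou applied to a w with a = 1 - e^-(n+1), which tends to 1. *)
Lemma integrable_lnm_unit w : nc w = 1 ->
  mu.-integrable I2 (fun t => lne (nc (1 - w * cis t))%:E) /\
  (0 <= \int[mu]_(t in I2) lne (nc (1 - w * cis t))%:E)%E.
Proof.
move=> w1; have pi0 := pi_gt0 R.
pose a n : R := 1 - expR (- n.+1%:R).
have aE n : 1 - a n = expR (- n.+1%:R) by rewrite /a; ring.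
have a01 n : 0 < a n < 1.
  rewrite /a subr_gt0 expR_lt1 ltrBlDr ltrDl expR_gt0 andbT oppr_lt0 ltr0n //.
have naw n : nc ((a n)%:C%C * w) < 1.
  have /andP[h1 h2] := a01 n.
  by rewrite ncM nc_real w1 mulr1 ger0_norm // ltW.
(* Subtracting from ln 2 makes the functions nonnegative, since |1 - a w e^(it)| <= 2; all of them
   have integral 2 pi ln 2. *)
pose f n t : \bar R := (ln 2 - lnm ((a n)%:C%C * w) t)%:E.
have ub n t : lnm ((a n)%:C%C * w) t <= ln 2.
  rewrite /lnm ler_ln ?posrE ?nc_gt0 ?cis_den_neq0 //.
  have := ncB 1 ((a n)%:C%C * w * cis t); rewrite Normc.normc1 ncM nc_cis mulr1.
  by have := naw n; lra.
have fc n : ctn (fun t => ln 2 - lnm ((a n)%:C%C * w) t) 0 (2 * pi).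
  by apply: ctnB; [exact: ctn_cst|exact: ctn_lnm].
have mf n : measurable_fun I2 (f n) by have [/measurable_int] := integral_ctn (fc n).
have f0 n t : I2 t -> (0 <= f n t)%E by move=> _; rewrite lee_fin subr_ge0.
have intf n : (\int[mu]_(t in I2) f n t = (ln 2 * (2 * pi))%:E)%E.
  have [_ ->] := integral_ctn (fc n); rewrite riB; [|exact: ctn_cst|exact: ctn_lnm].
  by rewrite -/(J _) J_eq0 // ri_cst ?subr0 ?mulr_ge0 // ltW.
pose F t : \bar R := ((ln 2)%:E - lne (nc (1 - w * cis t))%:E)%E.
have FD t : F t = ((ln 2)%:E - lne (nc (1 - w * cis t))%:E)%E by [].
have a_cvg (e : R) : 0 < e -> \forall n \near \oo, expR (- n.+1%:R) < e.
  move=> e0; have /cvgrPdist_lt /(_ e e0) [N _ HN] := @cvgn_expR R.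
  exists N => // n /= Nn; have := HN n.+1 (leqW Nn).
  by rewrite /= sub0r normrN ger0_norm // expR_ge0.
have fF t : f n t @[n --> \oo] --> F t.
  (* At the zero of 1 - w e^(it) the approximating values are ln 2 + n + 1, which tend to +oo as the
     convention [lne 0 = -oo] demands. *)
  have [x1|x1] := eqVneq (w * cis t) 1.
    have -> : F t = +oo%E.
      by rewrite FD x1 subrr Normc.normc0 le0_lneNy ?lee_fin.
    apply/cvgeyPge => A; near=> n.
    rewrite /f /lnm -mulrA x1 mulr1.
    have -> : 1 - (a n)%:C%C = (1 - a n)%:C%C by apply/eqP; rewrite eq_complex /= subr0 !eqxx.
    rewrite nc_real aE ger0_norm ?expR_ge0 // expRK opprK lee_fin.
    have : A < n%:R by near: n; exists (Num.truncn A).+1 => // n /= hn;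
      apply: (lt_le_trans (truncnS_gt _)); rewrite ler_nat.
    have : 0 <= ln 2 :> R by rewrite ln_ge0 // ler1n.
    by rewrite -[n.+1]addn1 natrD => *; lra.
  have x0 : 1 - w * cis t != 0 by rewrite subr_eq0 eq_sym.
  have -> : F t = (ln 2 - ln (nc (1 - w * cis t)))%:E by rewrite FD lne_nc_neq0.
  apply: cvg_EFin; first by apply: nearW.
  apply: cvgB; first exact: cvg_cst.
  have := continuous_ln (R := R) (x := nc (1 - w * cis t)); rewrite nc_gt0 => /(_ x0) lc.
  apply: (continuous_cvg _ lc).
  apply/cvgrPdist_lt => e e0; near=> n.
  rewrite (le_lt_trans (nc_lip _ _)) //.
  have -> : 1 - w * cis t - (1 - (a n)%:C%C * w * cis t) = - ((1 - (a n)%:C%C) * (w * cis t)) by ring.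
  have -> : 1 - (a n)%:C%C = (1 - a n)%:C%C by apply/eqP; rewrite eq_complex /= subr0 !eqxx.
  rewrite ncN !ncM nc_cis w1 mulr1 mulr1 nc_real aE ger0_norm ?expR_ge0 //.
  by near: n; exact: a_cvg.
have mF : measurable_fun I2 F.
  by apply: (emeasurable_fun_cvg f) => // t _; exact: fF.
have F0 t : (0 <= F t)%E.
  have n2 : nc (1 - w * cis t) <= 2.
    by have := ncB 1 (w * cis t); rewrite Normc.normc1 ncM nc_cis w1 mulr1.
  rewrite FD; have [->|x1] := eqVneq (1 - w * cis t) 0.
    by rewrite Normc.normc0 le0_lneNy // [X in (_ <= X)%E](_ : _ = +oo%E) ?leey.
  by rewrite lne_nc_neq0 // -EFinB lee_fin subr_ge0 ler_ln ?posrE ?nc_gt0.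
have intF : (\int[mu]_(t in I2) F t <= (ln 2 * (2 * pi))%:E)%E.
  have := fatou mu (measurable_itv _) mf f0.
  have -> : (fun n => \int[mu]_(t in I2) f n t)%E = cst (ln 2 * (2 * pi))%:E.
    by apply/funext => n; exact: intf.
  rewrite [X in (_ <= X)%E]is_cvg_limn_einfE; last exact: is_cvg_cst.
  rewrite lim_cst //; apply: le_trans.
  rewrite le_eqVlt; apply/orP; left; apply/eqP; apply: eq_integral => t _.
  rewrite is_cvg_limn_einfE; first by apply/esym/cvg_lim => //; exact: fF.
  by apply/cvg_ex; exists (F t); exact: fF.
have iF : mu.-integrable I2 F.
  apply/integrableP; split => //; under eq_integral do rewrite gee0_abs //.
  by rewrite (le_lt_trans intF) // ltry.
have ic : mu.-integrable I2 (cst (ln 2)%:E).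
  by have [] := integral_ctn (@ctn_cst _ (ln 2) 0 (2 * pi)).
have FE : (fun t => lne (nc (1 - w * cis t))%:E) = (fun t => (ln 2)%:E - F t)%E.
  apply/funext => t; rewrite FD; have [->|x1] := eqVneq (1 - w * cis t) 0.
    by rewrite Normc.normc0 le0_lneNy ?lee_fin.
  by rewrite lne_nc_neq0 // -!EFinB; congr (_%:E); ring.
rewrite FE; split; first exact: (integrableB mI2 ic iF).
have -> : (\int[mu]_(t in I2) ((ln 2)%:E - F t) = \int[mu]_(t in I2) cst (ln 2)%:E t - \int[mu]_(t in I2) F t)%E.
  exact: (integralB mI2 ic iF).
have -> : (\int[mu]_(t in I2) cst (ln 2)%:E t = (ln 2)%:E * mu I2)%E by exact: integral_cst.
rewrite mu_I2.
rewrite -EFinM; move: intF; case: (\int[mu]_(t in I2) F t)%E => [s| |] //=.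
  by rewrite -EFinB !lee_fin subr_ge0.
by move=> _; rewrite addey // leey.
Unshelve. all: by end_near. Qed.

Lemma nc_conj z : nc (conjc z) = nc z.
Proof. by case: z => x y; rewrite /nc /= sqrrN. Qed.

Lemma circle_ptE w r t : circle_pt w r t = w + r%:C%C * cis t.
Proof. by congr (_ + _); rewrite /cis; apply/eqP; rewrite eq_complex /= !mul0r subr0 addr0 !eqxx. Qed.

Lemma nc_circle_out w z r t : w != z ->
  nc (circle_pt w r t - z) = nc (w - z) * nc (1 - (- (r%:C%C / (w - z))) * cis t).
Proof.
move=> wz; have d0 : w - z != 0 by rewrite subr_eq0.
rewrite -ncM circle_ptE; congr nc; field; exact: d0.
Qed.

Lemma conj_onemM (u v : R[i]) : conjc (1 - u * conjc v) = 1 - conjc u * v.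
Proof.
case: u v => [a b] [c d]; apply/eqP; rewrite eq_complex /=.
by apply/andP; split; apply/eqP; ring.
Qed.

(** Factoring out r e^(it) leaves e^(-it); conjugation, which preserves the modulus, brings the
    remaining factor to the form treated by [lnm]. *)
Lemma nc_circle_in w z r t : 0 < r ->
  nc (circle_pt w r t - z) = r * nc (1 - conjc ((z - w) / r%:C%C) * cis t).
Proof.
move=> r0; have rc0 : r%:C%C != 0 by rewrite -nc_gt0 nc_real normr_gt0 gt_eqF.
have cc : conjc (cis t) * cis t = 1.
  apply/eqP; rewrite eq_complex /=; apply/andP; split; apply/eqP; last by ring.
  by rewrite mulNr opprK -!expr2 cos2Dsin2.
have -> : 1 - conjc ((z - w) / r%:C%C) * cis t = conjc (1 - (z - w) / r%:C%C * conjc (cis t)).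
  by rewrite conj_onemM.
have E : w + r%:C%C * cis t - z = r%:C%C * (cis t * (1 - (z - w) / r%:C%C * conjc (cis t))).
  have -> : r%:C%C * (cis t * (1 - (z - w) / r%:C%C * conjc (cis t))) =
     r%:C%C * cis t - (z - w) * (conjc (cis t) * cis t) by field; exact: rc0.
  by rewrite cc; ring.
by rewrite nc_conj circle_ptE E ncM ncM nc_real nc_cis mul1r ger0_norm // ltW.
Qed.

Lemma log_circle_mean_out w z r : 0 < r -> r < nc (w - z) ->
  ctn (fun t => ln (nc (circle_pt w r t - z))) 0 (2 * pi) /\
  ri (fun t => ln (nc (circle_pt w r t - z))) 0 (2 * pi) = 2 * pi * ln (nc (w - z)).
Proof.
move=> r0 rz; have pi0 := pi_gt0 R.
have n0 : 0 < nc (w - z) by lra.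
have wz : w != z by rewrite -subr_eq0 -nc_gt0.
set v := - (r%:C%C / (w - z)).
have v1 : nc v < 1.
  by rewrite ncN ncM ncV nc_real ger0_norm ?ltW // ltr_pdivrMr // mul1r.
have E t : ln (nc (circle_pt w r t - z)) = ln (nc (w - z)) + lnm v t.
  by rewrite nc_circle_out // lnM ?posrE // nc_gt0 cis_den_neq0.
have -> : (fun t => ln (nc (circle_pt w r t - z))) = (fun t => ln (nc (w - z)) + lnm v t).
  exact/funext.
split; first by apply: ctnD; [exact: ctn_cst|exact: ctn_lnm].
rewrite riD; [|exact: ctn_cst|exact: ctn_lnm].
by rewrite -/(J v) J_eq0 // addr0 ri_cst ?subr0 ?mulr_ge0 ?ltW // mulrC.
Qed.

(** The mean is the maximum of ln r and ln |w - z|. For z outside the circle this is an equality;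
    for z inside or on it, the factor r is extracted and the rest has nonnegative integral. *)
Lemma lne_circle_mean w z r : 0 < r -> w != z ->
  mu.-integrable I2 (fun t => lne (nc (circle_pt w r t - z))%:E) /\
  ((2 * pi * ln (nc (w - z)))%:E <= \int[mu]_(t in I2) lne (nc (circle_pt w r t - z))%:E)%E.
Proof.
move=> r0 wz; have pi0 := pi_gt0 R.
have n0 : 0 < nc (w - z) by rewrite nc_gt0 subr_eq0.
have [rz|zr] := ltP r (nc (w - z)).
  have [h1 h2] := log_circle_mean_out r0 rz.
  have E : (fun t => lne (nc (circle_pt w r t - z))%:E) = EFin \o (fun t => ln (nc (circle_pt w r t - z))).
    apply/funext => t; rewrite -[RHS]/((ln (nc (circle_pt w r t - z)))%:E) lne_EFin // nc_circle_out // mulr_gt0 // nc_gt0.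
    apply: cis_den_neq0.
    by rewrite ncN ncM ncV nc_real ger0_norm ?ltW // ltr_pdivrMr // mul1r.
  by rewrite E; have [h3 ->] := integral_ctn h1; rewrite h2.
set v := conjc ((z - w) / r%:C%C).
have vE : nc v = nc (w - z) / r.
  by rewrite nc_conj ncM ncV nc_real ger0_norm ?ltW // ncC.
have v1 : nc v <= 1 by rewrite vE ler_pdivrMr // mul1r.
have E : (fun t => lne (nc (circle_pt w r t - z))%:E) = (fun t => (ln r)%:E + lne (nc (1 - v * cis t))%:E)%E.
  apply/funext => t; rewrite nc_circle_in // EFinM -/v.
  have [->|d0] := eqVneq (1 - v * cis t) 0.
    by rewrite Normc.normc0 mule0 le0_lneNy // addeNy.
  by rewrite -EFinM !lne_EFin ?mulr_gt0 ?nc_gt0 // lnM ?posrE // nc_gt0.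
have ic : mu.-integrable I2 (cst (ln r)%:E).
  by have [] := integral_ctn (@ctn_cst _ (ln r) 0 (2 * pi)).
have [iv pv] : mu.-integrable I2 (fun t => lne (nc (1 - v * cis t))%:E) /\
  (0 <= \int[mu]_(t in I2) lne (nc (1 - v * cis t))%:E)%E.
  have [e1|n1] := eqVneq (nc v) 1; first exact: integrable_lnm_unit.
  have v1' : nc v < 1 by rewrite lt_neqAle n1.
  have [h1 h2] := integrable_lnm v1'.
  have -> : (fun t => lne (nc (1 - v * cis t))%:E) = (fun t => (lnm v t)%:E).
    by apply/funext => t; rewrite lne_nc_neq0 // cis_den_neq0.
  by rewrite h2.
rewrite E; split; first exact: (integrableD mI2 ic iv).
have -> : (\int[mu]_(t in I2) ((ln r)%:E + lne (nc (1 - v * cis t))%:E) = \int[mu]_(t in I2) cst (ln r)%:E t + \int[mu]_(t in I2) lne (nc (1 - v * cis t))%:E)%E.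
  exact: (integralD mI2 ic iv).
have -> : (\int[mu]_(t in I2) cst (ln r)%:E t = (2 * pi * ln r)%:E)%E.
  have -> : (\int[mu]_(t in I2) cst (ln r)%:E t = (ln r)%:E * mu I2)%E by exact: integral_cst.
  by rewrite mu_I2 -EFinM mulrC.
apply: (@le_trans _ _ (2 * pi * ln r)%:E).
  by rewrite lee_fin ler_pM2l ?mulr_gt0 // ler_ln ?posrE.
by rewrite leeDl.
Qed.
End log_circle_mean.

(** * Upper limits of logarithmic potentials *)

Section upper_limit.
Variables (R : realType) (U : choiceType) (T : filteredType U).

Lemma limf_esup_le (u : T -> \bar R) (F : set_system T) (a : \bar R) :
  F [set x | (u x <= a)%E] -> (limf_esup u F <= a)%E.
Proof.
move=> H; apply: ge_ereal_inf; exists (ereal_sup (u @` [set x | (u x <= a)%E])).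
  by exists [set x | (u x <= a)%E].
by apply: ge_ereal_sup => _ [x /= xa <-].
Qed.

Lemma limf_esup_ge (u : T -> \bar R) (F : set_system T) (a : \bar R) : ProperFilter F ->
  F [set x | (a <= u x)%E] -> (a <= limf_esup u F)%E.
Proof.
move=> PF H; apply: le_ereal_inf_tmp => _ [V FV <-].
have [x [/= ax Vx]] := filter_ex (filterI H FV).
by apply: (le_trans ax); apply: ereal_sup_ubound; exists x.
Qed.
End upper_limit.

Lemma limn_esup_le (R : realType) (u : nat -> \bar R) (a : \bar R) :
  (\forall n \near \oo, (u n <= a)%E) -> (limn_esup u <= a)%E.
Proof. exact: limf_esup_le. Qed.

Lemma limn_esup_ge (R : realType) (u : nat -> \bar R) (a : \bar R) :
  (\forall n \near \oo, (a <= u n)%E) -> (a <= limn_esup u)%E.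
Proof. exact: limf_esup_ge. Qed.

Section psi.
Variable R : realType.
Notation mu := (@lebesgue_measure R).
Variables (D : set R[i]) (e : nat -> nat -> R[i]) (p : R[i]) (tau : R).
Hypothesis Dop : open D.
Hypothesis eD : forall n j, ~ D (e n j).
Hypothesis tau0 : 0 < tau.
Hypothesis ep : forall n j, nc (e n j - p) <= tau.
Implicit Types (w x z : R[i]) (n : nat).

Definition avg (h : nat -> R) n : R := n.+1%:R^-1 * \sum_(j < n.+1) h j.

Lemma avg_le (h : nat -> R) n (b : R) : (forall j, h j <= b) -> avg h n <= b.
Proof.
move=> hb; rewrite /avg ler_pdivrMl ?ltr0n //.
apply: (@le_trans _ _ (\sum_(j < n.+1) b)); first exact: ler_sum.
by rewrite sumr_const card_ord mulr_natl.
Qed.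
Lemma avg_ge (h : nat -> R) n (a : R) : (forall j, a <= h j) -> a <= avg h n.
Proof.
move=> ha; rewrite /avg ler_pdivlMl ?ltr0n //.
apply: (@le_trans _ _ (\sum_(j < n.+1) a)); last exact: ler_sum.
by rewrite sumr_const card_ord mulr_natl.
Qed.
Lemma le_avg (h k : nat -> R) n (c : R) : (forall j, h j <= k j + c) -> avg h n <= avg k n + c.
Proof.
move=> hk; rewrite -lerBlDl; have -> : avg h n - avg k n = avg (fun j => h j - k j) n.
  by rewrite /avg sumrB mulrBr.
by apply: avg_le => j; rewrite lerBlDl.
Qed.

Definition Phi n x : R := avg (fun j => - ln (nc (x - e n j))) n.
(** On [D] the upper limit is finite by [Phi_bounds], so [fine] loses nothing there and real
    arithmetic becomes available. *)
Definition psi x : R := fine (limn_esup (fun n => (Phi n x)%:E)).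

Lemma dist_e x (eta : R) n j : (forall z, nc (z - x) < eta -> D z) -> eta <= nc (x - e n j).
Proof. by move=> H; rewrite leNgt; apply/negP => h; apply: (@eD n j); apply: H; rewrite ncC. Qed.

Lemma Phi_bounds x (eta : R) n : 0 < eta -> (forall z, nc (z - x) < eta -> D z) ->
  - ln (nc (x - p) + tau) <= Phi n x <= - ln eta.
Proof.
move=> eta0 H; apply/andP; split; [apply: avg_ge => j|apply: avg_le => j];
  have h := dist_e n j H; rewrite lerN2 ler_ln ?posrE //; try lra.
  have := nc_dist_triangle p x (e n j); rewrite (ncC p); have := ep n j; lra.
by rewrite ltr_wpDl ?nc_ge0.
Qed.

Lemma limn_esup_fin (u : nat -> R) (a b : R) : (forall n, a <= u n <= b) ->
  limn_esup (fun n => (u n)%:E) = (fine (limn_esup (fun n => (u n)%:E)))%:E /\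
  a <= fine (limn_esup (fun n => (u n)%:E)) <= b.
Proof.
move=> H.
have h1 : (a%:E <= limn_esup (fun n => (u n)%:E))%E.
  by apply: limn_esup_ge; apply: nearW => n; rewrite lee_fin; case/andP: (H n).
have h2 : (limn_esup (fun n => (u n)%:E) <= b%:E)%E.
  by apply: limn_esup_le; apply: nearW => n; rewrite lee_fin; case/andP: (H n).
move: h1 h2; case: (limn_esup _) => [l| |] //=; rewrite ?lee_fin => h1 h2.
by rewrite h1 h2.
Qed.

Lemma psiE x : D x -> limn_esup (fun n => (Phi n x)%:E) = (psi x)%:E.
Proof.
move=> Dx; have [eta eta0 H] := (openC_P D).1 Dop x Dx.
by have [] := limn_esup_fin (fun n => Phi_bounds n eta0 H).
Qed.

Lemma psi_bounds x (eta : R) : 0 < eta -> (forall z, nc (z - x) < eta -> D z) ->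
  - ln (nc (x - p) + tau) <= psi x <= - ln eta.
Proof. by move=> eta0 H; have [] := limn_esup_fin (fun n => Phi_bounds n eta0 H). Qed.

Lemma psi_le x (b : R) : D x -> (\forall n \near \oo, Phi n x <= b) -> psi x <= b.
Proof.
move=> Dx H; rewrite -lee_fin -psiE //; apply: limn_esup_le.
by apply: filterS H => n; rewrite lee_fin.
Qed.

(** A Harnack-type inequality: every pole is at distance at least eta from x, so a move by k eta
    shrinks each distance at most by the factor 1 - k. The bound is uniform in n and therefore
    survives the upper limit; it yields upper semicontinuity. *)
Lemma psi_local x y (eta k : R) : 0 < eta -> (forall z, nc (z - x) < eta -> D z) ->
  0 < k < 1 -> nc (y - x) <= k * eta -> D y -> psi y <= psi x - ln (1 - k).
Proof.
move=> eta0 H /andP[k0 k1] yx Dy.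
have Dx : D x by apply: H; rewrite subrr Normc.normc0.
have PhiE n : Phi n y <= Phi n x + - ln (1 - k).
  apply: le_avg => j; have h := dist_e n j H.
  have n0 : 0 < nc (x - e n j) by lra.
  rewrite -opprD lerN2 -lnM ?posrE //; last by lra.
  have h2 : nc (x - e n j) * (1 - k) <= nc (y - e n j).
    have := nc_dist_triangle y x (e n j); rewrite (ncC x y).
    have : k * eta <= k * nc (x - e n j) by rewrite ler_pM2l.
    rewrite mulrBr mulr1 (mulrC (nc (x - e n j))); lra.
  have h3 : 0 < nc (x - e n j) * (1 - k) by rewrite mulr_gt0 // subr_gt0.
  by rewrite ler_ln ?posrE // (lt_le_trans h3).
rewrite -lerBDr opprK -lee_fin -psiE //.
(* The upper limit is an infimum of suprema over members V of the filter; the comparison is made on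
   each V. *)
apply: le_ereal_inf_tmp => _ [V FV <-].
have h1 : ((psi y)%:E <= ereal_sup ((fun n => (Phi n y)%:E) @` V))%E.
  by rewrite -psiE //; apply: ereal_inf_lbound; exists V.
have [v Vv] := filter_ex (FV : \oo V).
have h2 : ((Phi v x)%:E <= ereal_sup ((fun n => (Phi n x)%:E) @` V))%E.
  by apply: ereal_sup_ubound; exists v.
case E : (ereal_sup ((fun n => (Phi n x)%:E) @` V)) h2 => [s| |] // _; last by rewrite leey.
rewrite lee_fin -lerBrDr -lee_fin; apply: (le_trans h1).
apply: ge_ereal_sup => _ [n Vn <-]; rewrite lee_fin (le_trans (PhiE n)) // lerD2r.
by rewrite -lee_fin -E; apply: ereal_sup_ubound; exists n.
Qed.

(** Compactness of the parameter interval gives one eta for the whole circle, and thus a bound for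
    all [Phi n] on it. *)
Lemma disc_margin w (r : R) : 0 < r -> [set x | nc (x - w) <= r] `<=` D ->
  exists2 eta : R, 0 < eta & forall t, 0 <= t <= 2 * pi ->
    forall z, nc (z - circle_pt w r t) < eta -> D z.
Proof.
move=> r0 HD.
have circD t : D (circle_pt w r t).
  by apply: HD; rewrite /= circle_ptE addrC addKr ncM nc_real nc_cis mulr1 ger0_norm // ltW.
pose P (eta t : R) := forall z, nc (z - circle_pt w r t) < eta -> D z.
have /compact_near_coveringP := @segment_compact R 0 (2 * pi).
move=> /(_ _ (0^'+)%R P _) H.
have : \forall eta \near (0 : R)^'+, `[0, 2 * pi]%classic `<=` P eta.
  apply: H => t _; have [d d0 Hd] := (openC_P D).1 Dop _ (circD t).
  have dr : 0 < d / (2 * r) by rewrite divr_gt0 // mulr_gt0.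
  have [s s0 Hs] := cis_cont t dr.
  have d2 : 0 < d / 2 by rewrite divr_gt0.
  exists (ball t s, [set eta | 0 < eta < d / 2]) => /=.
    split; first exact: nbhsx_ballx.
    near=> eta => /=; apply/andP; split; near: eta; [exact: nbhs_right_gt|exact: nbhs_right_lt].
  move=> [t' eta] [/= tt /andP[eta0 etad]] z zt; apply: Hd.
  rewrite (le_lt_trans (nc_dist_triangle (circle_pt w r t') _ _)) //.
  have : nc (circle_pt w r t' - circle_pt w r t) < d / 2.
    rewrite !circle_ptE (_ : _ - _ = r%:C%C * (cis t' - cis t)); last by ring.
    rewrite ncM nc_real (ger0_norm (ltW r0)).
    have -> : d / 2 = r * (d / (2 * r)) by field; rewrite gt_eqF.
    by rewrite ltr_pM2l //; apply: Hs; move: tt; rewrite /ball /= distrC.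
  lra.
move=> H'; have eta_gt0 : \forall eta \near (0 : R)^'+, 0 < eta by exact: nbhs_right_gt.
have [eta [h eta0]] := @filter_ex _ _ (at_right_proper_filter 0) _ (filterI H' eta_gt0).
by exists eta => // t tP; apply: h; rewrite /= in_itv.
Unshelve. all: by end_near. Qed.

Lemma ctn_sum (h : nat -> R -> R) m a b : (forall j, ctn (h j) a b) ->
  ctn (fun t => \sum_(j < m) h j t) a b /\
  ri (fun t => \sum_(j < m) h j t) a b = \sum_(j < m) ri (h j) a b.
Proof.
move=> hc; elim: m => [|m [IH1 IH2]].
  have -> : (fun t => \sum_(j < 0) h j t) = (fun=> 0) by apply/funext => t; rewrite big_ord0.
  split; first exact: ctn_cst.
  by rewrite big_ord0 -[LHS]/(fine _) integral0_eq.
have -> : (fun t => \sum_(j < m.+1) h j t) = (fun t => \sum_(j < m) h j t + h m t).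
  by apply/funext => t; rewrite big_ord_recr.
by split; [exact: ctnD|rewrite riD // IH2 big_ord_recr].
Qed.

(** The poles lie outside the closed disc, where the logarithm has the exact mean value property. *)
Lemma Phi_mean w (r : R) n : 0 < r -> [set x | nc (x - w) <= r] `<=` D ->
  ctn (fun t => Phi n (circle_pt w r t)) 0 (2 * pi) /\
  ri (fun t => Phi n (circle_pt w r t)) 0 (2 * pi) = 2 * pi * Phi n w.
Proof.
move=> r0 HD.
have far j : r < nc (w - e n j).
  by rewrite ltNge; apply/negP => h; apply: (@eD n j); apply: HD; rewrite /= ncC.
pose h j t := - ln (nc (circle_pt w r t - e n j)).
have hE j : h j = fun t => -1 * ln (nc (circle_pt w r t - e n j)).
  by apply/funext => t; rewrite mulN1r.
have hc j : ctn (h j) 0 (2 * pi) /\ ri (h j) 0 (2 * pi) = 2 * pi * - ln (nc (w - e n j)).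
  have [h1 h2] := log_circle_mean_out r0 (far j).
  rewrite hE; split; first by apply: ctnM => //; exact: ctn_cst.
  by rewrite riZ // h2 mulN1r mulrN.
have [s1 s2] := ctn_sum n.+1 (fun j => (hc j).1).
split; first by apply: ctnM => //; exact: ctn_cst.
rewrite /Phi /avg riZ // s2 mulrCA; congr (_ * _).
by rewrite mulr_sumr; apply: eq_bigr => j _; case: (hc j).
Qed.

Let I2 := `[0%R, (2 * pi)%R]%classic : set R.

(** Reverse Fatou: Fatou's lemma applied to B - [Phi n], which is nonnegative on the circle for B =
    - ln eta, combined with the exact means of [Phi n]. *)
Lemma psi_mean w (r : R) : 0 < r -> [set x | nc (x - w) <= r] `<=` D ->
  mu.-integrable I2 (fun t => (psi (circle_pt w r t))%:E) /\
  ((2 * pi * psi w)%:E <= \int[mu]_(t in I2) (psi (circle_pt w r t))%:E)%E.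
Proof.
move=> r0 HD; have pi0 := pi_gt0 R.
have [eta eta0 Heta] := disc_margin r0 HD.
have mI2 : measurable (I2 : set (measurableTypeR R)) by exact: measurable_itv.
pose B := - ln eta.
pose f n t : \bar R := (B + - Phi n (circle_pt w r t))%:E.
have I2P t : I2 t -> 0 <= t <= 2 * pi by rewrite /I2 /= in_itv.
have Pc n := Phi_mean n r0 HD.
have fc n : ctn (fun t => B + - Phi n (circle_pt w r t)) 0 (2 * pi).
  by apply: ctnB; [exact: ctn_cst|case: (Pc n)].
have mf n : measurable_fun I2 (f n) by have [/measurable_int] := integral_ctn (fc n).
have f0 n t : I2 t -> (0 <= f n t)%E.
  move=> /I2P tP; rewrite lee_fin subr_ge0.
  by have /andP[] := Phi_bounds n eta0 (Heta t tP).
have intf n : (\int[mu]_(t in I2) f n t = (2 * pi * B)%:E + (2 * pi)%:E * - (Phi n w)%:E)%E.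
  have [_ ->] := integral_ctn (fc n); rewrite riB; [|exact: ctn_cst|by case: (Pc n)].
  case: (Pc n) => _ ->; rewrite ri_cst ?subr0 ?mulr_ge0 // ?ltW //.
  by rewrite -EFinN -EFinM -EFinD; congr (_%:E); ring.
have Dw : D w by apply: HD; rewrite /= subrr Normc.normc0 ltW.
have Dc t : I2 t -> D (circle_pt w r t).
  by move=> /I2P /Heta; apply; rewrite subrr Normc.normc0.
pose F t : \bar R := (B - psi (circle_pt w r t))%:E.
have FE t : I2 t -> limn_einf (f^~ t) = F t.
  move=> It; have -> : f^~ t = (fun n => B%:E + (-%E \o (fun n => (Phi n (circle_pt w r t))%:E)) n)%E.
    by apply/funext => n.
  by rewrite limn_einf_shift // limn_einfN psiE; [by []|exact: Dc].
have intF : (\int[mu]_(t in I2) F t <= (2 * pi * (B - psi w))%:E)%E.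
  have := fatou mu mI2 mf f0.
  have -> : (fun n => \int[mu]_(t in I2) f n t)%E =
     (fun n => (2 * pi * B)%:E + (-%E \o (fun n => (2 * pi * Phi n w)%:E)) n)%E.
    by apply/funext => n; rewrite intf /=; congr (_ + _)%E; rewrite -EFinM mulrN.
  rewrite limn_einf_shift // limn_einfN => H.
  have -> : (\int[mu]_(t in I2) F t = \int[mu]_(t in I2) limn_einf (f^~ t))%E.
    by apply: eq_integral => t; rewrite inE => /FE.
  apply: (le_trans H).
  (* The positive factor 2 pi is moved through the upper limit, again on each member of the
     filter. *)
  have h : ((2 * pi * psi w)%:E <= limn_esup (fun n => (2 * pi * Phi n w)%:E))%E.
    apply: le_ereal_inf_tmp => _ [V FV <-].
    have : ((psi w)%:E <= ereal_sup ((fun n => (Phi n w)%:E) @` V))%E.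
      by rewrite -psiE //; apply: ereal_inf_lbound; exists V.
    case E : (ereal_sup [set (2 * pi * Phi n w)%:E | n in V]) => [s| |]; rewrite ?leey //; last first.
      have [v Vv] := filter_ex FV.
      have : ((2 * pi * Phi v w)%:E <= -oo)%E by rewrite -E; apply: ereal_sup_ubound; exists v.
      by [].
    have pp : 0 < 2 * pi :> R by rewrite mulr_gt0.
    move=> h1; rewrite lee_fin mulrC -ler_pdivlMr // -lee_fin; apply: (le_trans h1).
    apply: ge_ereal_sup => _ [n Vn <-]; rewrite lee_fin ler_pdivlMr // mulrC -lee_fin -E.
    by apply: ereal_sup_ubound; exists n.
  rewrite mulrBr EFinB; exact: leeB.
have mF : measurable_fun I2 F.
  apply: (eq_measurable_fun (fun t => limn_einf (f^~ t))).
    by move=> t; rewrite inE => /FE.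
  have -> : (fun t => limn_einf (f^~ t)) = (fun t => - limn_esup (fun n => - f n t))%E by [].
  apply: measurableT_comp => //.
  apply: measurable_fun_limn_esup => n; exact: measurableT_comp.
have iF : mu.-integrable I2 F.
  apply/integrableP; split => //.
  have -> : (\int[mu]_(t in I2) `|F t| = \int[mu]_(t in I2) F t)%E.
    apply: eq_integral => t; rewrite inE => It; rewrite gee0_abs // lee_fin subr_ge0.
    by have /andP[] := psi_bounds eta0 (Heta t (I2P t It)).
  by rewrite (le_lt_trans intF) // ltry.
have ic : mu.-integrable I2 (cst B%:E).
  by have [] := integral_ctn (@ctn_cst _ B 0 (2 * pi)).
have E : (fun t => (psi (circle_pt w r t))%:E) = (fun t => B%:E - F t)%E.
  by apply/funext => t; rewrite /F -EFinB; congr (_%:E); ring.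
rewrite E; split; first exact: (integrableB mI2 ic iF).
have -> : (\int[mu]_(t in I2) (B%:E - F t) = \int[mu]_(t in I2) cst B%:E t - \int[mu]_(t in I2) F t)%E.
  exact: (integralB mI2 ic iF).
have -> : (\int[mu]_(t in I2) cst B%:E t = B%:E * mu I2)%E by exact: integral_cst.
rewrite mu_I2 -EFinM; move: intF; case: (\int[mu]_(t in I2) F t)%E => [s| |] //=.
  rewrite -EFinB !lee_fin mulrBr (mulrC B); lra.
by move=> _; rewrite addey // leey.
Qed.
End psi.

(** * Averages of logarithms over equally spaced radii *)

Section log_sum.
Variable R : realType.

(** The value of - ln at k / N, cut off to 0 at k = 0 and beyond N so that it is nonnegative and
    sums over any index range can be compared. *)
Definition lgap (N k : nat) : R := if (0 < k <= N)%N then ln N%:R - ln k%:R else 0.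

Lemma lgap_ge0 N k : 0 <= lgap N k.
Proof.
rewrite /lgap; case: ifP => // /andP[k0 kN].
by rewrite subr_ge0 ler_ln ?posrE ?ltr0n ?ler_nat // (leq_trans k0).
Qed.

(** This is N ln N - ln N! <= N; the induction step is N ln (1 + 1 / N) <= 1. *)
Lemma sum_lgap N : \sum_(k < N.+1) lgap N k <= N%:R.
Proof.
rewrite big_ord_recl {1}/lgap /= add0r.
have -> : \sum_(i < N) lgap N (lift ord0 i) = \sum_(i < N) (ln N%:R - ln i.+1%:R).
  by apply: eq_bigr => i _; rewrite /lgap /= ltn_ord.
rewrite sumrB sumr_const card_ord -[X in X - _]mulr_natl.
elim: N => [|N IH]; first by rewrite mul0r big_ord0 subr0.
rewrite big_ord_recr /=.
have [->|N0] := posnP N; first by rewrite big_ord0 add0r mul1r subrr.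
have n0 : 0 < N%:R :> R by rewrite ltr0n.
have : ln (1 + N%:R^-1) <= N%:R^-1 :> R.
  have i0 : 0 < N%:R^-1 :> R by rewrite invr_gt0.
  by apply: le_ln1Dx; lra.
have -> : 1 + N%:R^-1 = N.+1%:R / N%:R :> R.
  by rewrite -[N.+1]addn1 natrD mulrDl divff ?gt_eqF // mul1r.
rewrite ln_div ?posrE ?ltr0n // => h.
have : N%:R * (ln N.+1%:R - ln N%:R) <= 1 :> R.
  by have := ler_wpM2l (ltW n0) h; rewrite mulfV ?gt_eqF.
set L := ln N.+1%:R.
have -> : (N.+1)%:R = N%:R + 1 :> R by rewrite -[N.+1]addn1 natrD.
rewrite mulrDl mul1r mulrBr; lra.
Qed.

Lemma sum_lgap_le N m : \sum_(k < m) lgap N k <= N%:R.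
Proof.
apply: le_trans (sum_lgap N); have [mN|Nm] := leqP m N.+1.
  rewrite (big_ord_widen N.+1 (fun k => lgap N k) mN) big_mkcond /=; apply: ler_sum => i _.
  by case: ifP => // _; exact: lgap_ge0.
elim: m Nm => // m IH; rewrite ltnS leq_eqVlt big_ord_recr /= => /predU1P[<-|Nm].
  by rewrite [X in _ + X]/lgap ltnn andbF addr0.
by rewrite [X in _ + X]/lgap (leqNgt m) (ltnW Nm) andbF addr0 IH.
Qed.

(** Truncated subtraction sends the indices up to m to 0, where [lgap] vanishes, so only those to
    the right of m count; [sum_lgap_left] is the mirror image. *)
Lemma sum_lgap_right N m M : \sum_(i < M) lgap N (i - m) <= N%:R.
Proof.
apply: le_trans (sum_lgap_le N M); elim: m M => [|m IH] M.
  by apply: ler_sum => i _; rewrite subn0.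
case: M => [|M]; first by rewrite !big_ord0.
rewrite big_ord_recl /= sub0n {1}/lgap /= add0r big_ord_recr /= ler_wpDr ?lgap_ge0 //.
exact: IH.
Qed.

Lemma sum_lgap_left N m M : \sum_(i < M) lgap N (m - i.+1) <= N%:R.
Proof.
apply: le_trans (sum_lgap_le N m).
have -> : \sum_(k < m) lgap N k = \sum_(i < m) lgap N (m - i.+1).
  by rewrite (reindex_inj rev_ord_inj); apply: eq_bigr => i _.
have [Mm|mM] := leqP M m.
  rewrite (big_ord_widen m (fun i => lgap N (m - i.+1)) Mm) big_mkcond /=.
  by apply: ler_sum => i _; case: ifP => // _; exact: lgap_ge0.
rewrite (big_ord_widen M (fun i => lgap N (m - i.+1)) (ltnW mM)) [leRHS]big_mkcond /=.
apply: ler_sum => i _; case: ifP => // /negbT; rewrite -leqNgt => mi.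
by rewrite (eqP (leqW mi : (m - i.+1 == 0)%N)) /lgap.
Qed.

Lemma sum_indicator (m M : nat) (c : R) (s : nat -> nat) : 0 <= c -> injective s ->
  \sum_(i < M) c * (s i == m)%:R <= c.
Proof.
move=> c0 si; case: (boolP [exists i : 'I_M, s i == m]) => [/existsP[i /eqP im]|/existsPn H].
  rewrite (bigD1 i) //= im eqxx mulr1 big1 ?addr0 // => j ji.
  rewrite -im; case: eqP => [/si /val_inj e|]; last by rewrite mulr0.
  by rewrite e eqxx in ji.
by rewrite big1 // => i _; rewrite (negbTE (H i)) mulr0.
Qed.

(* y is at distance at least tau k / N from all but two of the radii tau i / N. *)
Lemma avg_radii (y tau eta : R) (n : nat) (h : nat -> R) : 0 <= y -> 0 < tau -> 0 < eta ->
  (forall j, (j <= n)%N -> eta <= h j) ->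
  (forall j, (j <= n)%N -> `|y - j.+1%:R * tau / n.+1%:R| <= h j) ->
  avg (fun j => - ln (h j)) n <= - ln tau + 2 + 2 * Num.max 0 (ln tau - ln eta) / n.+1%:R.
Proof.
move=> y0 tau0 eta0 heta hy; set N := n.+1; set c := Num.max _ _.
have N0 : 0 < N%:R :> R by rewrite ltr0n.
have c0 : 0 <= c by rewrite le_max lexx.
pose s := y * N%:R / tau; pose m := Num.truncn s.
have s0 : 0 <= s by rewrite /s divr_ge0 ?mulr_ge0 // ltW.
have /andP[ms sm] : m%:R <= s < m.+1%:R.
  by rewrite /m; apply: truncn_itv.
have yE : y = s * (tau / N%:R) by rewrite /s; field; rewrite !gt_eqF.
have tN : 0 < tau / N%:R by rewrite divr_gt0.
(* In units of tau / N the position s of y lies in [m, m + 1) and the j-th radius is j + 1. Their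
   distance is at least j - m on the right and m - (j + 1) on the left. The two radii m and m + 1
   next to s have only the lower bound eta and cost c each; the two [lgap] sums give the constant
   2. *)
have key j : (j < N)%N -> - ln (h j) <= - ln tau +
   (lgap N (j - m) + lgap N (m - j.+1) + (c * (j.+1 == m)%:R + c * (j == m)%:R)).
  rewrite ltnS => jn.
  have hj0 : 0 < h j by apply: lt_le_trans (heta j jn).
  have far k : (0 < k)%N -> (k%:R <= s - j.+1%:R) \/ (k%:R <= j.+1%:R - s) ->
     - ln (h j) <= - ln tau + (ln N%:R - ln k%:R).
    move=> k0 H; have kp : 0 < k%:R :> R by rewrite ltr0n.
    have : tau / N%:R * k%:R <= h j.
      apply: le_trans (hy j jn); rewrite yE.
      have -> : s * (tau / N%:R) - j.+1%:R * tau / N%:R = (tau / N%:R) * (s - j.+1%:R) by ring.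
      rewrite normrM (gtr0_norm tN) ler_pM2l // ler_normr opprB.
      by case: H => ->; rewrite ?orbT.
    rewrite -ler_ln ?posrE ?mulr_gt0 ?invr_gt0 // !lnM ?posrE ?mulr_gt0 ?invr_gt0 // lnV ?posrE //.
    lra.
  have pos1 := lgap_ge0 N (j - m); have pos2 := lgap_ge0 N (m - j.+1).
  have [jm|mj|jm] := ltngtP j m.
  - have [jm1|mj1|jm1] := ltngtP j.+1 m; last first.
    + rewrite /= mulr1 mulr0 addr0 (_ : j.+1 = m) //.
      have : c >= ln tau - ln eta by rewrite le_max lexx orbT.
      have : ln eta <= ln (h j) by rewrite ler_ln ?posrE // heta.
      rewrite jm1 in pos2 *; lra.
    + by rewrite ltnS leqNgt jm in mj1.
    rewrite !mulr0 !addr0.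
    have k0 : (0 < m - j.+1)%N by rewrite subn_gt0.
    have H := far _ k0 (or_introl _).
    have : - ln (h j) <= - ln tau + lgap N (m - j.+1).
      rewrite /lgap k0 /=; case: leqP => [kN|Nk].
        by apply: H; rewrite natrB ?(ltnW jm1) // lerB.
      apply: (le_trans (H _)); first by rewrite natrB ?(ltnW jm1) // lerB.
      by rewrite lerD2l subr_le0 ler_ln ?posrE ?ltr0n // ler_nat ltnW.
    lra.
  - have k0 : (0 < j - m)%N by rewrite subn_gt0.
    have H : - ln (h j) <= - ln tau + lgap N (j - m).
      rewrite /lgap k0 /= (leq_trans (leq_subr _ _)) ?(leqW jn) //.
      apply: far => //; right; rewrite natrB ?(ltnW mj) // -[j.+1]addn1 natrD.
      by move: sm; rewrite -[m.+1]addn1 natrD; lra.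
    have e0 : 0 <= c * (j.+1 == m)%:R by rewrite mulr_ge0.
    rewrite mulr0; lra.
  - have e0 : 0 <= c * (j.+1 == m)%:R by rewrite mulr_ge0.
    have : c >= ln tau - ln eta by rewrite le_max lexx orbT.
    have : ln eta <= ln (h j) by rewrite ler_ln ?posrE // heta.
    rewrite /= mulr1; lra.
rewrite /avg -/N ler_pdivrMl //.
apply: (@le_trans _ _ (\sum_(j < N) (- ln tau +
   (lgap N (j - m) + lgap N (m - j.+1) + (c * (j.+1 == m)%:R + c * (nat_of_ord j == m)%:R))))).
  by apply: ler_sum => j _; apply: key; exact: ltn_ord.
rewrite big_split /= sumr_const card_ord -[X in X + _ <= _]mulr_natl !big_split /=.
have S1 := sum_lgap_right N m N; have S2 := sum_lgap_left N m N.
have S3 := @sum_indicator m N c S c0 succn_inj.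
have S4 := @sum_indicator m N c id c0 (fun _ _ e => e).
have -> : N%:R * (- ln tau + 2 + 2 * c / N%:R) = N%:R * - ln tau + (N%:R + N%:R + (c + c)).
  by field; rewrite gt_eqF.
by rewrite lerD2l; apply: lerD; apply: lerD.
Qed.
End log_sum.

(** * A competitor for the Green function *)

Section competitor.
Variable R : realType.
Notation mu := (@lebesgue_measure R).
Variables (D : set R[i]) (z p : R[i]) (tau : R) (E : R -> R[i]).
Hypothesis Dop : open D.
Hypothesis Dz : D z.
Hypothesis tau0 : 0 < tau.
Hypothesis tau_le : tau <= nc (z - p).
Hypothesis EP : forall r, 0 < r <= tau -> ~ D (E r) /\ nc (E r - p) = r.
Implicit Types (w x : R[i]).

Let del := nc (z - p).
Let del0 : 0 < del. Proof. exact: lt_le_trans tau_le. Qed.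

(** The index is capped at n to keep the radius in (0, tau] for all pairs n, j, as the construction
    of [psi] requires; the averages only use j <= n. *)
Definition radius (n j : nat) : R := (minn j n).+1%:R * tau / n.+1%:R.
Lemma radiusP n j : 0 < radius n j <= tau.
Proof.
have n0 : 0 < n.+1%:R :> R by rewrite ltr0n.
rewrite /radius divr_gt0 ?mulr_gt0 ?ltr0n //= ler_pdivrMr // mulrC ler_pM2l //.
by rewrite ler_nat ltnS geq_minr.
Qed.
Definition epts n j : R[i] := E (radius n j).
Lemma eptsD n j : ~ D (epts n j). Proof. by case: (EP (radiusP n j)). Qed.
Lemma epts_nc n j : nc (epts n j - p) = radius n j. Proof. by case: (EP (radiusP n j)). Qed.
Lemma epts_le n j : nc (epts n j - p) <= tau.
Proof. by rewrite epts_nc; case/andP: (radiusP n j). Qed.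

Notation ps := (psi epts).

(** The averages are at most - ln tau + 2 + 2 c / (n + 1), where c depends on x; the last term is
    eventually at most 1, so the upper limit has a bound independent of x. *)
Lemma psi_near x : D x -> ps x <= - ln tau + 3.
Proof.
move=> Dx; have [eta eta0 H] := (openC_P D).1 Dop x Dx.
apply: (psi_le Dop eptsD tau0 epts_le) => //.
set c := Num.max 0 (ln tau - ln eta).
have c0 : 0 <= c by rewrite le_max lexx.
have H1 n : Phi epts n x <= - ln tau + 2 + 2 * c / n.+1%:R.
  apply: (@avg_radii _ (nc (x - p))) => //; first exact: nc_ge0.
    by move=> j _; exact: (dist_e eptsD n j H).
  move=> j jn; have := nc_lip (x - p) (epts n j - p).
  rewrite epts_nc /radius (minn_idPl jn) => /le_trans; apply.
  by rewrite opprB addrA subrK.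
exists (Num.truncn (2 * c)).+1 => // n /= hn.
rewrite (le_trans (H1 n)) // -lerBrDl.
have -> : - ln tau + 3 - (- ln tau + 2) = 1 by ring.
rewrite ler_pdivrMr ?ltr0n // mul1r ltW // (lt_le_trans (truncnS_gt _)) // ler_nat.
exact: leqW.
Qed.

Lemma psi_far x : D x -> 2 * tau <= nc (x - p) -> ps x <= - ln (nc (x - p) / 2).
Proof.
move=> Dx far; have y0 : 0 < nc (x - p) by apply: lt_le_trans far; rewrite mulr_gt0.
apply: (psi_le Dop eptsD tau0 epts_le) => //; apply: nearW => n; apply: avg_le => j.
have h : nc (x - p) / 2 <= nc (x - epts n j).
  have := nc_dist_triangle (epts n j) x p; have := epts_le n j; lra.
rewrite lerN2 ler_ln ?posrE ?divr_gt0 //.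
by rewrite (lt_le_trans _ h) // divr_gt0.
Qed.

(** Makes [ucomp] negative: for |x - p| < 2 del one has |x - z| <= 3 del, and the 4 exceeds the 3 of
    [psi_near]. Farther away |x - z| <= 3 |x - p| / 2, so the growth of the logarithm cancels
    against [psi_far], and ln tau <= ln del does the rest. *)
Definition ucst : R := ln (3 * del) - ln tau + 4.
Definition ucomp x : \bar R := (lne (nc (x - z))%:E + (ps x - ucst)%:E)%E.

Lemma ucomp_pole : ucomp z = -oo%E.
Proof. by rewrite /ucomp subrr Normc.normc0 le0_lneNy // addNye. Qed.
Lemma ucompE x : x != z -> ucomp x = (ln (nc (x - z)) + (ps x - ucst))%:E.
Proof. by move=> xz; rewrite /ucomp lne_nc_neq0 // subr_eq0. Qed.

Lemma ucomp_lt0 x : D x -> (ucomp x < 0)%E.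
Proof.
move=> Dx; have [->|xz] := eqVneq x z; first by rewrite ucomp_pole.
rewrite ucompE // lte_fin.
have n0 : 0 < nc (x - z) by rewrite nc_gt0 subr_eq0.
have tri := nc_dist_triangle p x z; rewrite (ncC p) -/del in tri.
have lnd : ln tau <= ln del by rewrite ler_ln ?posrE.
have l3 : ln (3 * del) = ln 3 + ln del by rewrite lnM ?posrE.
have [near|far] := ltP (nc (x - p)) (2 * del).
  have := psi_near Dx.
  have : ln (nc (x - z)) <= ln (3 * del) by rewrite ler_ln ?posrE ?mulr_gt0 //; lra.
  rewrite /ucst; lra.
have y0 : 0 < nc (x - p) by apply: lt_le_trans far; rewrite mulr_gt0.
have h1 : ps x <= - ln (nc (x - p) / 2).
  by apply: psi_far => //; apply: le_trans far; rewrite ler_pM2l.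
have : ln (nc (x - z)) <= ln (3 * (nc (x - p) / 2)).
  by rewrite ler_ln ?posrE ?mulr_gt0 ?divr_gt0 //; lra.
rewrite lnM ?posrE ?divr_gt0 // /ucst; lra.
Qed.

Lemma ucomp_pole_bound :
  exists C : R, \forall x \near z, (ucomp x <= lne (nc (x - z))%:E + C%:E)%E.
Proof.
have [eta eta0 H] := (openC_P D).1 Dop z Dz.
exists (ps z - ln (1 - 2^-1) - ucst); apply/nbhsC_P; exists (eta / 2); first by rewrite divr_gt0.
move=> x xz; rewrite /ucomp leeD2l // lee_fin lerD2r.
apply: (psi_local Dop eptsD tau0 epts_le eta0 H).
- by apply/andP; split; lra.
- by rewrite mulrC ltW.
- apply: H; lra.
Qed.

Lemma ucomp_usc : upper_semicontinuous_on D ucomp.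
Proof.
move=> w a Dw; have [eta eta0 H] := (openC_P D).1 Dop w Dw.
have loc k x : 0 < k < 1 -> nc (x - w) <= k * eta -> D x -> ps x <= ps w - ln (1 - k).
  by move=> k01; exact: (psi_local Dop eptsD tau0 epts_le eta0 H).
have [wz|wz] := eqVneq w z.
  move=> _; apply/nbhsC_P.
  pose B := ps w - ln (1 - 2^-1) - ucst.
  exists (Num.min (eta / 2) (expR (a - B))); first by rewrite lt_min divr_gt0 // expR_gt0.
  move=> x; rewrite lt_min => /andP[x1 x2] Dx.
  have [->|xz] := eqVneq x z; first by rewrite ucomp_pole ltNyr.
  rewrite ucompE // lte_fin.
  have : ps x <= ps w - ln (1 - 2^-1).
    by apply: loc => //; [apply/andP; split; lra|rewrite mulrC ltW].
  have : ln (nc (x - z)) < a - B.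
    rewrite -ltr_expR lnK ?posrE; first by rewrite -wz.
    by rewrite nc_gt0 subr_eq0.
  rewrite /B; lra.
rewrite ucompE // lte_fin => ua.
pose g := a - (ln (nc (w - z)) + (ps w - ucst)).
have g0 : 0 < g by rewrite subr_gt0.
have n0 : 0 < nc (w - z) by rewrite nc_gt0 subr_eq0.
(* k = 1 - e^(-g/3) makes - ln (1 - k) = g / 3 *)
pose k := 1 - expR (- (g / 3)).
have k01 : 0 < k < 1.
  rewrite /k subr_gt0 expR_lt1 ltrBlDr ltrDl expR_gt0 andbT oppr_lt0 divr_gt0 //.
have lk : ln (1 - k) = - (g / 3) by rewrite /k opprB addrC subrK expRK.
have [k0 k1] := andP k01.
have e0 : 0 < nc (w - z) * (expR (g / 3) - 1).
  by rewrite mulr_gt0 // subr_gt0 expR_gt1 divr_gt0.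
apply/nbhsC_P; exists (Num.min (k * eta) (nc (w - z) * (expR (g / 3) - 1))).
  by rewrite lt_min mulr_gt0.
move=> x; rewrite lt_min => /andP[x1 x2] Dx.
have [->|xz] := eqVneq x z; first by rewrite ucomp_pole ltNyr.
rewrite ucompE // lte_fin.
have h1 : ps x <= ps w + g / 3 by have := loc k x k01 (ltW x1) Dx; rewrite lk opprK.
have h2 : ln (nc (x - z)) <= ln (nc (w - z)) + g / 3.
  rewrite -[g / 3]expRK -lnM ?posrE ?expR_gt0 //.
  rewrite ler_ln ?posrE ?mulr_gt0 ?expR_gt0 ?nc_gt0 ?subr_eq0 //.
  have := nc_dist_triangle w x z; move: x2; rewrite mulrBr mulr1; lra.
have : g = a - (ln (nc (w - z)) + (ps w - ucst)) by [].
lra.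
Qed.

Lemma ucomp_mean w (r : R) : 0 < r -> [set x | nc (x - w) <= r] `<=` D ->
  (ucomp w <= circle_mean ucomp w r)%E.
Proof.
move=> r0 HD; have [->|wz] := eqVneq w z; first by rewrite ucomp_pole leNye.
have pi0 := pi_gt0 R; have pp : 0 < 2 * pi :> R by rewrite mulr_gt0.
have [i1 m1] := lne_circle_mean r0 wz.
have [i2 m2] := psi_mean Dop eptsD tau0 epts_le r0 HD.
pose I2 : set R := `[0%R, (2 * pi)%R]%classic.
have mI2 : measurable (I2 : set (measurableTypeR R)) by exact: measurable_itv.
have i3 : mu.-integrable I2 (cst (- ucst)%:E).
  by have [] := integral_ctn (@ctn_cst _ (- ucst) 0 (2 * pi)).
have i23 := integrableD mI2 i2 i3.
rewrite /circle_mean ucompE //.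
have -> : (\int[mu]_(t in I2) ucomp (circle_pt w r t) =
   \int[mu]_(t in I2) (lne (nc (circle_pt w r t - z))%:E +
      ((ps (circle_pt w r t))%:E + cst (- ucst)%:E t)))%E.
  by apply: eq_integral => t _.
rewrite (integralD mI2 i1 i23) (integralD mI2 i2 i3).
have -> : (\int[mu]_(t in I2) cst (- ucst)%:E t = (- ucst)%:E * mu I2)%E by exact: integral_cst.
rewrite mu_I2 -EFinM.
have H : ((2 * pi * ln (nc (w - z)))%:E + ((2 * pi * ps w)%:E + (- ucst * (2 * pi))%:E) <=
  \int[mu]_(t in I2) lne (nc (circle_pt w r t - z))%:E +
   (\int[mu]_(t in I2) (ps (circle_pt w r t))%:E + (- ucst * (2 * pi))%:E))%E.
  by apply: leeD => //; apply: leeD.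
apply: (@le_trans _ _ ((2 * pi)^-1%:E * ((2 * pi * ln (nc (w - z)))%:E +
    ((2 * pi * ps w)%:E + (- ucst * (2 * pi))%:E)))%E).
  rewrite -!EFinD -EFinM lee_fin le_eqVlt; apply/orP; left; apply/eqP.
  by move: pp; move: (2 * pi) => P P0; field; rewrite gt_eqF.
by apply: lee_wpmul2l => //; rewrite lee_fin invr_ge0 ltW.
Qed.

Lemma ucomp_competitor : green_competitor D z ucomp.
Proof.
split; last exact: ucomp_pole_bound.
  split.
  - by move=> w /ucomp_lt0 /lt_trans; apply; rewrite ltry.
  - exact: ucomp_usc.
  - exact: ucomp_mean.
exact: ucomp_lt0.
Qed.

(** The exponential of - ln (3 del) - [ucst], where - ln (3 del) is a lower bound for [psi] near z;
    hence the square of 3 del in the denominator. *)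
Definition acst : R := tau * expR (- 4) / (9 * del ^+ 2).
Lemma acst_gt0 : 0 < acst.
Proof. by rewrite divr_gt0 ?mulr_gt0 ?expR_gt0 ?exprn_gt0. Qed.

Lemma azukawa_ge X : ((acst * nc X)%:E <= azukawa D z X)%E.
Proof.
have [->|X0] := eqVneq X 0.
  rewrite Normc.normc0 mulr0; apply: limf_esup_ge.
  by apply: nearW => t; rewrite /= mule_ge0 ?expeR_ge0 // inve_ge0 lee_fin nc_ge0.
have nX : 0 < nc X by rewrite nc_gt0.
have [eta eta0 H] := (openC_P D).1 Dop z Dz.
apply: limf_esup_ge; rewrite /dnbhs /within; apply/nbhsC_P.
(* The first term keeps z + t X in D; the second gives |z + t X - p| + tau <= 3 del. *)
exists (Num.min (eta / nc X) (del / nc X)); first by rewrite lt_min !divr_gt0.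
move=> t; rewrite subr0 lt_min => /andP[t1 t2] t0.
have nt : 0 < nc t by rewrite nc_gt0.
rewrite ltr_pdivlMr // -ncM in t1; rewrite ltr_pdivlMr // -ncM in t2.
set x := z + t * X.
have xzE : x - z = t * X by rewrite /x addrC addKr.
have Dx : D x by apply: H; rewrite xzE.
have xz : x != z by rewrite -subr_eq0 xzE mulf_neq0.
have [ex ex0 Hx] := (openC_P D).1 Dop x Dx.
have /andP[ps1 _] := psi_bounds eptsD tau0 epts_le ex0 Hx.
have h1 : - ln (3 * del) <= ps x.
  apply: le_trans ps1; rewrite lerN2 ler_ln ?posrE ?mulr_gt0 //.
    by have := nc_dist_triangle z x p; rewrite xzE -/del; have := tau_le; rewrite -/del; lra.
  by rewrite ltr_wpDl ?nc_ge0.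
have g1 : (ucomp x <= green D z x)%E.
  by apply: ereal_sup_ubound; exists ucomp => //; exact: ucomp_competitor.
have g2 : ((acst * nc X * nc t)%:E <= expeR (green D z x))%E.
  apply: (@le_trans _ _ (expeR (ucomp x))); last by rewrite lee_expeR.
  rewrite ucompE //= lee_fin expRD lnK ?posrE ?nc_gt0 ?subr_eq0 // xzE ncM.
  rewrite (_ : acst * nc X * nc t = nc t * nc X * acst); last by ring.
  rewrite ler_pM2l ?mulr_gt0 //.
  have -> : acst = expR (- ln (3 * del) - ucst).
    rewrite /ucst /acst !opprD opprK !expRD !expRN lnK ?posrE ?mulr_gt0 // lnK ?posrE //.
    by field; rewrite !gt_eqF // expR_gt0.
  by rewrite ler_expR lerD2r.
rewrite /= -/x; case: (green D z x) g2 => [s| |] //=.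
- by rewrite inver gt_eqF // -EFinM !lee_fin ler_pdivlMr.
- by move=> _; rewrite inver gt_eqF // gt0_mulye ?leey // lte_fin invr_gt0.
- by rewrite lee_fin => h; have := lt_le_trans (mulr_gt0 (mulr_gt0 acst_gt0 nX) nt) h; rewrite ltxx.
Qed.
End competitor.

(** * Area of a bounded indicatrix *)

Section area.
Variable R : realType.
Notation mu := (@lebesgue_measure R).
Notation RR := (measurableTypeR R * measurableTypeR R)%type.

(* No measurability is required of A: integrals of nonnegative functions and
   lebesgue_measure are monotone on arbitrary functions and sets. *)
Lemma lambdaC_le (A : set R[i]) (M : R) : 0 < M -> A `<=` [set X | nc X < M] ->
  (lambdaC A <= ((2 * M) ^+ 2)%:E)%E.
Proof.
move=> M0 AM; pose J : set R := `[- M, M]%classic.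
have mJ : measurable (J : set (measurableTypeR R)) by exact: measurable_itv.
have muJ : mu J = (2 * M)%:E.
  by rewrite /J lebesgue_measure_itv /= lte_fin gtrN // -EFinB opprK mulr_natl mulr2n.
have mono (f g : measurableTypeR R -> \bar R) : (forall x, 0 <= f x)%E -> (forall x, f x <= g x)%E ->
    (\int[mu]_x f x <= \int[mu]_x g x)%E.
  move=> f0 fg; rewrite ge0_integralTE // ge0_integralTE //.
    apply: ereal_sup_le => _ [h hf <-]; exists h => // x; exact: le_trans (hf x) (fg x).
  by move=> x; apply: le_trans (fg x).
have -> : ((2 * M) ^+ 2)%:E = ((@lebesgue_measure R \x @lebesgue_measure R) (J `*` J : set RR))%E.
  by rewrite product_measure1E // [X in (X * _)%E]muJ [X in (_ * X)%E]muJ -EFinM expr2.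
rewrite /lambdaC /product_measure1; apply: mono => // x /=.
apply: le_outer_measure.
move=> y; rewrite /xsection /= !inE /= => /AM /= h.
have := Re_le_nc (pair_complex (x, y)); have := Im_le_nc (pair_complex (x, y)).
rewrite /= => h1 h2; split; rewrite /J /= in_itv /= -ler_norml; apply: ltW.
  exact: le_lt_trans h2 h.
exact: le_lt_trans h1 h.
Qed.
End area.

(** * Components of the complement *)

Section sphere.
Variable R : realType.
Notation S := (one_point_compactification R[i]).
Implicit Types (p w : R[i]) (r : R) (C : set S).

Lemma pair_complex_continuous : continuous (@pair_complex R : R * R -> R[i]).
Proof.
move=> [x y] P /nbhsC_P [e e0 He]; apply/nbhs_ballP; exists (e / 2); first by rewrite /= divr_gt0.
move=> [u v] [/=]; rewrite /ball /= => h1 h2; apply: He.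
rewrite (le_lt_trans (nc_le_ReIm _)) // ReB ImB /= distrC [X in _ + X]distrC.
exact: half_sum h1 h2.
Qed.

Lemma square_compact p r :
  compact [set w : R[i] | cheb w p <= r].
Proof.
pose K : set (R * R) := `[complex.Re p - r, complex.Re p + r]%classic `*`
  `[complex.Im p - r, complex.Im p + r]%classic.
have -> : [set w : R[i] | cheb w p <= r] = @pair_complex R @` K.
  apply/seteqP; split => [w|_ [q [/= h1 h2] <-]].
    rewrite /= /cheb ge_max !ler_distl => /andP[h1 h2].
    exists (complex.Re w, complex.Im w); last by case: (w).
    by split; rewrite /= in_itv.
  by move: h1 h2; rewrite !in_itv /= -!ler_distl => h1 h2; rewrite /cheb ge_max /= h1 h2.
apply: continuous_compact.
  by apply: continuous_subspaceT => q; exact: pair_complex_continuous.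
by apply: compact_setX; exact: segment_compact.
Qed.

Lemma cheb_triangle w z p : cheb z p <= cheb w z + cheb w p.
Proof.
rewrite {1}/cheb ge_max; apply/andP; split.
  rewrite (le_trans (ler_distD (complex.Re w) _ _)) // lerD //.
    by rewrite distrC /cheb le_max lexx.
  by rewrite /cheb le_max lexx.
rewrite (le_trans (ler_distD (complex.Im w) _ _)) // lerD //.
  by rewrite distrC /cheb le_max lexx orbT.
by rewrite /cheb le_max lexx orbT.
Qed.

Lemma square_closed p r : closed [set w : R[i] | cheb w p <= r].
Proof.
rewrite -[X in closed X]setCK; apply: open_closedC; apply/openC_P => z /= /negP; rewrite -ltNge => h.
exists (cheb z p - r) => [|w wz]; first by rewrite subr_gt0.
apply/negP; rewrite -ltNge.
have := cheb_triangle w z p; have := cheb_nc w z; lra.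
Qed.

Lemma nbhs_S_some p (U : set S) (e : R) : 0 < e -> (forall w, nc (w - p) < e -> U (Some w)) ->
  nbhs (Some p : S) U.
Proof.
move=> e0 H; change (nbhs p (Some @^-1` U)).
by apply/nbhsC_P; exists e.
Qed.

(** Neighbourhoods of infinity are given by complements of closed compact sets; squares are used
    because their compactness is that of a product of segments. *)
Lemma nbhs_S_none p (U : set S) r : U None -> (forall w, r < nc (w - p) -> U (Some w)) ->
  nbhs (None : S) U.
Proof.
move=> UN H; exists [set w : R[i] | cheb w p <= r].
  by split; [exact: square_compact|exact: square_closed].
move=> s [[w /= /negP]|->//]; rewrite -ltNge => h <-.
by apply: H; apply: (lt_le_trans h); exact: cheb_nc.
Qed.

(** A set missing the circle would be separated by the open disc and the open exterior. The exterior
    V contains the point at infinity vacuously, so q may be infinite. *)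
Lemma connected_hits_circle C p (q : S) r : connected C -> C (Some p) -> C q -> 0 < r ->
  (forall w, q = Some w -> r < nc (w - p)) -> exists2 e, C (Some e) & nc (e - p) = r.
Proof.
move=> Cc Cp Cq r0 qr; apply: contrapT => /forall2NP H.
have nr w : C (Some w) -> nc (w - p) != r.
  by move=> Cw; apply/eqP => e; case: (H w) => [/(_ Cw)|/(_ e)].
pose U : set S := [set s | exists2 w, s = Some w & nc (w - p) < r].
pose V : set S := [set s | forall w, s = Some w -> r < nc (w - p)].
have Uop : open U.
  rewrite openE => _ [w -> wr]; apply: (@nbhs_S_some w _ (r - nc (w - p))); first by rewrite subr_gt0.
  move=> u uw; exists u => //; rewrite (le_lt_trans (nc_dist_triangle w u p)) //.
  by rewrite -ltrBrDr.
have Vop : open V.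
  rewrite openE => -[w|] Vs; last by apply: (@nbhs_S_none p _ r) => // w h _ [<-].
  have wr : r < nc (w - p) by exact: Vs.
  apply: (@nbhs_S_some w _ (nc (w - p) - r)); first by rewrite subr_gt0.
  move=> u uw _ [<-]; have := nc_dist_triangle u w p; rewrite (ncC w u); lra.
have E : C `&` U = C `&` ~` V.
  apply/seteqP; split => [s [Cs [w sw wr]]|s [Cs Vs]]; split => //.
    by move=> /(_ w sw) h; have := lt_trans wr h; rewrite ltxx.
  case: s Cs Vs => [w|] Cs Vs; last by case: Vs.
  exists w => //; rewrite lt_neqAle nr //= leNgt; apply/negP => h; apply: Vs => _ [<-].
  exact: h.
have : C `&` U = C.
  apply: Cc.
  - by exists (Some p); split => //; exists p => //; rewrite subrr Normc.normc0.
  - by exists U.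
  - by exists (~` V); [exact: open_closedC|].
move=> CU; have : (C `&` U) q by rewrite CU.
by move=> [_ [w qw wr]]; have := lt_trans wr (qr w qw); rewrite ltxx.
Qed.
End sphere.

Section components.
Variable R : realType.
Notation S := (one_point_compactification R[i]).
Implicit Types (p w : R[i]) (r M : R) (E : set S).

Definition nondegenerate E := exists a b, [/\ E a, E b & a <> b].
(* E contains the point at infinity or is unbounded *)
Definition far_reaching E := forall M, exists2 q : S, E q & forall w, q = Some w -> M < nc w.

Lemma far_reaching_hits E p r : connected E -> E (Some p) -> far_reaching E -> 0 < r ->
  exists2 e, E (Some e) & nc (e - p) = r.
Proof.
move=> Ec Ep Eb r0; have [q Eq Hq] := Eb (r + nc p).
apply: (connected_hits_circle Ec Ep Eq r0) => w /Hq h.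
have := nc_dist_triangle p w 0; rewrite !subr0; lra.
Qed.

(** One number bounds both the position and, by its inverse, the extent seen from any point. Both
    parts survive enlarging M, so finitely many sets can share it. *)
Definition bounded_by M E := (forall w, E (Some w) -> nc w <= M) /\
  (forall w, E (Some w) -> exists2 v, E (Some v) & M^-1 < nc (v - w)).

Lemma bounded_byW M N E : 0 < M -> M <= N -> bounded_by M E -> bounded_by N E.
Proof.
move=> M0 MN [h1 h2]; split => [w /h1 /le_trans|w /h2[v Ev hv]]; first exact.
exists v => //; apply: le_lt_trans hv; rewrite lef_pV2 ?posrE //; exact: lt_le_trans MN.
Qed.

(** Of two distinct points of E, one is at least half their distance away from w; the 4 in the
    witness makes the inequality strict. *)
Lemma exists_bounded_by E : nondegenerate E -> ~ far_reaching E -> exists2 M, 0 < M & bounded_by M E.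
Proof.
move=> [a [b [Ea Eb ab]]] /existsNP[M1 /forall2NP HM].
have fin q : E q -> exists2 w, q = Some w & nc w <= M1.
  move=> Eq; have [//|/existsNP[w /not_implyP[qw h]]] := HM q.
  by exists w => //; rewrite leNgt; apply/negP.
have [a' aE _] := fin a Ea; have [b' bE _] := fin b Eb.
have d0 : 0 < nc (a' - b').
  by rewrite nc_gt0 subr_eq0; apply/eqP => e; apply: ab; rewrite aE bE e.
have i0 : 0 < 4 / nc (a' - b') by rewrite divr_gt0.
exists (Num.max (Num.max 1 M1) (4 / nc (a' - b'))); first by rewrite !lt_max ltr01.
set M := Num.max _ _; have MM : 4 / nc (a' - b') <= M by rewrite le_max lexx orbT.
split => [w Ew|w Ew]; first by have [w' [->] h] := fin _ Ew; rewrite !le_max h orbT.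
have iM : M^-1 <= nc (a' - b') / 4.
  by rewrite -[leRHS]invrK invf_div lef_pV2 ?posrE // (lt_le_trans i0).
have tri := nc_dist_triangle w a' b'; rewrite (ncC w) in tri.
have [h|h] := ltP (M^-1) (nc (a' - w)); first by exists a' => //; rewrite -aE.
by exists b'; [rewrite -bE|lra].
Qed.

(** Provides the lower bound 1 / M for tau that does not depend on the component nearest to z. *)
Lemma uniform_bounded_by (EE : set (set S)) : finite_set EE ->
  exists2 M, 0 < M & forall E, EE E -> nondegenerate E -> ~ far_reaching E -> bounded_by M E.
Proof.
move=> /finite_seqP[s ->]; elim: s => [|E s [M M0 IH]]; first by exists 1.
have [[nE bE]|nb] := pselect (nondegenerate E /\ ~ far_reaching E).
  have [N N0 HN] := exists_bounded_by nE bE.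
  exists (Num.max M N); first by rewrite lt_max M0.
  move=> E' /=; rewrite inE => /predU1P[-> _ _|E's nE' bE'].
    by apply: bounded_byW HN => //; rewrite le_max lexx orbT.
  by apply: bounded_byW (IH _ E's nE' bE') => //; rewrite le_max lexx.
exists M => // E' /=; rewrite inE => /predU1P[-> ? ?|]; last exact: IH.
by case: nb.
Qed.

Variable D : set R[i].
Definition comp (w : R[i]) : set S := connected_component (sphere_compl D) (Some w).

Lemma sphere_complP w : sphere_compl D (Some w) <-> ~ D w.
Proof.
split => [H Dw|nDw [v Dv [e]]]; first by apply: H; exists w.
by apply: nDw; rewrite -e.
Qed.
Lemma comp_self w : ~ D w -> comp w (Some w).
Proof. by move=> /sphere_complP; exact: connected_component_refl. Qed.
Lemma comp_connected w : connected (comp w).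
Proof. exact: component_connected. Qed.
Lemma comp_out w v : comp w (Some v) -> ~ D v.
Proof. by move=> /connected_component_sub /sphere_complP. Qed.

(** The one-point components inject into the finite set of all components. *)
Lemma degenerate_points : finitely_connected D ->
  exists s : seq R[i], forall w, ~ D w -> w \in s \/ nondegenerate (comp w).
Proof.
move=> fin.
pose P := [set w : R[i] | ~ D w /\ comp w = [set Some w]].
have : finite_set P.
  have : finite_set ((fun w => [set (Some w : S)]) @` P).
    by apply: sub_finite_set fin => _ [w [Dw cw] <-]; exists (Some w) => //; exact/sphere_complP.
  move=> /(finite_preimage (f := fun w => [set (Some w : S)])) H.
  apply: (sub_finite_set _ (H _)) => [w Pw|w v _ _ /(congr1 (fun A => A (Some w))) /= e].
    by exists w.
  by have ev : Some w = Some v; [rewrite -e | case: ev].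
move=> /finite_seqP[s sE]; exists s => w nDw.
have [e|ne] := pselect (comp w = [set Some w]).
  left; have : P w by split.
  by rewrite sE.
right; apply: contrapT => H; apply: ne; apply/seteqP; split => [q cq|_ ->]; last exact: comp_self.
by apply: contrapT => qw; apply: H; exists q, (Some w); split => //; exact: comp_self.
Qed.
End components.

(** * From a Green competitor to the estimate *)

Section conclusion.
Variable R : realType.
Implicit Types (D : set R[i]) (z w p : R[i]) (r c k tau : R).
Notation mu2 := (@lebesgue_measure R \x @lebesgue_measure R)%E.

Definition admissible D (f : R[i] -> R[i]) := holomorphic D f /\
  (integralC D (fun w => ((nc (f w)) ^+ 2)%:E) <= 1)%E.

Lemma admissible_cderiv D f : admissible D f ->
  (forall w, D w -> exists l, cderiv f w l) /\
  (\int[mu2]_q (sqnorm_on D f q)%:E <= 1%:E)%E.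
Proof.
by move=> [h1 h2]; split => [w /h1 /derivable_cderiv//|]; rewrite -integralC_sqnorm_on.
Qed.

Definition estimate D c z :=
  (lambdaC (azukawa_indicatrix D z) = +oo%E -> bergman_kernel D z = 0%E) /\
  ((lambdaC (azukawa_indicatrix D z) < +oo)%E ->
   (bergman_kernel D z <= c%:E / lambdaC (azukawa_indicatrix D z))%E).

Lemma lambdaC_ge0 (A : set R[i]) : (0 <= lambdaC A)%E.
Proof. by apply: integral_ge0 => x _; exact: measure_ge0. Qed.

Lemma estimate_zero D c z : 0 < c -> (forall f, admissible D f -> nc (f z) = 0) -> estimate D c z.
Proof.
move=> c0 H; have K0 : bergman_kernel D z = 0%E.
  apply/le_anti/andP; split.
    by apply: ge_ereal_sup => _ [f /H -> <-]; rewrite expr0n.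
  apply: ereal_sup_ubound; exists (cst 0); last by rewrite Normc.normc0 expr0n.
  split; first by move=> w _; exact: derivable_cst.
  rewrite /integralC; under eq_integral do rewrite Normc.normc0 expr0n /=.
  by rewrite integral0.
split => // _; rewrite K0; apply: mule_ge0; first by rewrite lee_fin ltW.
by rewrite inve_ge0 lambdaC_ge0.
Qed.

(** With a = [acst], the indicatrix lies in the disc of radius 1 / a, of measure at most (2 / a)^2,
    while the kernel is at most k^2. The squared expression in the last hypothesis is k (2 / a). *)
Lemma estimate_competitor D c z p tau k : 0 < c -> open D -> D z -> 0 < tau -> tau <= nc (z - p) ->
  (forall r, 0 < r <= tau -> exists2 e, ~ D e & nc (e - p) = r) ->
  (forall f, admissible D f -> nc (f z) <= k) -> 0 <= k ->
  (k * (18 * expR 4 * nc (z - p) ^+ 2 / tau)) ^+ 2 <= c -> estimate D c z.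
Proof.
move=> c0 Dop Dz tau0 tle hit Hk k0 kc.
have [E EP] : exists E : R -> R[i], forall r, 0 < r <= tau -> ~ D (E r) /\ nc (E r - p) = r.
  have H r : exists e, 0 < r <= tau -> ~ D e /\ nc (e - p) = r.
    by case: (boolP (0 < r <= tau)) => [/hit[e]|_]; [exists e|exists 0].
  by have [E HE] := choice H; exists E.
set a := acst z p tau; have a0 : 0 < a by exact: acst_gt0.
have d0 : 0 < nc (z - p) by exact: lt_le_trans tle.
have sub : azukawa_indicatrix D z `<=` [set X | nc X < a^-1].
  move=> X /= /(le_lt_trans (azukawa_ge Dop Dz tau0 tle EP X)).
  by rewrite lte_fin -ltr_pdivlMl // mulr1.
have ia : 0 < a^-1 by rewrite invr_gt0.
have lam := lambdaC_le ia sub.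
have lam0 := lambdaC_ge0 (azukawa_indicatrix D z).
have Kk : (bergman_kernel D z <= (k ^+ 2)%:E)%E.
  apply: ge_ereal_sup => _ [f /Hk h <-]; rewrite lee_fin ler_pXn2r ?nnegrE //; exact: nc_ge0.
have aE : 2 * a^-1 = 18 * expR 4 * nc (z - p) ^+ 2 / tau.
  by rewrite /a /acst expRN; field; rewrite !gt_eqF // expR_gt0.
split => [e|_]; first by rewrite e in lam.
move: lam lam0; case: (lambdaC _) => [s| |] //; rewrite !lee_fin => sl s0.
(* For an indicatrix of measure 0 the right-hand side is +oo, as the extended inverse of 0. *)
have [->|sn] := eqVneq s 0; first by rewrite inve0 gt0_muley ?leey // lte_fin.
have sp : 0 < s by rewrite lt_neqAle eq_sym sn.
apply: (le_trans Kk); rewrite inver (negbTE sn) -EFinM lee_fin ler_pdivlMr //.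
apply: le_trans kc; rewrite -aE exprMn; apply: ler_wpM2l => //.
by rewrite sqr_ge0.
Qed.
End conclusion.

(** * Choice of the pole and of tau according to the position of z *)

Section casework.
Variable R : realType.
Implicit Types (D : set R[i]) (z w p : R[i]) (r c k tau L M : R).

Definition fat D w := ~ D w /\ nondegenerate (comp D w).
(** The factor 2 replaces an attained minimum, so closedness of the fat part need not be shown. *)
Definition nearest D z p := fat D p /\ forall w, fat D w -> nc (z - p) <= 2 * nc (z - w).

Lemma nc_gt0_out D z p : D z -> ~ D p -> 0 < nc (z - p).
Proof. by move=> Dz Dp; rewrite nc_gt0 subr_eq0; apply: contra_notN Dp => /eqP <-. Qed.

Lemma exists_nearest D z : open D -> D z -> (exists w, fat D w) -> exists p, nearest D z p.
Proof.
move=> Dop Dz [w0 Fw0]; pose A := [set nc (z - w) | w in fat D].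
have [e e0 He] := (openC_P D).1 Dop z Dz.
have eA : lbound A e.
  move=> _ [w [nDw _] <-]; rewrite leNgt; apply/negP => h; apply: nDw; apply: He; by rewrite ncC.
have hA : has_inf A by split; [exists (nc (z - w0)), w0|exists e].
have I0 : e <= inf A by apply: lb_le_inf => //; exact: hA.1.
have I1 : 0 < inf A by lra.
have [_ [p Fp <-] hp] := inf_adherent I1 hA.
exists p; split => // w Fw; have : inf A <= nc (z - w).
  by apply: ge_inf; [exact: hA.2|exists w].
lra.
Qed.

(** With d = |z - p| and r = d / 8, the square of half-width 2 r around z stays within distance 4 r
    = d / 2, which no fat point enters. The constant is 24 times 8. *)
Lemma admissible_bound_nearest D z p (P : seq R[i]) f : open D -> D z ->
  (forall w, ~ D w -> w \in P \/ nondegenerate (comp D w)) -> nearest D z p ->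
  admissible D f -> nc (f z) <= 192 / nc (z - p).
Proof.
move=> Dop Dz HP [[nDp _] Hp] /admissible_cderiv[fd f1].
have d0 := nc_gt0_out Dz nDp.
have -> : 192 / nc (z - p) = 24 / (nc (z - p) / 8) by field; rewrite gt_eqF.
apply: (L2_mean_bound (P := P) Dop fd f1 Dz); first by rewrite divr_gt0.
move=> w w1 w2 wP; apply: contrapT => nDw; case: (HP w nDw) => [wP'|nd].
  by rewrite wP' in wP.
have := Hp w (conj nDw nd); rewrite (ncC z w); have := nc_le_ReIm (w - z).
rewrite ReB ImB; lra.
Qed.

Lemma hits_nearest_small D p M r : ~ D p -> bounded_by M (comp D p) -> 0 < r <= M^-1 ->
  exists2 e, ~ D e & nc (e - p) = r.
Proof.
move=> nDp [_ /(_ p (comp_self nDp))[v Cv hv]] /andP[r0 rM].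
have [|e Ce er] := connected_hits_circle (@comp_connected _ D p) (comp_self nDp) Cv r0.
  by move=> w [<-]; exact: le_lt_trans hv.
by exists e => //; exact: comp_out Ce.
Qed.

Lemma hits_far_reaching D p r : ~ D p -> far_reaching (comp D p) -> 0 < r ->
  exists2 e, ~ D e & nc (e - p) = r.
Proof.
move=> nDp far r0.
have [e Ce er] := far_reaching_hits (@comp_connected _ D p) (comp_self nDp) far r0.
by exists e => //; exact: comp_out Ce.
Qed.

Definition Acst : R := 192 * (18 * expR 4).
Lemma Acst_gt0 : 0 < Acst. Proof. by rewrite !mulr_gt0 // expR_gt0. Qed.

(* The constants of [L2_mean_bound] and of [estimate_competitor] multiply to
   [Acst * d / tau] at distance [d]. *)
Lemma estimate_tau D z p tau t c (q : R[i]) : open D -> D z -> 0 < tau -> tau <= nc (z - q) ->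
  0 < nc (z - p) ->
  (forall r, 0 < r <= tau -> exists2 e, ~ D e & nc (e - q) = r) ->
  (forall f, admissible D f -> nc (f z) <= 192 / nc (z - p)) ->
  nc (z - q) ^+ 2 <= t * (tau * nc (z - p)) -> (Acst * t) ^+ 2 <= c -> 0 < c -> estimate D c z.
Proof.
move=> Dop Dz tau0 tle d0 hit Hk ht kc c0.
have k0 : 0 <= 192 / nc (z - p) by rewrite divr_ge0 // ltW.
apply: (estimate_competitor c0 Dop Dz tau0 tle hit Hk k0).
have tp : 0 < tau * nc (z - p) by rewrite mulr_gt0.
have t0 : 0 <= t by rewrite -(pmulr_lge0 _ tp) (le_trans _ ht) // sqr_ge0.
apply: le_trans kc; rewrite ler_pXn2r ?nnegrE //.
- have -> : 192 / nc (z - p) * (18 * expR 4 * nc (z - q) ^+ 2 / tau) =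
     Acst * (nc (z - q) ^+ 2 / (tau * nc (z - p))).
    by rewrite /Acst; field; rewrite !gt_eqF.
  by rewrite ler_pM2l ?Acst_gt0 // ler_pdivrMr.
- apply: mulr_ge0 => //; apply: divr_ge0; last exact: ltW.
  by apply: mulr_ge0; [apply: mulr_ge0 => //; exact: expR_ge0|exact: sqr_ge0].
- by apply: mulr_ge0 => //; apply: ltW; exact: Acst_gt0.
Qed.

Lemma estimate_far_reaching D z p c : open D -> D z -> ~ D p -> far_reaching (comp D p) ->
  (forall f, admissible D f -> nc (f z) <= 192 / nc (z - p)) ->
  Acst ^+ 2 <= c -> 0 < c -> estimate D c z.
Proof.
move=> Dop Dz nDp far Hk kc c0; have d0 := nc_gt0_out Dz nDp.
apply: (@estimate_tau D z p (nc (z - p)) 1 c p) => //.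
- by move=> r /andP[r0 _]; exact: hits_far_reaching.
- by rewrite mul1r expr2.
- by rewrite mulr1.
Qed.

(** For tau the minimum of d and 1 / M, the quotient d / tau is at most 1 + L M as long as d <=
    L. *)
Lemma estimate_bounded D z p c L M : open D -> D z -> ~ D p -> 0 < M -> bounded_by M (comp D p) ->
  (forall f, admissible D f -> nc (f z) <= 192 / nc (z - p)) -> nc (z - p) <= L ->
  (Acst * (1 + L * M)) ^+ 2 <= c -> 0 < c -> estimate D c z.
Proof.
move=> Dop Dz nDp M0 bM Hk dL kc c0; have d0 := nc_gt0_out Dz nDp.
have iM : 0 < M^-1 by rewrite invr_gt0.
have L0 : 0 < L by exact: lt_le_trans dL.
have LM : 0 < L * M by rewrite mulr_gt0.
apply: (@estimate_tau D z p (Num.min (nc (z - p)) M^-1) (1 + L * M) c p) => //.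
- by rewrite lt_min d0.
- by rewrite ge_min lexx.
- move=> r /andP[r0 rt]; apply: (hits_nearest_small nDp bM).
  by rewrite r0 (le_trans rt) // ge_min lexx orbT.
- rewrite mulrA expr2 ler_pM2r //.
  case: (leP (nc (z - p)) M^-1) => _; first by apply: ler_peMl; [exact: ltW|rewrite lerDl ltW].
  by rewrite mulrDl mul1r mulfK ?gt_eqF //; lra.
Qed.
End casework.

Theorem proposition4 (R : realType) (D : set R[i]) :
  domain D -> finitely_connected D ->
  exists c : R, 0 < c /\ forall z : R[i], D z ->
    (lambdaC (azukawa_indicatrix D z) = +oo%E -> bergman_kernel D z = 0%E) /\
    ((lambdaC (azukawa_indicatrix D z) < +oo)%E ->
     (bergman_kernel D z <= c%:E / lambdaC (azukawa_indicatrix D z))%E).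
Proof.
move=> [_ Dop _] fin; have [P HP] := degenerate_points fin.
have [M M0 HM] := uniform_bounded_by fin.
have bM w : fat D w -> ~ far_reaching (comp D w) -> bounded_by M (comp D w).
  by move=> [nDw nd]; apply: HM => //; exists (Some w) => //; exact/sphere_complP.
suff [c [c0 H]] : exists c, 0 < c /\ forall z, D z -> estimate D c z.
  by exists c; split => // z /H[].
have A0 := Acst_gt0 R; set A := Acst R in A0.
have sqpos (t : R) : 0 < t -> 0 < (A * t) ^+ 2 by move=> t0; rewrite exprn_gt0 // mulr_gt0.
have sqmono (s t : R) : 0 < s -> s <= t -> (A * s) ^+ 2 <= (A * t) ^+ 2.
  move=> s0 st; have tp := lt_le_trans s0 st.
  by rewrite ler_pXn2r ?nnegrE ?ler_pM2l //; apply: mulr_ge0; exact: ltW.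
have [ex|nex] := pselect (exists w, fat D w); last first.
  exists 1; split => // z Dz; apply: estimate_zero => // f /admissible_cderiv[fd f1].
  apply/eqP; rewrite eq_le nc_ge0 andbT; apply/ler_addgt0Pr => e e0; rewrite add0r.
  have r0 : 0 < 24 / e by rewrite divr_gt0.
  have -> : e = 24 / (24 / e) by field; rewrite gt_eqF.
  apply: (L2_mean_bound (P := P) Dop fd f1 Dz r0) => w _ _ wP.
  apply: contrapT => nDw; case: (HP w nDw) => [wP'|nd]; first by rewrite wP' in wP.
  by apply: nex; exists w.
have kb z p f : D z -> nearest D z p -> admissible D f -> nc (f z) <= 192 / nc (z - p).
  by move=> Dz; exact: admissible_bound_nearest Dop Dz HP.
have [[q [[nDq _] farq]]|nfar] := pselect (exists q, fat D q /\ far_reaching (comp D q)).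
  (* If p lies in a bounded component and |z - p| > L, then |z - q| <= |z - p| + |p| + |q| <= 2 |z -
     p|. *)
  pose L := M + nc q; have L0 : 0 < L by rewrite ltr_wpDr ?nc_ge0.
  have LM : 0 < L * M by rewrite mulr_gt0.
  exists ((A * (4 + L * M)) ^+ 2); split; first by apply: sqpos; lra.
  move=> z Dz; have [p Np] := exists_nearest Dop Dz ex.
  have [Fp _] := Np; have [nDp _] := Fp; have d0 := nc_gt0_out Dz nDp.
  have [farp|nfarp] := pselect (far_reaching (comp D p)).
    apply: (estimate_far_reaching Dop Dz nDp farp) => [f /kb h||]; first exact: h.
      by rewrite -[Acst R]mulr1; apply: sqmono; lra.
    by apply: sqpos; lra.
  have bp := bM _ Fp nfarp.
  have [dL|Ld] := leP (nc (z - p)) L.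
    apply: (estimate_bounded Dop Dz nDp M0 bp _ dL) => [f /kb h||]; first exact: h.
      by apply: sqmono; lra.
    by apply: sqpos; lra.
  have dq := nc_gt0_out Dz nDq.
  (* Two different points are used: p bounds the kernel, while the competitor is built at q, whose
     component meets every circle around q, so that tau can be the full distance |z - q|. *)
  apply: (@estimate_tau R D z p (nc (z - q)) 2 _ q) => //.
  - by move=> r /andP[r0 _]; exact: hits_far_reaching.
  - by move=> f /kb h; exact: h.
  - rewrite expr2 mulrCA ler_pM2l //.
    have := nc_dist_triangle p z q; have := ncB p q.
    by have := bp.1 _ (comp_self nDp); move: Ld; rewrite /L; lra.
  - by apply: sqmono; lra.
  - by apply: sqpos; lra.
have [r0 [r00 Mr0 Pr0]] : exists r0, [/\ 0 < r0, M <= r0 & forall w, w \in P -> nc w <= r0].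
  elim: (P) => [|w s [r [r0 Mr Hr]]]; first by exists M.
  exists (Num.max r (nc w)); split; rewrite ?lt_max ?le_max ?r0 ?Mr //.
  by move=> v; rewrite inE le_max => /predU1P[->|/Hr ->//]; rewrite lexx orbT.
have bd w : ~ D w -> nc w <= r0.
  move=> nDw; case: (HP w nDw) => [/Pr0 //|nd]; have Fw : fat D w by [].
  have nf : ~ far_reaching (comp D w) by move=> h; apply: nfar; exists w.
  exact: le_trans ((bM _ Fw nf).1 _ (comp_self nDw)) Mr0.
have iM : 0 < M^-1 by rewrite invr_gt0.
(* For |z - p| > L one gets |z| > 8 r0, hence [cheb z 0] > 4 r0 as the exterior bound requires, and
   also tau = 1 / M < |z - p|. *)
pose L := 8 * r0 + M + M^-1; have L0 : 0 < L by rewrite /L; lra.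
have LM : 0 < L * M by rewrite mulr_gt0.
have rM : 0 < r0 * M by rewrite mulr_gt0.
(* The part 1 + L M serves the points z within L of p and 9 r0 M the distant ones, where 9 is the
   square of the ratio 3 between |z - p| and [cheb z 0]. *)
exists ((A * (1 + L * M + 9 * (r0 * M))) ^+ 2); split; first by apply: sqpos; lra.
move=> z Dz; have [p Np] := exists_nearest Dop Dz ex.
have [Fp _] := Np; have [nDp _] := Fp; have d0 := nc_gt0_out Dz nDp.
have nf : ~ far_reaching (comp D p) by move=> h; apply: nfar; exists p.
have bp := bM _ Fp nf.
have [dL|Ld] := leP (nc (z - p)) L.
  apply: (estimate_bounded Dop Dz nDp M0 bp _ dL) => [f /kb h||]; first exact: h.
    by apply: sqmono; lra.
  by apply: sqpos; lra.
have pM := bp.1 _ (comp_self nDp).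
have m4 : 4 * r0 < cheb z 0.
  have := ncB z p; have := nc_cheb z 0; rewrite subr0; move: Ld; rewrite /L; lra.
have d3 : nc (z - p) <= 3 * cheb z 0.
  have := ncB z p; have := nc_cheb z 0; rewrite subr0; lra.
have m0 : 0 < cheb z 0 by lra.
have m20 : 0 < cheb z 0 ^+ 2 by rewrite exprn_gt0.
apply: (@estimate_competitor R D _ z p M^-1 (192 * r0 / cheb z 0 ^+ 2)) => //.
- by apply: sqpos; lra.
- by apply: ltW; apply: le_lt_trans Ld; rewrite /L; lra.
- by move=> r; exact: hits_nearest_small.
- move=> f /admissible_cderiv[fd f1]; apply: (L2_exterior_bound Dop fd f1) => // w hw.
  apply: contrapT => /bd h; have := Re_le_nc w; have := Im_le_nc w.
  by case: hw; lra.
- by rewrite divr_ge0 ?mulr_ge0 // ltW.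
rewrite ler_pXn2r ?nnegrE.
- have -> : 192 * r0 / cheb z 0 ^+ 2 * (18 * expR 4 * nc (z - p) ^+ 2 / M^-1) =
     A * (r0 * M * (nc (z - p) ^+ 2 / cheb z 0 ^+ 2)).
    by rewrite /A /Acst; field; rewrite !gt_eqF.
  rewrite ler_pM2l //; have : nc (z - p) ^+ 2 / cheb z 0 ^+ 2 <= 9.
    rewrite ler_pdivrMr // -[9](_ : 3 ^+ 2 = 9); last by ring.
    by rewrite -exprMn ler_pXn2r ?nnegrE ?nc_ge0 // mulr_ge0 // ltW.
  move=> h9; apply: (le_trans (ler_wpM2l (ltW rM) h9)).
  by rewrite (mulrC _ 9) lerDr addr_ge0 // ltW.
- by [].
- apply: mulr_ge0; first by apply: divr_ge0; [apply: mulr_ge0 => //; exact: ltW|exact: ltW].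
  apply: divr_ge0; last exact: ltW.
  by apply: mulr_ge0; [apply: mulr_ge0 => //; exact: expR_ge0|exact: sqr_ge0].
- apply: mulr_ge0; first exact: ltW.
  by apply: addr_ge0; [apply: addr_ge0 => //; exact: ltW|apply: mulr_ge0 => //; exact: ltW].
Qed.
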